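(* If $P$ is a grid polygon, then $$\operatorname{perim}(P)\geq \frac{7}{2}\operatorname{cyc}(P)-\frac{3}{2}.$$
   Context: Consider the infinite triangular grid in the plane, scaled so that each equilateral triangular grid cell has side length $1$ and oriented so that some of the grid lines are horizontal. The sides of the grid cells are called panes. A grid polygon is a (not necessarily convex) polygon (the closed region, including its boundary) whose boundary is a union of panes; the boundary, viewed as a closed curve, does not intersect itself. Let $P$ be a grid polygon with boundary panes $b_1,\ldots,b_n$, listed clockwise. From the midpoint of a boundary pane $b_i$, emit a beam of light into the interior of $P$ so that the beam forms a $60^\circ$ angle with $b_i$ and travels either northeast (direction $60^\circ$), southeast (direction $-60^\circ$), or west (direction $180^\circ$), depending on the orientation of $b_i$ (exactly one of these three directions satisfies the requirements). The beam travels in a straight line through the interior of $P$ until reaching the midpoint of a different boundary pane $b_{\pi(i)}$, which it meets at a $60^\circ$ angle. This defines a permutation $\pi=\pi_P\colon[n]\to[n]$, where $[n]=\{1,\ldots,n\}$, called the billiards permutation of $P$. $\operatorname{perim}(P)$ denotes the number $n$ of boundary panes of $P$. $\operatorname{cyc}(P)$ denotes the number of cycles of $\pi_P$. *)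

(* Defs.v *)
From HB Require Import structures.
From mathcomp Require Import all_boot all_order all_fingroup all_algebra.
From mathcomp Require Import finmap zify.

Set Implicit Arguments.
Unset Strict Implicit.
Unset Printing Implicit Defensive.

Import Order.TTheory GRing.Theory Num.Theory.
Local Open Scope fset_scope.
Local Open Scope ring_scope.

(* The integer vector (a, b) stands for the point or displacement             *)
(* a * (1, 0) + b * (1/2, sqrt 3 / 2) of the Euclidean plane, so that the     *)
(* vertices of the triangular grid are exactly the integer vectors.           *)
Definition vec : Type := (int * int)%type.

(* Twice the Euclidean inner product; in particular a unit vector u has       *)
(* dot2 u u = 2.                                                              *)
Definition dot2 (u v : vec) : int :=
  2 * (u.1 * v.1) + 2 * (u.2 * v.2) + u.1 * v.2 + u.2 * v.1.

(* The Euclidean cross product u x v divided by sqrt 3 / 2: negative iff v    *)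
(* points to the right of u.                                                  *)
Definition cross (u v : vec) : int := u.1 * v.2 - u.2 * v.1.

(* For unit vectors: the lines spanned by u and v form a 60 degree angle,     *)
(* i.e. |<u, v>| = cos 60.                                                    *)
Definition angle60 (u v : vec) : bool := `|dot2 u v| == 1.

Definition northeast : vec := (0, 1).
Definition southeast : vec := (1, -1).
Definition west : vec := (-1, 0).
Definition beam_directions : seq vec := [:: northeast; southeast; west].

(* (p, true) is the upward-pointing grid cell whose lower left corner is p;   *)
(* (p, false) is the downward-pointing cell sharing its northwest-southeast   *)
(* side with (p, true).                                                       *)
Definition cell : Type := (vec * bool)%type.

Definition corners (c : cell) : seq vec :=
  let: (p, up) := c in
  [:: p + (1, 0); p + (0, 1); if up then p else p + (1, 1)].

(* Midpoints of panes are stored with doubled coordinates: the midpoint of    *)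
(* the pane with endpoints x and y is x + y.                                  *)
Definition midpoints (c : cell) : seq vec :=
  [seq xy.1 + xy.2 | xy <- zip (corners c) (rot 1 (corners c))].

(* The segment xy is a pane lying on the boundary of the union of S: it is a  *)
(* side of exactly one cell of S.                                             *)
Definition boundary_pane (S : {fset cell}) (x y : vec) : bool :=
  (x != y) &&
  (#|` [fset c in S | (x \in corners c) && (y \in corners c)] | == 1%N).

(* A grid polygon is a nonempty finite union of closed grid cells whose       *)
(* boundary is one closed curve without self-intersections. The vertices of   *)
(* this curve are listed clockwise, i.e. with the polygon on the right, and   *)
(* the i-th boundary pane joins bvertex i to its cyclic successor.            *)
Record grid_polygon : Type := GridPolygon {
  cells : {fset cell};
  perim : nat;
  bvertex : 'I_perim -> vec;
  cells_neq0 : cells != fset0;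
  bvertex_inj : injective bvertex;
  boundaryP : forall x y : vec,
    boundary_pane cells x y <->
    exists i : 'I_perim, (x, y) = (bvertex i, bvertex (ordS i)) \/
                         (y, x) = (bvertex i, bvertex (ordS i));
  clockwise : forall (i : 'I_perim) (c : cell), c \in cells ->
    bvertex i \in corners c -> bvertex (ordS i) \in corners c ->
    forall z : vec, z \in corners c ->
    cross (bvertex (ordS i) - bvertex i) (z - bvertex i) <= 0
}.

Definition pane_vector (P : grid_polygon) (i : 'I_(perim P)) : vec :=
  bvertex (ordS i) - bvertex i.
Definition pane_midpoint (P : grid_polygon) (i : 'I_(perim P)) : vec :=
  bvertex i + bvertex (ordS i).

(* Some cell of P contains the segment between the (doubled) pane midpoints   *)
(* m and m', which is then a midline of that cell.                            *)
Definition lit (P : grid_polygon) (m m' : vec) : bool :=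
  has (fun c => (m \in midpoints c) && (m' \in midpoints c)) (cells P).

(* In doubled coordinates, a beam in direction d that is at the midpoint m of *)
(* a pane next meets the grid at the midpoint m + d of another pane. As every *)
(* segment of the beam runs inside P, no pane strictly between the i-th and   *)
(* the j-th one is on the boundary, whereas the j-th one is.                  *)
Definition beam_along (P : grid_polygon) (i j : 'I_(perim P))
    (d : vec) (k : nat) : bool :=
  [&& d \in beam_directions, angle60 d (pane_vector i), (0 < k)%N,
      pane_midpoint j == pane_midpoint i + d *+ k
    & [forall l : 'I_k,
        lit P (pane_midpoint i + d *+ l) (pane_midpoint i + d *+ l.+1)]].

Definition beam (P : grid_polygon) (i j : 'I_(perim P)) : Prop :=
  exists (d : vec) (k : nat), beam_along i j d k.

Lemma addvE (a b c d : int) : (a, b) + (c, d) = (a + c, b + d) :> vec.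
Proof. by []. Qed.
Lemma subvE (a b c d : int) : (a, b) - (c, d) = (a - c, b - d) :> vec.
Proof. by []. Qed.
Lemma mulvE (a b : int) k : (a, b) *+ k = (a *+ k, b *+ k) :> vec.
Proof. by elim: k => // k IH; rewrite !mulrS IH. Qed.

Lemma in_corners (a b x y : int) (up : bool) :
  ((x, y) \in corners ((a, b), up)) =
  [|| (x == a + 1) && (y == b), (x == a) && (y == b + 1)
    | if up then (x == a) && (y == b) else (x == a + 1) && (y == b + 1)].
Proof. by case: up; rewrite /corners !inE !xpair_eqE ?addr0. Qed.

Lemma in_midpoints (a b x y : int) (up : bool) :
  ((x, y) \in midpoints ((a, b), up)) =
  if up then
    [|| (x == a + a + 1) && (y == b + b + 1), (x == a + a + 1) && (y == b + b)
      | (x == a + a) && (y == b + b + 1)]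
  else
    [|| (x == a + a + 1) && (y == b + b + 1), (x == a + a + 2) && (y == b + b + 1)
      | (x == a + a + 1) && (y == b + b + 2)].
Proof.
case: up; rewrite /midpoints /= !inE !xpair_eqE !addvE /=; lia.
Qed.

Lemma beam_dirE (d : vec) : d \in beam_directions ->
  [\/ d = northeast, d = southeast | d = west].
Proof.
by rewrite !inE => /or3P[] /eqP->; [constructor 1|constructor 2|constructor 3].
Qed.

Ltac split_hyps := repeat match goal with
  | h : is_true (_ || _) |- _ => case/orP: h => h
  | h : is_true (_ && _) |- _ => case/andP: h => ? ?
  | h : is_true (?x == ?y :> int) |- _ =>
      move/eqP: h => h; (subst x || subst y || idtac)
  end.

Lemma pane_mid (c : cell) (x y : vec) : x != y ->
  x \in corners c -> y \in corners c -> x + y \in midpoints c.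
Proof.
case: c x y => [[a b] u] [x1 x2] [y1 y2].
rewrite xpair_eqE !in_corners addvE in_midpoints.
by case: u => n h1 h2; split_hyps; lia.
Qed.

Lemma mid_pane (c c' : cell) (x y : vec) : x != y ->
  x \in corners c' -> y \in corners c' -> x + y \in midpoints c ->
  (x \in corners c) && (y \in corners c).
Proof.
case: c c' x y => [[a b] u] [[a' b'] u'] [x1 x2] [y1 y2].
rewrite xpair_eqE !in_corners addvE in_midpoints.
by case: u; case: u' => n h1 h2 h3; split_hyps; lia.
Qed.

Lemma mid_inj (c c' : cell) (x y x' y' : vec) : x != y -> x' != y' ->
  x \in corners c -> y \in corners c ->
  x' \in corners c' -> y' \in corners c' -> x + y = x' + y' ->
  x = x' /\ y = y' \/ x = y' /\ y = x'.
Proof.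
move=> nxy nxy' hx hy hx' hy' e.
have /andP[gx gy] : (x' \in corners c) && (y' \in corners c).
  by apply: (mid_pane nxy' hx' hy'); rewrite -e pane_mid.
clear hx' hy' c'.
have: ((x == x') && (y == y')) || ((x == y') && (y == x')).
  case: c x y x' y' nxy nxy' hx hy gx gy e =>
    [[a b] u] [x1 x2] [y1 y2] [x1' x2'] [y1' y2'].
  rewrite !xpair_eqE !in_corners !addvE => n n' hx hy gx gy [e1 e2].
  case: u hx hy gx gy => /or3P[]/andP[/eqP? /eqP?] /or3P[]/andP[/eqP? /eqP?];
    subst; try (by move: n; rewrite !eqxx);
    move=> /or3P[]/andP[/eqP? /eqP?] /or3P[]/andP[/eqP? /eqP?]; subst;
    try (by move: n'; rewrite !eqxx); clear n n'; lia.
by case/orP => /andP[/eqP-> /eqP->]; [left|right].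
Qed.

Lemma mid_dirF (c : cell) (m d d' : vec) :
  d \in beam_directions -> d' \in beam_directions ->
  m \in midpoints c -> m + d \in midpoints c -> m + d' \in midpoints c ->
  d = d'.
Proof.
case: c m => [[a b] u] [x y] /beam_dirE[]-> /beam_dirE[]->;
  rewrite // !addvE !in_midpoints; case: u => h1 h2 h3; split_hyps; lia.
Qed.

Lemma mid_dirB (c : cell) (m m' d d' : vec) :
  d \in beam_directions -> d' \in beam_directions ->
  m \in midpoints c -> m' \in midpoints c ->
  m + d = m' + d' -> m + d \in midpoints c -> d = d'.
Proof.
case: c m m' => [[a b] u] [x y] [x' y'] /beam_dirE[]-> /beam_dirE[]->;
  rewrite // !addvE => h h' [e1 e2]; move: h h' e1 e2;
  rewrite !in_midpoints; case: u => h1 h2 h3 h4 h5; split_hyps; lia.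
Qed.

Lemma mid_ex (c : cell) (m : vec) : m \in midpoints c ->
  exists2 d, d \in beam_directions & m + d \in midpoints c.
Proof.
case: c m => [[a b] u] [x y] h.
have: (x, y) + northeast \in midpoints ((a, b), u) \/
      (x, y) + southeast \in midpoints ((a, b), u) \/
      (x, y) + west \in midpoints ((a, b), u).
  by move: h; rewrite !addvE !in_midpoints; case: u => h; split_hyps; lia.
by case=> [|[]] g; [exists northeast|exists southeast|exists west].
Qed.

Lemma mid_line (c : cell) (m d : vec) : d \in beam_directions ->
  m \in midpoints c -> m + d \in midpoints c -> m + d + d \notin midpoints c.
Proof.
case: c m => [[a b] u] [x y] /beam_dirE[]->; rewrite !addvE !in_midpoints;
  case: u => h1 h2; split_hyps; lia.
Qed.

Lemma mid_step (c c' : cell) (m d : vec) : d \in beam_directions ->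
  c != c' -> m \in midpoints c -> m + d \in midpoints c ->
  m + d \in midpoints c' -> m + d + d \in midpoints c'.
Proof.
case: c c' m => [[a b] u] [[a' b'] u'] [x y] /beam_dirE[]->;
  rewrite !xpair_eqE !addvE !in_midpoints;
  case: u; case: u' => n h1 h2 h3; split_hyps; lia.
Qed.

Lemma mid_angle (c : cell) (x y d : vec) : d \in beam_directions -> x != y ->
  x \in corners c -> y \in corners c -> x + y + d \in midpoints c ->
  angle60 d (y - x).
Proof.
case: c x y => [[a b] u] [x1 x2] [y1 y2] /beam_dirE[]->;
  rewrite xpair_eqE !in_corners !subvE !addvE in_midpoints /angle60 /dot2 /=;
  case: u => n h1 h2 h3; split_hyps; lia.
Qed.

Lemma mid_ex_pane (c : cell) (m : vec) : m \in midpoints c ->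
  exists x y, [/\ x != y, x \in corners c, y \in corners c & m = x + y].
Proof.
case: c m => [[a b] u] [x y]; rewrite in_midpoints => hm.
have wit (x1 x2 y1 y2 : int) : x = x1 + y1 -> y = x2 + y2 ->
    [&& (x1, x2) != (y1, y2), (x1, x2) \in corners (a, b, u)
      & (y1, y2) \in corners (a, b, u)] ->
    exists p q, [/\ p != q, p \in corners (a, b, u), q \in corners (a, b, u)
                  & (x, y) = p + q].
  by move=> -> -> /and3P[]; exists (x1, x2), (y1, y2).
case: u hm wit => /or3P[]/andP[/eqP hx /eqP hy] wit.
- by apply: (wit (a + 1) b a (b + 1)); rewrite ?xpair_eqE ?in_corners; lia.
- by apply: (wit (a + 1) b a b); rewrite ?xpair_eqE ?in_corners; lia.
- by apply: (wit a (b + 1) a b); rewrite ?xpair_eqE ?in_corners; lia.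
- by apply: (wit (a + 1) b a (b + 1)); rewrite ?xpair_eqE ?in_corners; lia.
- by apply: (wit (a + 1) b (a + 1) (b + 1)); rewrite ?xpair_eqE ?in_corners;
    lia.
- by apply: (wit a (b + 1) (a + 1) (b + 1)); rewrite ?xpair_eqE ?in_corners;
    lia.
Qed.

Lemma third_corner (c : cell) (x y : vec) : x != y ->
  x \in corners c -> y \in corners c ->
  exists2 z, z \in corners c &
    ~~ ((cross (y - x) (z - x) <= 0) && (cross (x - y) (z - y) <= 0)).
Proof.
case: c x y => [[a b] u] [x1 x2] [y1 y2].
pose z : vec := (3 * a + (if u then 1 else 2) - x1 - y1,
                 3 * b + (if u then 1 else 2) - x2 - y2).
rewrite xpair_eqE !in_corners => n h1 h2; exists z; rewrite /z.
  by rewrite in_corners; case: u h1 h2 {z} => h1 h2; split_hyps; lia.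
by rewrite !subvE /cross /=; case: u h1 h2 {z} => h1 h2; split_hyps; lia.
Qed.

Section Billiards.
Variable P : grid_polygon.
Implicit Types i j : 'I_(perim P).

Lemma litP (m m' : vec) :
  reflect (exists c, [/\ c \in cells P, m \in midpoints c & m' \in midpoints c])
          (lit P m m').
Proof.
apply: (iffP hasP) => [[c cP /andP[h h']]|[c [cP h h']]]; exists c => //.
by rewrite h h'.
Qed.

Lemma bpane i : boundary_pane (cells P) (bvertex i) (bvertex (ordS i)).
Proof. by apply/boundaryP; exists i; left. Qed.

Lemma bpane_cell i : exists c,
  [/\ c \in cells P, bvertex i \in corners c, bvertex (ordS i) \in corners c &
      forall c', c' \in cells P -> pane_midpoint i \in midpoints c' -> c' = c].
Proof.
have /andP[ne /cardfs1P[c ec]] := bpane i.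
have : c \in [fset c]%fset by rewrite inE.
rewrite -ec !inE /= => /and3P[cP h h']; exists c; split=> // c' cP' hm.
have : c' \in [fset c in cells P |
                (bvertex i \in corners c) && (bvertex (ordS i) \in corners c)]%fset.
  by rewrite !inE /= cP' /=; exact: mid_pane ne h h' hm.
by rewrite ec inE => /eqP.
Qed.

Lemma pane_midpoint_inj : injective (@pane_midpoint P).
Proof.
move=> i i' e.
have [c [cP h1 h2 _]] := bpane_cell i.
have [c' [cP' h1' h2' _]] := bpane_cell i'.
have /andP[ne _] := bpane i; have /andP[ne' _] := bpane i'.
have [[e1 _]|[e1 e2]] := mid_inj ne ne' h1 h2 h1' h2' e.
  exact: bvertex_inj e1.
have [z zc /negP[]] := third_corner ne h1 h2; apply/andP; split.
  exact: clockwise cP h1 h2 _ zc.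
by have := clockwise (i := i') cP; rewrite -e1 -e2; apply.
Qed.

Lemma bpane_exit (c : cell) (m : vec) : c \in cells P -> m \in midpoints c ->
  (forall c', c' \in cells P -> m \in midpoints c' -> c' = c) ->
  exists j, pane_midpoint j = m.
Proof.
move=> cP hm un; have [x [y [ne hx hy em]]] := mid_ex_pane hm.
have : boundary_pane (cells P) x y.
  rewrite /boundary_pane ne; apply/cardfs1P; exists c; apply/fsetP => c'.
  rewrite !inE /=; apply/idP/eqP => [/and3P[cP' hx' hy']|->].
    by apply: un => //; rewrite em pane_mid.
  by rewrite cP hx hy.
by case/boundaryP => j [] [ex ey]; exists j;
  rewrite /pane_midpoint em ex ey // addrC.
Qed.

Lemma beam_through i j d k l i' : beam_along i j d k -> (0 < l < k)%N ->
  pane_midpoint i' != pane_midpoint i + d *+ l.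
Proof.
case/and5P=> dD _ _ _ /forallP hl; case: l => // l /= lk.
have /litP[c [cP h1 h2]] := hl (Ordinal (ltnW lk)).
have /litP[c' [cP' h1' h2']] := hl (Ordinal lk).
apply/eqP=> e; have [c0 [_ _ _ un]] := bpane_cell i'.
rewrite -e /= in h2 h1'.
have ec := un _ cP h2; have ec' := un _ cP' h1'.
move: h1 h2 h2'; rewrite ec ec' e /= !mulrSr !addrA => g1 g2.
by apply/negP; exact: mid_line g1 g2.
Qed.

Lemma beam_ex i : exists j, beam i j.
Proof.
have [c0 [c0P hx hy un]] := bpane_cell i.
have /andP[ne _] := bpane i.
have hm := pane_mid ne hx hy.
have [d dD hd] := mid_ex hm.
have ang := mid_angle dD ne hx hy hd.
pose f l := pane_midpoint i + d *+ l.
have bnd (s : seq cell) : exists N : nat, forall c, c \in s ->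
    forall m, m \in midpoints c -> (`|m.1| + `|m.2| < N%:Z)%R.
  elim: s => [|c s [N IH]]; first by exists 0%N => c; rewrite in_nil.
  exists (N + `|c.1.1| * 2 + `|c.1.2| * 2 + 10)%N => c'; rewrite inE.
  case/orP=> [/eqP->|cs] m hmm; last by have := IH _ cs _ hmm; lia.
  case: c m hmm {IH} => [[a b] u] [x y]; rewrite in_midpoints /=.
  by case: u => h; split_hyps; lia.
have [N hN] := bnd (cells P).
have exk : exists k, ~~ lit P (f k) (f k.+1).
  exists (N + `|(pane_midpoint i).1| + `|(pane_midpoint i).2|)%N.
  apply/litP=> -[c [cP /(hN _ cP) + _]]; rewrite /f.
  case: (pane_midpoint i) => x y /=.
  set K := (N + _ + _)%N => h.
  have {h}: `|x + (d *+ K).1| + `|y + (d *+ K).2| < N by [].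
  have : (K >= N + `|x| + `|y|)%N by [].
  clearbody K; case/beam_dirE: dD => ->;
    rewrite mulvE /= ?mulNrn ?mul0rn ?[1 *+ K]natz; lia.
case: (ex_minnP exk) => -[|k] nl mn.
  case/litP: nl; exists c0; split=> //; rewrite /f ?mulr0n ?addr0 //.
have lk l : (l < k.+1)%N -> lit P (f l) (f l.+1).
  by move=> lk; apply: contraLR lk => /mn; rewrite -leqNgt.
have /litP[c [cP h1 h2]] := lk _ (ltnSn k).
have [j ej] : exists j, pane_midpoint j = f k.+1.
  apply: (bpane_exit cP h2) => c' cP' h2'; apply/eqP; apply: contraNT nl => nc.
  apply/litP; exists c'; split=> //.
  move: h1 h2 h2'; rewrite /f !mulrSr !addrA => g1 g2 g3.
  by apply: (mid_step dD _ g1 g2 g3); rewrite eq_sym.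
exists j, d, k.+1; apply/and5P; split=> //; first by rewrite ej.
by apply/forallP => l; apply: lk.
Qed.

Lemma beam_source i i' j : beam i j -> beam i' j -> i = i'.
Proof.
case=> d [k hb] [d' [k' hb']].
have [dD _ k0 /eqP ej /forallP hl] := and5P hb.
have [dD' _ k0' /eqP ej' /forallP hl'] := and5P hb'.
have [c0 [_ _ _ un]] := bpane_cell j.
have kk : (k.-1 < k)%N by rewrite prednK.
have kk' : (k'.-1 < k')%N by rewrite prednK.
have /litP[c [cP h1 h2]] := hl (Ordinal kk).
have /litP[c' [cP' h1' h2']] := hl' (Ordinal kk').
rewrite /= prednK // -ej in h2; rewrite /= prednK // -ej' in h2'.
have ec := un _ cP h2; have ec' := un _ cP' h2'; subst c c'.
have f1 : pane_midpoint i + d *+ k.-1 + d = pane_midpoint j.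
  by rewrite ej -addrA -mulrSr prednK.
have f1' : pane_midpoint i' + d' *+ k'.-1 + d' = pane_midpoint j.
  by rewrite ej' -addrA -mulrSr prednK.
have ed : d = d'.
  by apply: (mid_dirB dD dD' h1 h1'); rewrite ?f1 ?f1'.
subst d'; apply: pane_midpoint_inj.
have aux (p q : vec) (a b : nat) : (a <= b)%N ->
    p + d *+ a = q + d *+ b -> p = q + d *+ (b - a).
  move=> ab e; apply: (addIr (d *+ a)).
  by rewrite e -addrA -mulrnDr subnK.
have e : pane_midpoint i + d *+ k = pane_midpoint i' + d *+ k' by rewrite -ej.
case: (ltngtP k k') => [lt|lt|ek].
- have ll : (0 < k' - k < k')%N by lia.
  case/eqP: (beam_through i hb' ll).
  by apply: aux => //; apply: ltnW.
- have ll : (0 < k - k' < k)%N by lia.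
  case/eqP: (beam_through i' hb ll).
  by apply: aux => //; apply: ltnW.
by move: e; rewrite ek => /addIr.
Qed.

Lemma beam_target i j j' : beam i j -> beam i j' -> j = j'.
Proof.
case=> d [k hb] [d' [k' hb']].
have [dD _ k0 /eqP ej /forallP hl] := and5P hb.
have [dD' _ k0' /eqP ej' /forallP hl'] := and5P hb'.
have [c0 [_ _ _ un]] := bpane_cell i.
have /litP[c [cP h1 h2]] := hl (Ordinal k0).
have /litP[c' [cP' h1' h2']] := hl' (Ordinal k0').
rewrite /= mulr0n addr0 in h1; rewrite /= mulr0n addr0 in h1'.
have ec := un _ cP h1; have ec' := un _ cP' h1'; subst c c'.
have ed := mid_dirF dD dD' h1 h2 h2'; subst d'; apply: pane_midpoint_inj.
case: (ltngtP k k') => [lt|lt|ek].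
- have ll : (0 < k < k')%N by lia.
  by case/eqP: (beam_through j hb' ll).
- have ll : (0 < k' < k)%N by lia.
  by case/eqP: (beam_through j' hb ll).
by rewrite ej ej' ek.
Qed.

Lemma beamb_ex i : exists x : 'I_(perim P) * (vec * nat),
  beam_along i x.1 x.2.1 x.2.2.
Proof. by have [j [d [k h]]] := beam_ex i; exists (j, (d, k)). Qed.

Definition beam_end i : 'I_(perim P) := (xchoose (beamb_ex i)).1.

Lemma beam_endP i : beam i (beam_end i).
Proof. by do 2!eexists; exact: (xchooseP (beamb_ex i)). Qed.

Lemma beam_end_inj : injective beam_end.
Proof.
move=> i i' e; have := beam_endP i'; rewrite -e.
exact: beam_source (beam_endP i).
Qed.

Definition billiards : {perm 'I_(perim P)} := perm beam_end_inj.

Lemma billiardsP i j : beam i j <-> billiards i = j.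
Proof.
rewrite permE; split=> [h|<-]; last exact: beam_endP.
exact: beam_target (beam_endP i) h.
Qed.

Definition cyc : nat := #|porbits billiards|.

End Billiards.

(* Main.v *)
(** When a beam is reflected by the boundary instead of being absorbed, the beams
    become the cycles of a permutation rho of the darts (midline of a cell, with a
    direction), which makes sense for every finite set S of cells; an orbit O has
    ell O >= 3 bounces, and perim is the total number of bounces.

    An interior pane joining two boundary vertices cuts P into polygons P1, P2 with
    cyc P = cyc P1 + cyc P2 - 1 and perim P = perim P1 + perim P2 - 2, so by induction
    there is no such pane. If cyc P <= 3, perim P >= 3 cyc P is enough. Otherwise an
    orbit with three bounces bounds a triangle, all of whose inner vertices are interior
    to P. As P is simply connected, every side of such a triangle has a mod 2 potential
    on the vertices of P, which shows that any other orbit leaves the triangle equally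
    often in the three directions. Comparing potentials of several triangles, an orbit O
    with ell O >= 4 leaves triangles of a given orientation at most 2 ell O - 7 times in
    all, while each triangle is left at least twice by such orbits (triangles that are
    too small force cyc P <= 3). Counting the exits from the t triangles in two ways,
    2 t <= sum 2 (2 ell O - 7) over the other orbits, i.e. 2 perim P >= 7 cyc P. *)

Require Import Defs.
From HB Require Import structures.
From mathcomp Require Import all_boot all_order all_fingroup all_algebra.
From mathcomp Require Import finmap zify lra.

Set Implicit Arguments.
Unset Strict Implicit.
Unset Printing Implicit Defensive.

Import Order.TTheory GRing.Theory Num.Theory.
Local Open Scope fset_scope.
Local Open Scope ring_scope.

(** * Cells, panes and midlines *)

(** P need not be convex: a line may meet it in several pieces, so lying beyond a side of a triangle
    cannot be read off from coordinates. It is defined by potentials instead: the side marks the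
    panes whose midpoints it contains, the marks form a mod 2 cocycle on P, and a vertex is beyond
    the side where the potential is 1. To apply this to beams, a dart is represented by its pivot,
    the vertex cut off by its midline: consecutive pivots are the ends of the pane by which the dart
    leaves its cell, so that an orbit becomes a closed walk on vertices, bounces included.

    The bound 2 ell O - 7 arises as follows. Seen from a vertex of a reference triangle, every
    triangle has an avoiding direction, the reference triangle has three, and a beam makes at most
    one exit in such directions. If O leaves the reference triangle at all, its total is thus at
    most ell O - 2, which suffices from five bounces on; four bounces need a separate argument.

    The constant 3 in 7 cyc P <= 2 perim P + 3 is what perim P >= 3 cyc P requires when cyc P <= 3,
    and cutting reproduces it: 3 + 3 - 7 + 2 * 2 = 3. *)

(* A direction also indexes the panes and the opposite vertices of a cell, and the
   family of grid lines parallel to it. *)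
Variant dir : Type := NE | W | SE.

Definition dir_code (d : dir) : option bool :=
  match d with NE => None | W => Some true | SE => Some false end.
Definition dir_decode (o : option bool) : dir :=
  match o with None => NE | Some true => W | Some false => SE end.
Lemma dir_codeK : cancel dir_code dir_decode. Proof. by case. Qed.
HB.instance Definition _ := Finite.copy dir (can_type dir_codeK).

Definition tau (d : dir) : dir := match d with NE => W | W => SE | SE => NE end.
Definition tau' (d : dir) : dir := match d with NE => SE | W => NE | SE => W end.

(* co c d locates the line carrying the midline of c in direction d. The three values are
   odd and add up to 1 or -1 according to the orientation of c; for vertices, cv uses the
   same scale, with even values adding up to 0. *)
Definition co (c : cell) (d : dir) : int :=
  match d with
  | NE => 2 * c.1.1 + 1
  | W => 2 * c.1.2 + 1
  | SE => - (2 * c.1.1 + 2 * c.1.2 + if c.2 then 1 else 3)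
  end.

Definition cv (v : vec) (d : dir) : int :=
  match d with NE => 2 * v.1 | W => 2 * v.2 | SE => - (2 * v.1 + 2 * v.2) end.

(* nb c i is the cell across pane i of c, and vx c i the vertex opposite that pane, whose
   ends are therefore vx c (tau i) and vx c (tau' i). *)
Definition nb (c : cell) (i : dir) : cell :=
  let: ((a, b), u) := c in
  if u then
    match i with
    | NE => ((a - 1, b), false) | W => ((a, b - 1), false) | SE => ((a, b), false)
    end
  else
    match i with
    | NE => ((a + 1, b), true) | W => ((a, b + 1), true) | SE => ((a, b), true)
    end.

Definition vx (c : cell) (i : dir) : vec :=
  let: ((a, b), u) := c in
  if u then
    match i with NE => (a + 1, b) | W => (a, b + 1) | SE => (a, b) end
  else
    match i with NE => (a, b + 1) | W => (a + 1, b) | SE => (a + 1, b + 1) end.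

(* A beam in direction d leaves c through pane ex c d; reflected there, it continues inside
   c in direction rf c d. *)
Definition ex (c : cell) (d : dir) : dir := if c.2 then tau' d else tau d.
Definition rf (c : cell) (d : dir) : dir := if c.2 then tau d else tau' d.

Lemma nbK i : involutive (nb^~ i).
Proof. by case=> [[a b] []]; case: i; rewrite /= ?subrK ?addrK. Qed.

Lemma nb_up c i : (nb c i).2 = ~~ c.2.
Proof. by case: c => [[a b] []]; case: i. Qed.

Lemma cell_inj (c c' : cell) i : co c i = co c' i -> co c (tau i) = co c' (tau i) ->
  co c (tau' i) = co c' (tau' i) -> c = c'.
Proof.
case: c c' => [[a b] u] [[a' b'] u'].
suff H : co ((a, b), u) NE = co ((a', b'), u') NE ->
  co ((a, b), u) W = co ((a', b'), u') W ->
  co ((a, b), u) SE = co ((a', b'), u') SE -> ((a, b), u) = ((a', b'), u') :> cell.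
  by case: i => h1 h2 h3; apply: H.
rewrite /co /= => h1 h2 h3.
have ea : a = a' by lia.
have eb : b = b' by lia.
subst; congr (_, _); move: h3; case: u; case: u' => //; lia.
Qed.

Lemma co_nb c i j : co (nb c i) j = co c j + (if i == j then if c.2 then -2 else 2 else 0).
Proof. by case: c => [[a b] []]; case: i; case: j; rewrite /=; lia. Qed.

Lemma vx_nb1 c i : vx (nb c i) (tau i) = vx c (tau' i).
Proof. by case: c => [[a b] []]; case: i; rewrite /= ?subrK. Qed.

Lemma vx_nb2 c i : vx (nb c i) (tau' i) = vx c (tau i).
Proof. by case: c => [[a b] []]; case: i; rewrite /= ?subrK. Qed.

(** Position along the line of direction [d]: a straight step raises it by 2, and together with [co]
    it determines the cell. *)
Definition lpos (c : cell) (d : dir) : int := co c (tau d) - co c (tau' d).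

Lemma lpos_nb c d : lpos (nb c (ex c d)) d = lpos c d + 2.
Proof. by case: c => [[a b] []]; case: d; rewrite /lpos /ex /=; lia. Qed.

Lemma co_nb_ex c d : co (nb c (ex c d)) d = co c d.
Proof. by case: c => [[a b] []]; case: d; rewrite /ex /=; lia. Qed.

Lemma rf_neq c d : rf c d != d.
Proof. by case: c => [[a b] []]; case: d. Qed.

Lemma line_inj c c' d : co c d = co c' d -> lpos c d = lpos c' d -> c = c'.
Proof.
move=> h1 h2; apply: (cell_inj h1); move: h1 h2; rewrite /lpos;
  case: c c' => [[a b] u] [[a' b'] u']; case: d; case: u; case: u' => /=; lia.
Qed.

Lemma nxt_inj c c' d : nb c (ex c d) = nb c' (ex c' d) -> c = c'.
Proof.
move=> e; have : ~~ c.2 = ~~ c'.2 by rewrite -(nb_up _ (ex c d)) e nb_up.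
by move=> /negb_inj u; move: e; rewrite /ex u; apply: (can_inj (nbK _)).
Qed.

(** The dart in direction [d'] leaves through the very pane by which the beam in direction [d] has
    entered. Hence a straight step and a reflection never produce the same dart, see [step_inj]. *)
Lemma nxt_back c d d' : rf (nb c (ex c d)) d' = d ->
  nb (nb c (ex c d)) (ex (nb c (ex c d)) d') = c.
Proof. by case: c => [[a b] []]; case: d; case: d'; rewrite /= ?subrK ?addrK. Qed.

Lemma rf_inj c : injective (rf c).
Proof. by case: c => [? []] [] []. Qed.

(** * The billiard permutation of a set of cells *)

Section Billiard.
Variable S : {fset cell}.
Notation dart := (S * dir)%type.
Implicit Types x y : dart.

Definition pc x : cell := val x.1.
Definition nxt x : cell := nb (pc x) (ex (pc x) x.2).
Definition bd x : bool := nxt x \notin S.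

(** A reflection is a step of its own that keeps the cell, so each bounce is exactly one dart with
    [bd]. *)
Definition step x : dart :=
  if insub (nxt x) is Some c then (c, x.2) else (x.1, rf (pc x) x.2).

Lemma pcS x : pc x \in S. Proof. exact: valP. Qed.

Lemma step_inj : injective step.
Proof.
move=> [c d] [c' d']; rewrite /step /nxt /pc /=.
case: insubP => [e _ eE|nS]; case: insubP => [e' _ eE'|nS'] [].
- move=> ee dd; subst; congr (_, _); apply: val_inj.
  exact: (nxt_inj (etrans (esym eE) eE')).
- move=> ee dd; case/negP: nS'; move: dd; rewrite -ee eE => /esym/nxt_back ->; exact: valP.
- move=> ee dd; case/negP: nS; move: dd; rewrite ee eE' => /nxt_back ->; exact: valP.
- by move=> cc; subst=> dd; congr (_, _); apply: rf_inj dd.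
Qed.

Definition rho : {perm dart} := perm step_inj.

Lemma rho_str x : ~~ bd x -> pc (rho x) = nxt x /\ (rho x).2 = x.2.
Proof. by rewrite /bd negbK permE /step => h; rewrite (insubT (mem S) h). Qed.

Lemma rho_bd x : bd x -> rho x = (x.1, rf (pc x) x.2).
Proof. by rewrite /bd permE /step => h; rewrite insubN. Qed.

(* The vertex that the midline of x cuts off. Consecutive pivots are adjacent even across a
   reflection, see piv_rho. *)
Definition piv x : vec := vx (pc x) x.2.

Lemma piv_rho x : piv (rho x) = vx (pc x) (rf (pc x) x.2).
Proof.
rewrite /piv; case: (boolP (bd x)) => h; first by rewrite (rho_bd h).
have [-> ->] := rho_str h; rewrite /nxt /ex /rf; move: (pc x) (x.2) => c d.
by case: c => [[a b] []]; case: d; rewrite /= ?subrK ?addrK.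
Qed.

Lemma iter_str x k : (forall j, (j < k)%N -> ~~ bd (iter j rho x)) ->
  [/\ (iter k rho x).2 = x.2, co (pc (iter k rho x)) x.2 = co (pc x) x.2
    & lpos (pc (iter k rho x)) x.2 = lpos (pc x) x.2 + 2 * k%:Z].
Proof.
elim: k => [|k IH] h; first by rewrite /= mulr0 addr0.
have [|h1 h2 h3] := IH; first by move=> j jk; apply: h; rewrite ltnS ltnW.
have [e1 e2] := rho_str (h _ (ltnSn k)); rewrite iterS e2 e1 h1; split=> //.
  by rewrite /nxt h1 co_nb_ex.
by rewrite /nxt h1 lpos_nb h3; lia.
Qed.

(** Without a bounce [lpos] would grow by 2 at every step, although [rho] has finite order. *)
Lemma bd_ex x : exists k, bd (iter k rho x).
Proof.
case: (pickP (fun k : 'I_#[rho]%g => bd (iter k rho x))) => [k h|nh]; first by exists k.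
have [|_ _] := @iter_str x #[rho]%g; first by move=> j jk; have /negbT := nh (Ordinal jk).
rewrite -permX expg_order perm1 => /eqP.
have : (0 < #[rho]%g)%N by exact: order_gt0.
lia.
Qed.

(* fin x is the dart at which the beam through x reaches the boundary. *)
Definition len x : nat := ex_minn (bd_ex x).
Definition fin x : dart := iter (len x) rho x.

Lemma fin_bd x : bd (fin x).
Proof. by rewrite /fin /len; case: ex_minnP. Qed.

Lemma len_min x j : (j < len x)%N -> ~~ bd (iter j rho x).
Proof. by rewrite /len; case: ex_minnP => k _ h jk; apply: contraL jk => /h; rewrite -leqNgt. Qed.

Lemma finP x : [/\ (fin x).2 = x.2, co (pc (fin x)) x.2 = co (pc x) x.2
    & lpos (pc (fin x)) x.2 = lpos (pc x) x.2 + 2 * (len x)%:Z].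
Proof. by apply: iter_str => j; apply: len_min. Qed.

Lemma fin_id x : bd x -> fin x = x.
Proof.
by move=> h; rewrite /fin; have := @len_min x 0; case: (len x) => [//|k] /(_ isT); rewrite /= h.
Qed.

Lemma fin_rho x : ~~ bd x -> fin (rho x) = fin x.
Proof.
move=> h; have h0 : (0 < len x)%N.
  by rewrite lt0n; apply: contra h => /eqP e; have := fin_bd x; rewrite /fin e.
have hb k : bd (iter k rho x) -> (len x <= k)%N.
  by move=> hk; rewrite leqNgt; apply: contraL hk => /len_min.
suff e : (len x = (len (rho x)).+1)%N by rewrite /fin e iterSr.
apply/eqP; rewrite eqn_leq hb; last by rewrite iterSr; exact: fin_bd.
rewrite -(prednK h0) ltnS leqNgt; apply/negP => /len_min.
by rewrite -iterSr prednK // fin_bd.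
Qed.

Lemma mem_iter_rho x k : iter k rho x \in porbit rho x.
Proof. by rewrite -permX mem_porbit. Qed.

Lemma fin_porbit x : fin x \in porbit rho x.
Proof. exact: mem_iter_rho. Qed.

Lemma fin_eq x y : fin x = fin y ->
  exists j, (x = iter j rho y /\ forall i, (i < j)%N -> ~~ bd (iter i rho y)) \/
            (y = iter j rho x /\ forall i, (i < j)%N -> ~~ bd (iter i rho x)).
Proof.
suff H x' y' : (len x' <= len y')%N -> fin x' = fin y' ->
    x' = iter (len y' - len x') rho y'.
  case: (leqP (len x) (len y)) => [h|/ltnW h] e.
    exists (len y - len x)%N; left; split; first exact: H.
    by move=> i hi; apply: len_min; lia.
  exists (len x - len y)%N; right; split; first exact: H.
  by move=> i hi; apply: len_min; lia.
move=> h; rewrite /fin -{1}(subnKC h) iterD => e; move: e.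
move: (iter _ _ y') => z; elim: (len x') => [//|k IH]; rewrite !iterS => /perm_inj; exact: IH.
Qed.

(** On the darts with [bd], this is the first return map of [rho]; it plays the role of the
    billiards permutation. *)
Definition nextb x : dart := fin (rho x).

Lemma nextb_bd x : bd (nextb x). Proof. exact: fin_bd. Qed.

Lemma nextb_porbit x : nextb x \in porbit rho x.
Proof.
have h := mem_iter_rho x 1; rewrite /= -eq_porbit_mem in h.
by rewrite -(eqP h) fin_porbit.
Qed.
Lemma nextb_inj : {in [pred x | bd x] &, injective nextb}.
Proof.
have H x y j : bd y -> (forall i, (i < j)%N -> ~~ bd (iter i rho (rho x))) ->
    rho y = iter j rho (rho x) -> y = x.
  case: j => [_ _ /perm_inj //|j] hy h; rewrite iterS => /perm_inj e.
  by case/negP: (h j (ltnSn j)); rewrite -e.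
move=> x y; rewrite !inE => hx hy /fin_eq[j [[e h]|[e h]]].
  exact: (H _ _ _ hx h e).
exact/esym/(H _ _ _ hy h e).
Qed.

(** [fin] is unchanged by a straight step and advances by [nextb] at a bounce. *)
Lemma fin_iter x k : exists r, fin (iter k rho x) = iter r nextb (fin x).
Proof.
elim: k => [|k [r IH]]; first by exists 0%N.
case: (boolP (bd (iter k rho x))) => h; last by exists r; rewrite iterS fin_rho.
by exists r.+1; rewrite !iterS -IH (fin_id h).
Qed.

Definition ell (O : {set dart}) : nat := #|[set x in O | bd x]|.

Lemma iter_nextb_bd b r : bd b -> bd (iter r nextb b).
Proof. by case: r => // r _; rewrite iterS nextb_bd. Qed.

Lemma iter_nextb_porbit b r : iter r nextb b \in porbit rho b.
Proof.
elim: r => [|r IH]; first exact: porbit_id.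
by rewrite iterS; move: IH; rewrite -!eq_porbit_mem => /eqP <-; rewrite eq_porbit_mem nextb_porbit.
Qed.

Lemma order_nextb b : bd b -> fingraph.order nextb b = ell (porbit rho b).
Proof.
move=> hb; rewrite /fingraph.order /ell; apply: eq_card => y; rewrite !inE.
apply/idP/andP => [/iter_findex <-|[/porbitP[k ->] hy]].
  by rewrite iter_nextb_porbit iter_nextb_bd.
move: hy; rewrite permX => hy; have [r] := fin_iter b k.
by rewrite (fin_id hy) (fin_id hb) => ->; exact: fconnect_iter.
Qed.

Lemma iter_ell b : bd b -> iter (ell (porbit rho b)) nextb b = b.
Proof.
move=> hb; rewrite -order_nextb //; apply: (@iter_order_in _ nextb [pred x | bd x]) => //.
  by move=> x; rewrite !inE nextb_bd.
exact: nextb_inj.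
Qed.

Lemma bd_orbit b y : bd b -> y \in porbit rho b -> bd y ->
  exists2 r, (r < ell (porbit rho b))%N & y = iter r nextb b.
Proof.
move=> hb /porbitP[k ->]; rewrite permX => hy; have [r] := fin_iter b k.
rewrite (fin_id hy) (fin_id hb) => e.
have : fconnect nextb b (iter k rho b) by rewrite e fconnect_iter.
by rewrite fconnect_orbit => /trajectP[i]; rewrite order_nextb // => ir ->; exists i.
Qed.

(** Between two bounces the beam meets every cell of its line, since a straight step raises [lpos]
    by exactly 2 and the positions of cells on one line differ by even numbers. *)
Lemma strand b z : bd b ->
  let d := (nextb b).2 in
  co z d = co (pc b) d -> lpos (pc b) d <= lpos z d <= lpos (pc (nextb b)) d ->
  exists2 j, pc (iter j rho (rho b)) = z & (iter j rho (rho b)).2 = d /\ (j <= len (rho b))%N.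
Proof.
move=> hb d hc /andP[h1 h2].
have [e1 e2 e3] := finP (rho b).
have ed : d = (rho b).2 by rewrite /d /nextb e1.
have ec : pc (rho b) = pc b by rewrite rho_bd.
rewrite /nextb -!ed ec in e2 e3.
have [k ek] : exists k : nat, lpos z d = lpos (pc b) d + 2 * k%:Z.
  exists `|(lpos z d - lpos (pc b) d) %/ 2|%Z%N.
  move: hc h1; rewrite /lpos; case: (z) (pc b) => [[a1 b1] u] [[a b'] u'].
  by case: d {ed e2 e3 h2} => /=; case: u; case: u'; lia.
have kl : (k <= len (rho b))%N by move: h2; rewrite /nextb ek e3; lia.
have [|f1 f2 f3] := @iter_str (rho b) k.
  by move=> j jk; apply: len_min; apply: leq_trans kl.
exists k; last by rewrite f1 -ed.
by apply: (@line_inj _ _ d); rewrite ed ?f2 ?f3 -ed ec.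
Qed.
End Billiard.
Arguments rho {S}.

(** The total of [g] does not change along a cycle, so its increases [a] and its decreases [b]
    balance. Every conservation law for orbits below is an instance. *)
Lemma porbit_telescope (T : finType) (p : {perm T}) x (g a b : T -> nat) :
  (forall y, y \in porbit p x -> g (p y) + b y = g y + a y)%N ->
  (\sum_(y in porbit p x) a y = \sum_(y in porbit p x) b y)%N.
Proof.
move=> h; have e : (\sum_(y in porbit p x) g (p y) = \sum_(y in porbit p x) g y)%N.
  rewrite [RHS](reindex_inj (@perm_inj _ p)); apply: eq_bigl => y.
  by rewrite -!eq_porbit_mem (porbit_perm p 1).
have : (\sum_(y in porbit p x) (g (p y) + b y) = \sum_(y in porbit p x) (g y + a y))%N.
  exact: eq_bigr.
by rewrite !big_split /= e => /addnI.
Qed.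

(** * Triangular orbits *)

(** Inverse of [vx]: when [u] and [i] vary, these are the six cells around [v]. *)
Definition cellat (v : vec) (u : bool) (i : dir) : cell :=
  let: (x, y) := v in
  if u then
    match i with
    | NE => ((x - 1, y), true) | W => ((x, y - 1), true) | SE => ((x, y), true)
    end
  else
    match i with
    | NE => ((x, y - 1), false) | W => ((x - 1, y), false)
    | SE => ((x - 1, y - 1), false)
    end.

Lemma cellatE c i : cellat (vx c i) c.2 i = c.
Proof. by case: c => [[a b] []]; case: i; rewrite /= ?addrK. Qed.

Lemma vx_cellat v u i : vx (cellat v u i) i = v.
Proof. by case: v => x y; case: u; case: i; rewrite /= ?subrK. Qed.

(* Interior vertices of the union of S. *)
Definition iv (S : {fset cell}) (v : vec) : bool :=
  [forall p : bool * dir, cellat v p.1 p.2 \in S].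

Lemma ivP (S : {fset cell}) v : reflect (forall c i, vx c i = v -> c \in S) (iv S v).
Proof.
apply: (iffP forallP) => [h c i e|h [u i]]; last by apply: (h _ i); rewrite vx_cellat.
by rewrite -(cellatE c i) e; exact: (h (c.2, i)).
Qed.

Lemma nivP (S : {fset cell}) c i : nb c i \notin S ->
  ~~ iv S (vx c (tau i)) /\ ~~ iv S (vx c (tau' i)).
Proof.
move=> h; split; apply/negP => /ivP H; case/negP: h.
  by apply: (H _ (tau' i)); exact: vx_nb2.
by apply: (H _ (tau i)); exact: vx_nb1.
Qed.

(* The triangle with orientation T.1 (pointing up or down) whose sides lie on the lines of
   coordinates ln T i, hence on midlines of cells. *)
Definition tri : Type := (bool * (int * int * int))%type.
Definition ln (T : tri) (i : dir) : int :=
  2 * (match i with NE => T.2.1.1 | W => T.2.1.2 | SE => T.2.2 end) + 1.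
Definition gtu (u : bool) (x y : int) : bool := if u then x < y else y < x.
Definition inD (T : tri) (v : vec) : bool :=
  [&& gtu T.1 (ln T NE) (cv v NE), gtu T.1 (ln T W) (cv v W)
    & gtu T.1 (ln T SE) (cv v SE)].
Definition touch (T : tri) (c : cell) : bool :=
  [|| inD T (vx c NE), inD T (vx c W) | inD T (vx c SE)].
(** Twice the side length, always odd. Up to a common sign, the differences [cv v d - ln T d] at an
    inner vertex are positive odd numbers with sum [sz T], so the sizes 1, 3, 5, 7 give 0, 1, 3, 6
    inner vertices. *)
Definition sz (T : tri) : int :=
  if T.1 then - (ln T NE + ln T W + ln T SE) else ln T NE + ln T W + ln T SE.

Lemma touchP T c : reflect (exists i, inD T (vx c i)) (touch T c).
Proof.
apply: (iffP or3P) => [[]|[[] h]]; first [by exists NE|by exists W|by exists SE|idtac].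
- by constructor 1. - by constructor 2. - by constructor 3.
Qed.

(** The second reflection undoes the first turn, so the two cells have opposite orientations.
    Agreeing in two coordinates, they would be neighbours with [c1] behind [c0] on the line of
    direction [d1]. *)
Lemma no_digon c0 c1 d0 d1 : d1 = rf c0 d0 -> d0 = rf c1 d1 ->
  co c1 d1 = co c0 d1 -> co c0 d0 = co c1 d0 -> lpos c0 d1 <= lpos c1 d1 -> False.
Proof.
case: c0 => [[a b] u]; case: c1 => [[a' b'] u']; rewrite /rf /lpos.
by move=> -> ; case: u; case: u'; case: d0 => //= _ h1 h2 h3; lia.
Qed.

Section Triangle.
Variable S : {fset cell}.
Notation dart := (S * dir)%type.
Implicit Types x y b : dart.

Lemma nextb_line b : bd b -> let b' := nextb b in
  [/\ b'.2 = rf (pc b) b.2, co (pc b') b'.2 = co (pc b) b'.2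
    & lpos (pc b) b'.2 <= lpos (pc b') b'.2].
Proof.
move=> hb; have [e1 e2 e3] := finP (rho b); rewrite /nextb e1 e2 e3.
have -> : pc (rho b) = pc b by rewrite rho_bd.
by split=> //; [rewrite rho_bd|lia].
Qed.

Lemma strand_start b x : bd b -> fin x = nextb b -> lpos (pc b) x.2 <= lpos (pc x) x.2.
Proof.
move=> hb; have e0 : pc (rho b) = pc b by rewrite rho_bd.
case/fin_eq => -[|j] [[e h]|[e h]].
- by rewrite e /= e0.
- by rewrite -e0 e.
- have [_ _ e3] := iter_str h.
  by have [] := iter_str h; rewrite -e => -> _ ->; rewrite e0; lia.
- have := h j (ltnSn j); move: e; rewrite iterS => /perm_inj <-; by rewrite hb.
Qed.

Lemma nextb_neq b : bd b -> nextb b != b.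
Proof.
move=> hb; have [e _ _] := nextb_line hb; apply/eqP => eb; move: e; rewrite eb => e.
by have := rf_neq (pc b) b.2; rewrite -e eqxx.
Qed.

Lemma nextb2_neq b : bd b -> nextb (nextb b) != b.
Proof.
move=> hb; apply/eqP => e2; have [h1 h2 h3] := nextb_line hb.
have := nextb_line (nextb_bd b); rewrite e2 /= => -[h4 h5 _].
exact: (no_digon h1 h4 h2 h5 h3).
Qed.

Lemma ell_ge3 b : bd b -> (2 < ell (porbit rho b))%N.
Proof.
move=> hb; have h1 := nextb_bd b; have h2 := nextb_bd (nextb b).
have n1 := nextb_neq hb; have n2 := nextb2_neq hb; have n3 := nextb_neq h1.
have o1 := iter_nextb_porbit b 1; have o2 := iter_nextb_porbit b 2.
rewrite /= in o1 o2; move: (nextb b) (nextb (nextb b)) h1 h2 n1 n2 n3 o1 o2 => b1 b2.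
move=> h1 h2 n1 n2 n3 o1 o2.
have <- : #|[set b; b1; b2]| = 3%N.
  by rewrite setUC cardsU1 cards2 !inE negb_or n2 n3 eq_sym n1.
apply: subset_leq_card; apply/subsetP => y; rewrite !inE => /orP[/orP[]|] /eqP->.
- by rewrite porbit_id.
- by rewrite o1.
- by rewrite o2.
Qed.
End Triangle.

(** Here [p] and [q] are the corner cells at the start and at the end of side [d]. The equality
    identifies the geometric side with the stretch covered by a beam in [strand]. *)
Lemma side_touch T d p q z : 3 <= sz T -> p.2 = ~~ T.1 -> q.2 = ~~ T.1 ->
  co p d = ln T d -> co q d = ln T d -> co z d = ln T d ->
  co p (ex p d) = ln T (ex p d) -> co q (rf q d) = ln T (rf q d) ->
  touch T z = (lpos p d <= lpos z d <= lpos q d).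
Proof.
rewrite /touch /inD /lpos /ex /rf => hs pu qu; rewrite pu qu.
case: p q pu qu => [[pa pb] pu] [[qa qb] qu] /= -> ->.
case: T hs => [u [[a b] c]]; rewrite /sz /gtu /ln /=.
case: z => [[x y] v].
by case: u; case: d => /= hs h1 h2 h3 h4 h5; case: v h3 => /= h3; lia.
Qed.

(** Three turns by [rf] close up only if the three cells have the same orientation. The lines of the
    beams then bound a triangle, and the last hypothesis fixes the sign of its size; size 1 means
    that all three bounces take place in one cell. *)
Lemma three_corners c0 c1 c2 d0 d1 d2 :
    d1 = rf c0 d0 -> d2 = rf c1 d1 -> d0 = rf c2 d2 ->
    co c1 d1 = co c0 d1 -> co c2 d2 = co c1 d2 -> co c0 d0 = co c2 d0 ->
    lpos c0 d1 <= lpos c1 d1 ->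
  exists T : tri,
    [/\ [/\ c0.2 = ~~ T.1, c1.2 = ~~ T.1 & c2.2 = ~~ T.1],
        [/\ co c0 d0 = ln T d0, co c1 d1 = ln T d1 & co c2 d2 = ln T d2],
        [/\ d0 = ex c0 d1, d1 = ex c1 d2 & d2 = ex c2 d0],
        1 <= sz T & (c1 = c0 /\ c2 = c0) \/ 3 <= sz T].
Proof.
case: c0 c1 c2 => [[a0 b0] u0] [[a1 b1] u1] [[a2 b2] u2].
rewrite /rf /lpos /ex => -> -> .
move=> h1 h2 h3 h4 h5; have [eu1 eu2] : u1 = u0 /\ u2 = u0.
  by move: h1; case: u0 {h2 h3 h4 h5}; case: u1; case: u2; case: d0.
subst; move: h1 h2 h3 h4 h5; case: u0; case: d0 => /= _ h1 h2 h3 h4;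
 (* The witnesses read the lines off the cells; the shift by 1 or 2 in the last entry comes from
    [co] in direction [SE], which depends on the orientation. *)
 [ exists (false, (a0, b1, - (a2 + b2) - 1)) | exists (false, (a2, b0, - (a1 + b1) - 1))
 | exists (false, (a1, b2, - (a0 + b0) - 1)) | exists (true, (a0, b2, - (a1 + b1) - 2))
 | exists (true, (a1, b0, - (a2 + b2) - 2)) | exists (true, (a2, b1, - (a0 + b0) - 2)) ];
 rewrite /sz /ln /=; split=> //; try (by split; lia); try (by lia);
 match goal with |- _ \/ is_true (_ <= ?s) => have [e|] : s = 1 \/ 3 <= s by lia end;
 by [left; split; congr (_, _, _); lia|right].
Qed.

Lemma cell_inj2 c c' k : c.2 = c'.2 -> co c (tau k) = co c' (tau k) ->
  co c (tau' k) = co c' (tau' k) -> c = c'.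
Proof.
case: c c' => [[a b] u] [[a' b'] u'] /= -> h1 h2; congr (_, _, _); move: h1 h2;
  by case: k => /=; lia.
Qed.

Section Class.
Variable S : {fset cell}.
Notation dart := (S * dir)%type.
Implicit Types x y b : dart.

Definition corners_in T : Prop := forall c k, c.2 = ~~ T.1 ->
  co c (tau k) = ln T (tau k) -> co c (tau' k) = ln T (tau' k) ->
  c \in S /\ nb c k \notin S.

Definition sides_in T : Prop := forall z d, co z d = ln T d -> touch T z -> z \in S.

Definition side_darts T (O : {set dart}) : Prop :=
  forall x, (x \in O) = (co (pc x) x.2 == ln T x.2) && touch T (pc x).

Section Side.
Variables (T : tri) (b : dart).
Hypotheses (hb : bd b) (s3 : 3 <= sz T).
Let d := (nextb b).2.
Hypotheses (ub : (pc b).2 = ~~ T.1) (ub' : (pc (nextb b)).2 = ~~ T.1).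
Hypotheses (lb : co (pc b) d = ln T d) (lb' : co (pc (nextb b)) d = ln T d).
Hypotheses (eb : co (pc b) (ex (pc b) d) = ln T (ex (pc b) d)).
Hypotheses (rb : co (pc (nextb b)) (rf (pc (nextb b)) d) = ln T (rf (pc (nextb b)) d)).

Lemma side_in z : co z d = ln T d -> touch T z -> exists x : dart,
  [/\ pc x = z, x.2 = d & x \in porbit rho b].
Proof.
move=> lz; rewrite (side_touch s3 ub ub' lb lb' lz eb rb) => hl.
have [j ez [ed _]] := strand hb (etrans lz (esym lb)) hl.
exists (iter j rho (rho b)); split; [exact: ez|exact: ed|idtac].
by rewrite -iterSr; exact: (mem_iter_rho b j.+1).
Qed.

Lemma side_out x : fin x = nextb b ->
  [/\ x.2 = d, co (pc x) x.2 = ln T x.2 & touch T (pc x)].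
Proof.
move=> ef; have := finP x; have := strand_start hb ef.
rewrite ef => h1 [h2 h3 h4]; have ed : x.2 = d by rewrite -h2.
rewrite ed in h1 h3 h4 *; rewrite -h3 lb'; split=> //.
rewrite (side_touch s3 ub ub' lb lb' _ eb rb) ?h1 ?h4 -?h3 //; lia.
Qed.
End Side.

(** The triangle is that of [three_corners]; by [side_in] the orbit covers its sides and by
    [side_out] it contains nothing else. The first alternative is size 1, where the orbit bounces at
    all three panes of one cell. *)
Lemma tri_class b : bd b -> ell (porbit rho b) = 3%N ->
  (forall i, nb (pc b) i \notin S) \/
  exists T, [/\ 3 <= sz T, corners_in T, sides_in T & side_darts T (porbit rho b)].
Proof.
move=> h0 e3; have := iter_ell h0; rewrite e3.
have orb y : y \in porbit rho b -> bd y -> [\/ y = b, y = nextb b | y = nextb (nextb b)].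
  move=> hy hb; have [r] := bd_orbit h0 hy hb; rewrite e3.
  by case: r => [|[|[|//]]] _ ->; [constructor 1|constructor 2|constructor 3].
have p1 := iter_nextb_porbit b 1; have p2 := iter_nextb_porbit b 2.
have h1 := nextb_bd b; have h2 := nextb_bd (nextb b).
have [] := nextb_line h0; have [] := nextb_line h1; have [] := nextb_line h2.
have si0 := fun T => @side_in T b h0; have so0 := fun T => @side_out T b h0.
have si1 := fun T => @side_in T (nextb b) h1; have so1 := fun T => @side_out T (nextb b) h1.
have si2 := fun T => @side_in T (nextb (nextb b)) h2; have so2 := fun T =>
  @side_out T (nextb (nextb b)) h2.
rewrite /= in p1 p2 orb si0 so0 si1 so1 si2 so2 *.
move: (nextb b) (nextb (nextb b)) (nextb (nextb (nextb b))) h1 h2 p1 p2 orb si0 so0 si1 so1 si2 so2.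
move=> b1 b2 b3 h1 h2 p1 p2 orb si0 so0 si1 so1 si2 so2.
move=> e0 l0 i0 e2 l2 i2 e1 l1 i1 eb; subst b3.
have [T [[u0 u1 u2] [m0 m1 m2] [x0 x1 x2] s1 s3]] := three_corners e1 e2 e0 l1 l2 l0 i1.
have bdE y : bd y -> nb (pc y) (ex (pc y) y.2) \notin S by [].
have allk k : [\/ k = ex (pc b) b.2, k = ex (pc b1) b1.2 | k = ex (pc b2) b2.2].
  rewrite e2 e1; move: u0 u1 u2; case: (pc b) (pc b1) (pc b2) => [? v0] [? v1] [? v2] /= -> -> ->.
  rewrite /ex /rf /=; case: (T.1); case: (b.2); case: k => /=;
    (try by constructor 1); (try by constructor 2); by constructor 3.
case: s3 => [[c10 c20]|s3].
  left=> i; case: (allk i) => e; rewrite e; first exact: bdE.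
    by rewrite -c10; exact: bdE.
  by rewrite -c20; exact: bdE.
have k0 : co (pc b) b1.2 = ln T b1.2 by rewrite -l1.
have k1 : co (pc b1) b2.2 = ln T b2.2 by rewrite -l2.
have k2 : co (pc b2) b.2 = ln T b.2 by rewrite -l0.
have z0 := si0 T s3 u0 u1 k0 m1; have z1 := si1 T s3 u1 u2 k1 m2.
have z2 := si2 T s3 u2 u0 k2 m0.
have y0 := so0 T s3 u0 u1 k0 m1; have y1 := so1 T s3 u1 u2 k1 m2.
have y2 := so2 T s3 u2 u0 k2 m0.
rewrite -x0 -?x1 -?x2 -?e0 -?e1 -?e2 in z0 z1 z2 y0 y1 y2.
have {}z0 := z0 m0 k1; have {}z1 := z1 m1 k2; have {}z2 := z2 m2 k0.
have {}y0 := y0 m0 k1; have {}y1 := y1 m1 k2; have {}y2 := y2 m2 k0.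
have alld d : [\/ d = b.2, d = b1.2 | d = b2.2].
  rewrite e2 e1; move: u0 u1; case: (pc b) (pc b1) => [? v0] [? v1] /= -> ->.
  rewrite /rf /=; case: (T.1); case: (b.2); case: d => /=;
    (try by constructor 1); (try by constructor 2); by constructor 3.
have q1 : porbit rho b1 = porbit rho b by apply/eqP; rewrite eq_porbit_mem.
have q2 : porbit rho b2 = porbit rho b by apply/eqP; rewrite eq_porbit_mem.
have sid z d : co z d = ln T d -> touch T z -> exists x : dart,
    [/\ pc x = z, x.2 = d & x \in porbit rho b].
  by rewrite q1 in z1; rewrite q2 in z2; case: (alld d) => -> h1' h2'; [exact: z2|exact: z0|exact:
    z1].
right; exists T; split=> //.
- have cor y c : bd y -> (pc y).2 = ~~ T.1 -> c.2 = ~~ T.1 -> co (pc y) y.2 = ln T y.2 ->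
      co (pc y) (rf (pc y) y.2) = ln T (rf (pc y) y.2) ->
      let k := ex (pc y) y.2 in co c (tau k) = ln T (tau k) ->
      co c (tau' k) = ln T (tau' k) -> c \in S /\ nb c k \notin S.
    move=> hy uy uc c1 c2 k c3 c4; suff -> : c = pc y by split; [exact: pcS|exact: bdE].
    apply: (cell_inj2 (k := k)); rewrite ?uc ?uy // ?c3 ?c4 /k; move: c1 c2 {c3 c4 k};
    by rewrite /ex /rf; case: (pc y).2; case: y.2.
  move=> c k cu; case: (allk k) => e; rewrite e => c1 c2.
  + by apply: (cor b c h0 u0 cu m0 _ c1 c2); rewrite -e1.
  + by apply: (cor b1 c h1 u1 cu m1 _ c1 c2); rewrite -e2.
  + by apply: (cor b2 c h2 u2 cu m2 _ c1 c2); rewrite -e0.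
- by move=> z d h1' h2'; have [x [<- _ _]] := sid _ _ h1' h2'; exact: pcS.
- move=> x; apply/idP/idP => [hx|/andP[/eqP hc ht]].
    have hf : fin x \in porbit rho b.
      by rewrite -eq_porbit_mem (eqP (_ :
        porbit rho (fin x) == porbit rho x)) ?eq_porbit_mem ?fin_porbit.
    have [] := orb _ hf (fin_bd x) => ef.
    + by have [_ -> ->] := y2 _ ef; rewrite eqxx.
    + by have [_ -> ->] := y0 _ ef; rewrite eqxx.
    + by have [_ -> ->] := y1 _ ef; rewrite eqxx.
  have [y [h1' h2' h3']] := sid _ _ hc ht; suff -> : x = y by [].
  by move: h1' h2' {hc ht h3'}; case: x y => [x1' x2'] [y1' y2']; rewrite /pc /= => /val_inj -> ->.
Qed.
End Class.

(** * Potentials of the sides of a triangle *)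

(* Coordinate j of the midpoint of pane l of the cell c. *)
Definition mc (c : cell) (l j : dir) : int :=
  co c j + (if l == j then if c.2 then -1 else 1 else 0).
Definition leu (u : bool) (x y : int) : bool := if u then x <= y else y <= x.
(** The mod 2 cochain of side [i]: it marks the panes whose midpoint lies on the side, the two end
    points of the side included. *)
Definition onside (T : tri) (i : dir) (c : cell) (l : dir) : bool :=
  [&& mc c l i == ln T i, leu T.1 (ln T NE) (mc c l NE),
      leu T.1 (ln T W) (mc c l W) & leu T.1 (ln T SE) (mc c l SE)].

Lemma mc_nb c l j : mc (nb c l) l j = mc c l j.
Proof. rewrite /mc co_nb nb_up; case: (l == j); case: c.2 => /=; lia. Qed.

Lemma onside_nb T i c l : onside T i (nb c l) l = onside T i c l.
Proof. by rewrite /onside !mc_nb. Qed.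

Ltac tri_cases T := case: T => [[] [[? ?] ?]];
  rewrite /sz /inD /touch /inD /onside /mc /gtu /leu /ln /=.

(** Such a pane is the one at a corner, seen from outside: [nb c l] is a corner cell. [corners_in]
    keeps [c] out of S. *)
Lemma onside_outer T i c l : 3 <= sz T -> onside T i c l -> ~~ touch T c ->
  [/\ (nb c l).2 = ~~ T.1, co (nb c l) (tau l) = ln T (tau l)
    & co (nb c l) (tau' l) = ln T (tau' l)].
Proof.
move: c i l => [[a b] []] i l; case: i; case: l; tri_cases T => h1 h2 h3; split=> //; lia.
Qed.

(** A side that meets the cell runs along a whole midline of it, hence marks two of its panes. *)
Lemma touch_cocycle T i c : 3 <= sz T -> touch T c ->
  onside T i c NE (+) onside T i c W (+) onside T i c SE = false.
Proof. move: c i => [[a b] []] i; case: i; tri_cases T; lia. Qed.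

Lemma inD_onside T i c l : inD T (vx c (tau l)) -> inD T (vx c (tau' l)) ->
  onside T i c l = false.
Proof. move: c i l => [[a b] []] i l; case: i; case: l; tri_cases T; lia. Qed.

Lemma onside_side T i j c l : inD T (vx c (tau l)) || inD T (vx c (tau' l)) ->
  onside T i c l -> onside T j c l -> i = j.
Proof. move: c i j l => [[a b] []] i j l; case: i; case: j; case: l => //; tri_cases T; lia. Qed.

(** The two vertices are the ends of the exit pane, so a side passes through its midpoint. Only the
    midlines in directions [d] and [rf c d] end there, and the first is excluded. The orientation of
    [c] then tells exits from entries. *)
Lemma cross_geo T c d : inD T (vx c d) != inD T (vx c (rf c d)) -> co c d != ln T d ->
  [/\ co c (rf c d) = ln T (rf c d), onside T (rf c d) c (ex c d)
    & c.2 = inD T (vx c d) (+) T.1].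
Proof.
move: c d => [[a b] []] d; rewrite /rf /ex; case: d; tri_cases T => h1 h2; split; lia.
Qed.

Lemma onside_cross T i c d : 3 <= sz T -> touch T c -> onside T i c (ex c d) -> co c d != ln T d ->
  inD T (vx c d) != inD T (vx c (rf c d)) /\ i = rf c d.
Proof.
move: c i d => [[a b] []] i d; rewrite /rf /ex; case: i; case: d; tri_cases T => h1 h2 h3 h4;
  split=> //; lia.
Qed.

Lemma inD_base T : 3 <= sz T ->
  inD T (if T.1 then (T.2.1.1 + 1, T.2.1.2 + 1) else (T.2.1.1, T.2.1.2)).
Proof. by tri_cases T; lia. Qed.

Lemma inD_ex T : 3 <= sz T -> exists v, inD T v.
Proof. by move=> /inD_base; eexists; eassumption. Qed.

(** Every inner vertex is joined to the inner vertex [base] by steps along two grid directions that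
    do not leave the triangle. *)
Lemma inD_connect T (R : vec -> Prop) :
    (forall c l, inD T (vx c (tau l)) -> inD T (vx c (tau' l)) ->
       R (vx c (tau l)) <-> R (vx c (tau' l))) ->
  forall v w, inD T v -> inD T w -> R v -> R w.
Proof.
move=> h v w; pose base : vec := if T.1 then (T.2.1.1 + 1, T.2.1.2 + 1) else (T.2.1.1, T.2.1.2).
suff H p : inD T p -> R p <-> R base by move=> /H h1 /H h2 /h1 /h2.
have hh (x y : int) : inD T (x, y) -> inD T (x - 1, y) -> R (x, y) <-> R (x - 1, y).
  by move=> h1 h2; have := h ((x - 1, y), true) W; rewrite /= subrK => H; split=> /H; apply.
have hw (x y : int) : inD T (x, y) -> inD T (x, y - 1) -> R (x, y) <-> R (x, y - 1).
  by move=> h1 h2; have := h ((x, y - 1), true) NE; rewrite /= subrK => H; split=> /H; apply.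
move=> {h}; case: p => [x y]; have [n] := ubnP (`|(x - base.1)%R| + `|(y - base.2)%R|)%N.
elim: n x y => // n IH x y hn hx.
have [exx|nx] := eqVneq x base.1.
  have [ey|ny] := eqVneq y base.2; first by rewrite exx ey -surjective_pairing.
  have [hd hn'] : inD T (if T.1 then (x, y - 1) else (x, y + 1)) /\
     (`|(x - base.1)%R| + `|((if T.1 then y - 1 else y + 1) - base.2)%R| < n)%N.
    by move: hx hn ny exx; rewrite {IH hh hw} /base {base}; tri_cases T => *; split; lia.
  move: hd hn'; case: (T.1) => hd hn'; apply: (iff_trans _ (IH _ _ hn' hd)); first exact: hw.
  by apply: iff_sym; have := hw x (y + 1); rewrite addrK => H; apply: H.
have [hd hn'] : inD T (if T.1 then (x - 1, y) else (x + 1, y)) /\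
   (`|((if T.1 then x - 1 else x + 1) - base.1)%R| + `|(y - base.2)%R| < n)%N.
  by move: hx hn nx; rewrite {IH hh hw} /base {base}; tri_cases T => *; split; lia.
move: hd hn'; case: (T.1) => hd hn'; apply: (iff_trans _ (IH _ _ hn' hd)); first exact: hh.
by apply: iff_sym; have := hh (x + 1) y; rewrite addrK => H; apply: H.
Qed.

(** * Topological conditions on a set of cells, and the potentials they provide *)

Definition connected_cells (S : {fset cell}) : Prop :=
  forall A : cell -> bool, (exists2 c, c \in S & A c) ->
  (forall c i, c \in S -> A c -> nb c i \in S -> A (nb c i)) ->
  forall c, c \in S -> A c.

(* The first cohomology of the union of S with coefficients in Z/2 vanishes. *)
Definition potentials (S : {fset cell}) : Prop := forall d : cell -> dir -> bool,
  (forall c i, c \in S -> nb c i \in S -> d (nb c i) i = d c i) ->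
  (forall c, c \in S -> d c NE (+) d c W (+) d c SE = false) ->
  exists F : vec -> bool, forall c i, c \in S ->
    F (vx c (tau i)) (+) F (vx c (tau' i)) = d c i.

Definition filled (S : {fset cell}) : Prop := forall T, 3 <= sz T ->
  sides_in S T -> forall v, inD T v -> iv S v.

Lemma dir_tauP (i j : dir) : [\/ i = j, i = tau j | i = tau' j].
Proof. by case: i; case: j; (try by constructor 1); (try by constructor 2); constructor 3. Qed.

Lemma vertex_const (S : {fset cell}) (E : vec -> bool) : connected_cells S ->
    (forall c l, c \in S -> E (vx c (tau l)) = E (vx c (tau' l))) ->
  forall c c' i j, c \in S -> c' \in S -> E (vx c i) = E (vx c' j).
Proof.
move=> cS h c c' i j cs cs'.
have all3 z k l : z \in S -> E (vx z k) = E (vx z l).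
  move=> zs; case: (dir_tauP k l) => -> //.
    by have := h z (tau' l) zs; case: l.
  by have := h z (tau l) zs; case: l.
have H := cS (fun z => E (vx z NE) == E (vx c i)).
apply/esym/eqP; rewrite (all3 c' j NE cs'); apply: H => //.
  by exists c => //; rewrite (all3 c NE i).
move=> z k zs /eqP <- zn; apply/eqP.
rewrite (all3 _ _ (tau k) zn) vx_nb1; exact: all3.
Qed.

Section Triangle.
Variables (S : {fset cell}) (T : tri).
Hypotheses (s3 : 3 <= sz T) (fT : forall v, inD T v -> iv S v) (cT : corners_in S T).
Hypotheses (conn : connected_cells S) (pot : potentials S).

Lemma touch_in c : touch T c -> c \in S.
Proof. by case/touchP => i /fT/ivP h; exact: h. Qed.

Lemma onside_touch i c l : c \in S -> onside T i c l -> touch T c.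
Proof.
move=> cs h; apply/negPn/negP => h'; have [h1 h2 h3] := onside_outer s3 h h'.
by have [_] := cT h1 h2 h3; rewrite nbK cs.
Qed.

(** By the corners, [onside T i] is a cocycle on all of S. Panes between inner vertices are
    unmarked, so a potential is constant there and can be normalised to 0; [F v] then says that [v]
    lies beyond side [i]. *)
Lemma side_pot i : exists F : vec -> bool,
  (forall c l, c \in S -> F (vx c (tau l)) (+) F (vx c (tau' l)) = onside T i c l) /\
  (forall v, inD T v -> F v = false).
Proof.
have [|c cs|F hF] := pot (d := onside T i).
- by move=> c l _ _; exact: onside_nb.
- case: (boolP (touch T c)) => h; first exact: touch_cocycle.
  have n l : onside T i c l = false by apply: contraNF h; exact: onside_touch.
  by rewrite !n.
have [v0 hv0] := inD_ex s3.
exists (fun v => F v (+) F v0); split=> [c l cs|v hv];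
  first by rewrite -(hF c l cs) addbACA addbb addbF.
suff -> : F v = F v0 by rewrite addbb.
apply: (@inD_connect T (fun v => F v = F v0) _ v0 v) => // c l h1 h2.
have cs : c \in S by move/fT/ivP: h1; apply.
have := hF c l cs; rewrite (inD_onside i h1 h2).
by case: (F (vx c (tau l))); case: (F (vx c (tau' l))) => //.
Qed.

Definition side_potential i (F : vec -> bool) : Prop :=
  (forall c l, c \in S -> F (vx c (tau l)) (+) F (vx c (tau' l)) = onside T i c l) /\
  (forall v, inD T v -> F v = false).

Lemma onside_rf i F c d : side_potential i F -> c \in S ->
  F (vx c (rf c d)) = F (vx c d) (+) onside T i c (ex c d).
Proof.
move=> [hF _] cs; rewrite -(hF _ _ cs); case: c {cs} => [[a b] []]; case: d; rewrite /rf /ex /=;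
  by do 2!case: (F _).
Qed.

Lemma side_potential_touch i F c a : side_potential i F -> inD T (vx c a) ->
  F (vx c (tau a)) = onside T i c (tau' a) /\ F (vx c (tau' a)) = onside T i c (tau a).
Proof.
move=> [hF hD] ha; have cs : c \in S by move/fT/ivP: ha; apply.
rewrite -!hF //; have := hD _ ha; case: a {ha} => /= ->; rewrite ?addbF ?addFb; by [].
Qed.

(** The product [E] of the potentials vanishes on every cell touching T, where both values are read
    off from a single pane and a pane with an inner end is on at most one side. Elsewhere no pane is
    marked, so [E] is constant on S, hence 0. *)
Lemma side_disjoint i j Fi Fj c k : i <> j -> side_potential i Fi -> side_potential j Fj ->
  c \in S -> ~~ (Fi (vx c k) && Fj (vx c k)).
Proof.
move=> nij hi hj cs; have [v0 v0D] := inD_ex s3.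
pose E v := Fi v && Fj v; rewrite -/(E _).
have Et z l : touch T z -> E (vx z l) = false.
  case/touchP => a ha; have [i1 i2] := side_potential_touch hi ha.
  have [j1 j2] := side_potential_touch hj ha; have := hi.2 _ ha.
  rewrite /E; case: (dir_tauP l a) => -> [h]; first by rewrite h.
    rewrite i1 j1; apply/negbTE/negP => /andP[h1 h2]; apply: nij; apply: onside_side h1 h2.
    by case: a ha {i1 i2 j1 j2 h} => /= ->; rewrite ?orbT.
  rewrite i2 j2; apply/negbTE/negP => /andP[h1 h2]; apply: nij; apply: onside_side h1 h2.
  by case: a ha {i1 i2 j1 j2 h} => /= ->; rewrite ?orbT.
pose z := cellat v0 true NE; have hz : touch T z by apply/touchP; exists NE; rewrite vx_cellat.
rewrite (vertex_const (E := E) conn _ k NE cs (touch_in hz)) ?Et // => x l xs.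
case: (boolP (touch T x)) => h; first by rewrite !Et.
have n m : onside T m x l = false by apply: contraNF h; exact: onside_touch.
have := hi.1 x l xs; have := hj.1 x l xs; rewrite !n /E.
by do 4!case: (_ (vx _ _)).
Qed.
End Triangle.

(** * Exits from a triangle *)

Lemma niv_piv (S : {fset cell}) (y : S * dir) : bd y ->
  ~~ iv S (piv y) /\ ~~ iv S (piv (rho y)).
Proof.
move=> hy; have [h1 h2] := nivP hy; rewrite piv_rho /piv; move: h1 h2; rewrite /ex /rf.
by case: (pc y).2; case: (y.2) => /= h1 h2.
Qed.

Definition exitd (S : {fset cell}) (T : tri) (d : dir) (y : S * dir) : bool :=
  [&& y.2 == d, inD T (piv y) & ~~ inD T (piv (rho y))].
Definition enterd (S : {fset cell}) (T : tri) (d : dir) (y : S * dir) : bool :=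
  [&& y.2 == d, ~~ inD T (piv y) & inD T (piv (rho y))].

Section Balance.
Variables (S : {fset cell}) (T : tri).
Notation dart := (S * dir)%type.
Implicit Types (x y : dart) (O : {set dart}).

Record triangle_in : Prop := TriangleIn {
  tri_sz : 3 <= sz T;
  tri_fill : forall v, inD T v -> iv S v;
  tri_corners : corners_in S T }.

Hypotheses (pot : potentials S) (hT : triangle_in).

(* By passesE the direction NE plays no special role here. *)
Definition passes O : nat := \sum_(y in O) exitd T NE y.

Variable x0 : dart.
Let O := porbit rho x0.
Hypothesis hO : forall y, y \in O -> ~~ ((co (pc y) y.2 == ln T y.2) && touch T (pc y)).

Lemma cross_dart y : y \in O -> inD T (piv y) != inD T (piv (rho y)) ->
  [/\ co (pc y) (rf (pc y) y.2) = ln T (rf (pc y) y.2),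
      onside T (rf (pc y) y.2) (pc y) (ex (pc y) y.2)
    & (pc y).2 = inD T (piv y) (+) T.1].
Proof.
move=> /hO + h; rewrite piv_rho /piv in h *; rewrite negb_and => /orP[|/negP[]].
  exact: cross_geo.
apply/touchP; case: (boolP (inD T (vx (pc y) y.2))) h => [|_] h; first by exists y.2.
by exists (rf (pc y) y.2); move: h; case: (inD _ _).
Qed.

(** The direction changes only at bounces, where neither pivot is an interior vertex, so neither is
    in T. Thus [inD T (piv y)], restricted to darts of direction [d], telescopes. *)
Lemma exit_enter d : (\sum_(y in O) exitd T d y = \sum_(y in O) enterd T d y)%N.
Proof.
apply/esym/(porbit_telescope (g := fun y => (y.2 == d) && inD T (piv y))) => y hy.
rewrite /exitd /enterd; case: (boolP (bd y)) => [h|/rho_str[_ ->]].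
  have [h1 h2] := niv_piv h.
  rewrite (negbTE (contra (@tri_fill hT _) h1)) (negbTE (contra (@tri_fill hT _) h2)).
  by rewrite !andbF.
by move: (_ == d) (inD T (piv y)) (inD T (piv (rho y))) => [] [] [].
Qed.

(** Along the pivots the potential of side [i] rises from 0 to 1 at an exit through this side, falls
    from 1 to 0 at an entry, and is constant otherwise. *)
Lemma side_balance i :
  (\sum_(y in O) (exitd T y.2 y && (rf (pc y) y.2 == i)) =
   \sum_(y in O) (enterd T y.2 y && (rf (pc y) y.2 == i)))%N.
Proof.
have [F hF] := side_pot (tri_sz hT) (@tri_fill hT) (tri_corners hT) pot i.
apply: (porbit_telescope (g := fun y => F (piv y))) => y hy.
have js := onside_rf y.2 hF (pcS y); rewrite -piv_rho -/(piv y) in js.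
have hc := @cross_dart y hy; rewrite /exitd /enterd eqxx /=.
have [hD|hD] := boolP (inD T (piv y) != inD T (piv (rho y))); last first.
  move: js; rewrite negbK in hD; rewrite -(eqP hD) andbN andNb /= !addn0.
  case: (boolP (onside T i (pc y) (ex (pc y) y.2))) => [os|_ ->]; last by rewrite addbF.
  have tc := onside_touch (tri_sz hT) (tri_corners hT) (pcS y) os.
  have nc : co (pc y) y.2 != ln T y.2 by move: (hO hy); rewrite tc andbT.
  by have [] := onside_cross (tri_sz hT) tc os nc; rewrite -piv_rho -/(piv y) (eqP hD) eqxx.
have [e1 e2 e3] := hc hD.
have e4 : onside T i (pc y) (ex (pc y) y.2) = (rf (pc y) y.2 == i).
  apply/idP/eqP => [h|<- //]; apply/esym; apply: onside_side h e2.
  move: hD; rewrite piv_rho /piv /ex /rf; case: (pc y).2; case: (y.2) => /=;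
    by do 2!case: (inD _ _).
move: js hD; rewrite e4; have h1 := hF.2 (piv y); have h2 := hF.2 (piv (rho y)).
case: (inD T (piv y)) h1; case: (inD T (piv (rho y))) h2 => // h1 h2 + _.
  by rewrite h2 //=; case: (rf _ _ == i) => ->.
by rewrite h1 //=; case: (rf _ _ == i) => /esym/eqP; rewrite ?addbT ?addbF; case: (F _).
Qed.

Lemma rf_side y i : (pc y).2 = ~~ T.1 -> rf (pc y) y.2 = i <-> y.2 = if T.1 then tau i else tau' i.
Proof.
rewrite /rf => ->; case: (T.1); case: (y.2); case: i; by split.
Qed.

Lemma rf_side' y i : (pc y).2 = T.1 -> rf (pc y) y.2 = i <-> y.2 = if T.1 then tau' i else tau i.
Proof.
rewrite /rf => ->; case: (T.1); case: (y.2); case: i; by split.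
Qed.

(** Exits through side [i] all have one of the directions [tau i], [tau' i], and entries through it
    have the other. With [side_balance] and [exit_enter], the exits in these two directions are
    equally many; [i] is arbitrary. *)
Lemma passesE d : (\sum_(y in O) exitd T d y)%N = passes O.
Proof.
pose f d := (\sum_(y in O) exitd T d y)%N; rewrite /passes -/(f d) -/(f NE).
have H i : f (if T.1 then tau i else tau' i) = f (if T.1 then tau' i else tau i).
  rewrite [RHS]exit_enter /f; have := side_balance i.
  rewrite (eq_bigr (fun y => exitd T (if T.1 then tau i else tau' i) y : nat)); last first.
    move=> y hy; rewrite /exitd; case: (boolP (inD T (piv y) && ~~ inD T (piv (rho y)))) => h;
      last first.
      by rewrite !andbF.
    have [] := @cross_dart y hy; first by case: (inD _ _) h; case: (inD _ _).
    case/andP: h => -> h; rewrite !andbT eqxx /= => _ _ u; congr nat_of_bool.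
    by apply/eqP/eqP; apply rf_side.
  rewrite [X in _ = X -> _](eq_bigr (fun y => enterd T (if T.1 then tau' i else tau i) y : nat)) //.
  move=> y hy; rewrite /enterd; case: (boolP (~~ inD T (piv y) && inD T (piv (rho y)))) => h;
    last first.
    by rewrite !andbF.
  have [] := @cross_dart y hy; first by case: (inD _ _) h; case: (inD _ _).
  case/andP: h => h _; rewrite (negbTE h) !andbT eqxx /= => _ _ u; congr nat_of_bool.
  by apply/eqP/eqP; apply rf_side'.
have := H NE; have := H W; have := H SE; case: (T.1) => /= h1 h2 h3; case: d => //; congruence.
Qed.
End Balance.

(** * Several triangles *)

(** As the coordinates of a point add up to 0, the first term is coordinate [i] of the corner of T
    opposite side [i]. For equal orientations, all of T lies strictly on the outer side of line [i]
    of T'. *)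
Definition separated (T T' : tri) (i : dir) : bool :=
  gtu T.1 (- (ln T (tau i) + ln T (tau' i))) (ln T' i).

Lemma separated_touch T T' i c : T.1 = T'.1 -> separated T T' i ->
  touch T c -> touch T' c -> False.
Proof.
move: c => [[a b] v]; case: T T' => [u [[x y] z]] [u' [[x' y'] z']] /= <-.
rewrite /separated /touch /inD /gtu /ln /=.
case: u; case: i; case: v => /=; lia.
Qed.

(** The cell at the corner opposite side [k], where the two other sides meet. *)
Definition corner_cell (T : tri) (k : dir) : cell :=
  let: (u, (a, b, s)) := T in
  let e : int := if u then 2 else 1 in
  match k with
  | NE => ((- s - e - b, b), ~~ u)
  | W => ((a, - s - e - a), ~~ u)
  | SE => ((a, b), ~~ u)
  end.

Lemma corner_cellE T k : [/\ (corner_cell T k).2 = ~~ T.1,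
  co (corner_cell T k) (tau k) = ln T (tau k) &
  co (corner_cell T k) (tau' k) = ln T (tau' k)].
Proof. by case: T => [[] [[a b] s]]; case: k; rewrite /ln /=; split=> //; lia. Qed.

Lemma corner_touch T k : 3 <= sz T -> touch T (corner_cell T k).
Proof. by case: k; tri_cases T; lia. Qed.

(** The corner of T opposite side [k] lies in T', strictly inside with respect to side [tau k], so
    one of the nearby vertices is an inner vertex of T'. These vertices are ends of a boundary pane,
    and [corner_out] gives a contradiction. *)
Lemma corner_inside T T' k : T.1 = T'.1 -> ~~ separated T T' k ->
    gtu T.1 (ln T' (tau k)) (ln T (tau k)) -> leu T.1 (ln T' (tau' k)) (ln T (tau' k)) ->
  inD T' (vx (corner_cell T k) (tau k)) || inD T' (vx (corner_cell T k) (tau' k)).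
Proof.
case: T T' => [u [[x y] z]] [u' [[x' y'] z']] /= <-.
rewrite /separated /touch /inD /gtu /leu /ln /=.
case: u; case: k => /=; lia.
Qed.

Lemma corner_inside' T T' k : T.1 = T'.1 -> ~~ separated T T' k ->
    gtu T.1 (ln T' (tau' k)) (ln T (tau' k)) -> leu T.1 (ln T' (tau k)) (ln T (tau k)) ->
  inD T' (vx (corner_cell T k) (tau k)) || inD T' (vx (corner_cell T k) (tau' k)).
Proof.
case: T T' => [u [[x y] z]] [u' [[x' y'] z']] /= <-.
rewrite /separated /touch /inD /gtu /leu /ln /=.
case: u; case: k => /=; lia.
Qed.

Lemma corner_out (S : {fset cell}) T T' k : triangle_in S T -> triangle_in S T' ->
  ~~ (inD T' (vx (corner_cell T k) (tau k)) || inD T' (vx (corner_cell T k) (tau' k))).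
Proof.
move=> hT hT'; have [e1 e2 e3] := corner_cellE T k.
have [_ h] := tri_corners hT e1 e2 e3; have [n1 n2] := nivP h.
by rewrite negb_or (contra (@tri_fill _ _ hT' _) n1) (contra (@tri_fill _ _ hT' _) n2).
Qed.

(** Without separation, [corner_out] forces any two lines of T' to lie on opposite sides of the
    corresponding lines of T, or both to coincide with them. The latter gives a common corner cell
    and a common dart; the former is impossible for three lines. *)
Lemma separate (S : {fset cell}) T T' (O O' : {set S * dir}) :
  triangle_in S T -> triangle_in S T' ->
    T.1 = T'.1 -> side_darts T O -> side_darts T' O' -> (forall x, x \in O -> x \notin O') ->
  exists i, separated T T' i || separated T' T i.
Proof.
move=> hT hT' eu hO hO' dis.
case: (boolP [exists i, separated T T' i || separated T' T i]) => [/existsP//|].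
rewrite negb_exists => /forallP ns.
have {}ns i : ~~ separated T T' i /\ ~~ separated T' T i by apply/andP; rewrite -negb_or.
have nshare k : ln T (tau k) = ln T' (tau k) -> ln T (tau' k) = ln T' (tau' k) -> False.
  move=> h1 h2; have [e1 e2 e3] := corner_cellE T k; have [f1 f2 f3] := corner_cellE T' k.
  have ec : corner_cell T k = corner_cell T' k.
    by apply: (cell_inj2 (k := k)); rewrite ?e1 ?e2 ?e3 ?f1 ?f2 ?f3 // eu.
  have [qS _] := tri_corners hT e1 e2 e3.
  have := dis ([` qS], tau k); rewrite hO hO' /pc /= e2 h1 eqxx.
  rewrite (corner_touch k (tri_sz hT)) ec (corner_touch k (tri_sz hT')).
  by move=> /(_ isT).
have c1 k := corner_inside eu (ns k).1; have c2 k := corner_inside' eu (ns k).1.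
have c3 k := corner_inside (esym eu) (ns k).2; have c4 k := corner_inside' (esym eu) (ns k).2.
have {}c1 k : gtu T.1 (ln T' (tau k)) (ln T (tau k)) -> ~~ leu T.1 (ln T' (tau' k)) (ln T (tau' k)).
  by move=> h; apply/negP => /(c1 k h); rewrite (negbTE (corner_out _ hT hT')).
have {}c2 k : gtu T.1 (ln T' (tau' k)) (ln T (tau' k)) -> ~~ leu T.1 (ln T' (tau k)) (ln T (tau k)).
  by move=> h; apply/negP => /(c2 k h); rewrite (negbTE (corner_out _ hT hT')).
have {}c3 k : gtu T'.1 (ln T (tau k)) (ln T' (tau k)) -> ~~ leu T'.1 (ln T (tau' k)) (ln T' (tau' k)).
  by move=> h; apply/negP => /(c3 k h); rewrite (negbTE (corner_out _ hT' hT)).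
have {}c4 k : gtu T'.1 (ln T (tau' k)) (ln T' (tau' k)) -> ~~ leu T'.1 (ln T (tau k)) (ln T' (tau k)).
  by move=> h; apply/negP => /(c4 k h); rewrite (negbTE (corner_out _ hT' hT)).
exfalso; move: (nshare NE) (nshare W) (nshare SE) (c1 NE) (c1 W) (c1 SE) (c2 NE) (c2 W) (c2 SE)
  (c3 NE) (c3 W) (c3 SE) (c4 NE) (c4 W) (c4 SE); rewrite -eu /gtu /leu /=.
move: (ln T NE) (ln T W) (ln T SE) (ln T' NE) (ln T' W) (ln T' SE) => a b c a' b' c'.
by clear; case: (T.1) => /=; lia.
Qed.

Lemma onside_lpos T e c c' d : e != d -> co c d = co c' d ->
  onside T e c (ex c d) -> onside T e c' (ex c' d) -> lpos c d = lpos c' d.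
Proof.
case: c c' => [[a b] v] [[a' b'] v']; case: T => [u [[x y] z]].
rewrite /onside /mc /ln /ex /lpos /= => ne h /and4P[/eqP h1 _ _ _] /and4P[/eqP h2 _ _ _].
by move: ne h h1 h2; case: e; case: d; case: v; case: v' => //=; lia.
Qed.

(** * Exits of one orbit from several triangles of the same orientation *)

Section Far.
Variables (S : {fset cell}) (T T' : tri) (f : dir) (F : vec -> bool) (v1 : vec).
Hypotheses (hT : triangle_in S T) (hT' : triangle_in S T').
Hypothesis apart : forall c, touch T c -> touch T' c -> False.
Hypothesis hF : side_potential S T f F.

Lemma far_const c l : touch T' c -> F (vx c (tau l)) = F (vx c (tau' l)).
Proof.
move=> tc; have cs := touch_in (@tri_fill _ _ hT') tc.
have n : onside T f c l = false.
  by apply/negP => /(onside_touch (tri_sz hT) (tri_corners hT) cs) /apart; apply.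
by have := hF.1 c l cs; rewrite n; do 2!case: (F _).
Qed.

Lemma far_touch c k : inD T' v1 -> F v1 -> touch T' c -> F (vx c k).
Proof.
move=> D1 F1 tc; have [a ha] := touchP _ _ tc.
have h : F (vx c a).
  apply: (@inD_connect T' (fun v => F v) _ v1) => // z l h1 h2.
  by rewrite far_const //; apply/touchP; exists (tau l).
case: (dir_tauP k a) => -> //.
  by rewrite -[tau a](_ : tau' (tau' a) = _) -1?far_const //; case: (a) h.
by rewrite -[tau' a](_ : tau (tau a) = _) ?far_const //; case: (a) h.
Qed.
End Far.

Lemma lpos_step_inj (p : int) (m m' : nat) : p + 2 * m%:Z = p + 2 * m'%:Z -> m = m'.
Proof. lia. Qed.

Lemma cell_inj3 c c' d : c.2 = c'.2 -> co c d = co c' d ->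
  co c (rf c d) = co c' (rf c d) -> c = c'.
Proof.
case: c c' => [[a b] v] [[a' b'] v'] /= <-; rewrite /rf /= => h1 h2; congr (_, _, _);
  by move: h1 h2; case: d; case: v => /=; lia.
Qed.

Section Avoiding.
Variables (S : {fset cell}) (I : finType) (P : pred I) (T : I -> tri) (OT : I -> {set S * dir}).
Notation dart := (S * dir)%type.
Variables (u : bool) (x0 : dart).
Let O := porbit rho x0.
Hypotheses (conn : connected_cells S) (pot : potentials S).
Hypothesis hT : forall i, P i -> triangle_in S (T i).
Hypothesis hO : forall i, P i -> side_darts (T i) (OT i).
Hypothesis hu : forall i, P i -> (T i).1 = u.
Hypothesis nO : forall i x, P i -> x \in O -> x \notin OT i.
Hypothesis dis : forall i j x, P i -> P j -> i != j -> x \in OT i -> x \notin OT j.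

Lemma apart i j c : P i -> P j -> i != j -> touch (T i) c -> touch (T j) c -> False.
Proof.
move=> Pi Pj nij t1 t2; have eu : (T i).1 = (T j).1 by rewrite !hu.
have [k /orP[] s] := separate (hT Pi) (hT Pj) eu (hO Pi) (hO Pj) (fun x => dis Pi Pj nij (x := x)).
  exact: separated_touch eu s t1 t2.
exact: separated_touch (esym eu) s t2 t1.
Qed.

Lemma not_own i (y : dart) : P i -> y \in O -> ~~ ((co (pc y) y.2 == ln (T i) y.2) && touch (T i) (pc y)).
Proof. by move=> Pi yO; rewrite -(hO Pi) nO. Qed.

Lemma piv_touch i (y : dart) : inD (T i) (piv y) -> touch (T i) (pc y).
Proof. by move=> h; apply/touchP; exists y.2. Qed.

Lemma crossing i (y : dart) : P i -> y \in O -> inD (T i) (piv y) != inD (T i) (piv (rho y)) ->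
  [/\ co (pc y) (rf (pc y) y.2) = ln (T i) (rf (pc y) y.2),
      onside (T i) (rf (pc y) y.2) (pc y) (ex (pc y) y.2)
    & (pc y).2 = inD (T i) (piv y) (+) u].
Proof. by move=> Pi yO h; rewrite -(hu Pi); apply: cross_dart yO h => z; exact: not_own. Qed.

Variable F : I -> dir -> vec -> bool.
Hypothesis hF : forall i d, P i -> side_potential S (T i) d (F i d).
Variables (i0 : I) (v0 : vec).
Hypotheses (Pi0 : P i0) (v0D : inD (T i0) v0).

(* v0 lies neither beyond side tau d nor beyond side tau' d of T i; a beam leaves at most
   one of the triangles in such a direction. *)
Definition avoid i d : bool := ~~ F i (tau d) v0 && ~~ F i (tau' d) v0.

Lemma v0_vertex : exists2 c, c \in S & vx c NE = v0.
Proof.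
exists (cellat v0 true NE); last by rewrite vx_cellat.
by have /ivP h := tri_fill (hT Pi0) v0D; apply: h; exact: vx_cellat.
Qed.

Lemma strand_O y k : y \in O -> iter k rho y \in O.
Proof.
by rewrite /O -!eq_porbit_mem => /eqP <-; rewrite eq_porbit_mem mem_iter_rho.
Qed.

(** If one beam leaves T j at [y] and T i at [x] afterwards, each triangle lies beyond a side of the
    other, and every vertex of S is beyond one of these two sides. But [v0] is beyond neither. *)
Lemma no_two_avoiding i j x y k : P i -> P j -> i != j -> x \in O -> y \in O ->
    exitd (T i) x.2 x -> exitd (T j) y.2 y -> avoid i x.2 -> avoid j y.2 ->
    x = iter k rho y -> (forall m, (m < k)%N -> ~~ bd (iter m rho y)) -> False.
Proof.
move=> Pi Pj nij xO yO ex_x ex_y av_x av_y ek hk.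
have str m : (m <= k)%N -> [/\ (iter m rho y).2 = y.2,
    co (pc (iter m rho y)) y.2 = co (pc y) y.2
    & lpos (pc (iter m rho y)) y.2 = lpos (pc y) y.2 + 2 * m%:Z].
  by move=> mk; apply: iter_str => m' m'm; apply: hk; exact: leq_trans m'm mk.
have pivS m : piv (iter m.+1 rho y) = vx (pc (iter m rho y)) (rf (pc (iter m rho y)) (iter m rho y).2).
  by rewrite -piv_rho.
case/and3P: ex_y => _ yD yD'; case/and3P: ex_x => _ xD xD'.
have [_ osy uy] : [/\ co (pc y) (rf (pc y) y.2) = ln (T j) (rf (pc y) y.2),
    onside (T j) (rf (pc y) y.2) (pc y) (ex (pc y) y.2) & (pc y).2 = ~~ u].
  by have := crossing Pj yO; rewrite yD yD' => /(_ isT) [? ? ->].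
have dx : x.2 = y.2 by rewrite ek; have [] := str k (leqnn k).
rewrite dx in av_x; move: osy av_x av_y; set d := y.2; set e := rf (pc y) d.
(* The beam leaves T j through side [e] and enters T i through side [f]; both are determined by [d]
   and [u], and they are the two sides different from [d]. *)
pose f := if u then tau d else tau' d.
have ed : e != d by exact: rf_neq.
have fd : f != d by rewrite /f; case: (u); case: (d).
have ee : e = if u then tau' d else tau d by rewrite /e /rf uy; case: (u).
move=> osy av_x av_y.
have avx : ~~ F i f v0 by move: av_x; rewrite /avoid /f => /andP[]; case: (u).
have avy : ~~ F j e v0 by move: av_y; rewrite /avoid ee => /andP[]; case: (u).
have jump l g m : P l -> (m < k)%N -> F l g (piv (iter m.+1 rho y)) =
    F l g (piv (iter m rho y)) (+) onside (T l) g (pc (iter m rho y)) (ex (pc (iter m rho y)) d).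
  move=> Pl mk; have [e1 _ _] := str m (ltnW mk).
  by rewrite pivS e1 (onside_rf _ (hF g Pl)) ?pcS // /piv e1.
have once l g m m' : g != d -> (m <= k)%N -> (m' <= k)%N ->
    onside (T l) g (pc (iter m rho y)) (ex (pc (iter m rho y)) d) ->
    onside (T l) g (pc (iter m' rho y)) (ex (pc (iter m' rho y)) d) -> m = m'.
  move=> gd mk mk' h1 h2; have [_ a2 a3] := str m mk; have [_ b2 b3] := str m' mk'.
  have := onside_lpos gd (etrans a2 (esym b2)) h1 h2; rewrite a3 b3; exact: lpos_step_inj.
have ap1 c : touch (T i) c -> touch (T j) c -> False := apart Pi Pj nij (c := c).
have ap2 c : touch (T j) c -> touch (T i) c -> False by move=> h1 h2; exact: ap1 h2 h1.
have kpos : (0 < k)%N.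
  rewrite lt0n; apply/eqP => k0; move: ek; rewrite k0 => exy.
  by apply: (ap1 (pc y)); [have := piv_touch xD; rewrite exy|exact: piv_touch].
(* The beam crosses side [e] of T j at [y] and, by [once], never again on this line. *)
have Fx : F j e (piv x).
  suff Fm m : (0 < m <= k)%N -> F j e (piv (iter m rho y)).
    by rewrite ek; apply: Fm; rewrite kpos leqnn.
  elim: m => // m IH /andP[_ mk]; rewrite (jump j e m Pj mk).
  case: (posnP m) => [->|m0]; first by rewrite ((hF e Pj).2 _ yD) osy.
  rewrite IH ?m0 1?ltnW // (_ : onside _ _ _ _ = false) //.
  apply/negP => os; have em' := once j e 0%N m ed isT (ltnW mk) osy os.
  by move: m0; rewrite -em'.
(* Since T i does not contain the pivot of [y], the beam enters it later, through side [f]; before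
   this crossing it was beyond [f], and by [once] all the way back to [y]. *)
have Fy : F i f (piv y).
  have [m mk [mD mD']] : exists2 m, (m < k)%N & ~~ inD (T i) (piv (iter m rho y)) /\
      inD (T i) (piv (iter m.+1 rho y)).
    have yni : ~~ inD (T i) (piv y).
      by apply/negP => h; apply: (ap1 (pc y)); exact: piv_touch.
    suff H n : (n <= k)%N -> inD (T i) (piv (iter n rho y)) -> exists2 m, (m < k)%N &
        ~~ inD (T i) (piv (iter m rho y)) /\ inD (T i) (piv (iter m.+1 rho y)).
      by apply: (H k (leqnn k)); rewrite -ek.
    elim: n => [|n IH] nk h; first by rewrite /= (negbTE yni) in h.
    case: (boolP (inD (T i) (piv (iter n rho y)))) => h'; last by exists n.
    exact: IH (ltnW nk) h'.
  have := crossing Pi (strand_O m yO); rewrite (negbTE mD) mD' => /(_ isT) [_ os um].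
  have [em _ _] := str m (ltnW mk); rewrite em -/d in os.
  have ef : rf (pc (iter m rho y)) d = f by rewrite /rf um /f; case: (u).
  rewrite ef in os; have := jump i f m Pi mk; rewrite ((hF f Pi).2 _ mD') os addbT.
  move/esym/negbFE => Fm.
  suff H n : (n <= m)%N -> F i f (piv (iter n rho y)) -> F i f (piv y) by exact: H (leqnn m) Fm.
  elim: n => // m' IH mm' Fm'; apply: (IH (ltnW mm')); move: Fm'; rewrite jump //; last by exact:
    leq_trans mm' (ltnW mk).
  rewrite (_ : onside _ _ _ _ = false) ?addbF //; apply/negP => os'.
  have em' := once i f m m' fd (ltnW mk) (ltnW (leq_trans mm' (ltnW mk))) os os'.
  by move: mm'; rewrite em' ltnn.
(* [E] vanishes near T i because of its second factor and near T j because of its first, and no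
   potential changes elsewhere; so [E] is constant, yet true at [v0] and false at the pivot of
   [y]. *)
pose E v := ~~ F i f v && ~~ F j e v.
have [c cS cv0] := v0_vertex.
have := vertex_const (E := E) conn _ NE y.2 cS (pcS y).
rewrite cv0 -/(piv y) /E avx avy Fy => H; suff : true = false by []; apply: H => {c cS cv0} c l cS.
case: (boolP (touch (T i) c)) => [ti|ni].
  by rewrite !(far_touch (hT Pj) (hT Pi) ap2 (hF e Pj) _ xD Fx ti) !andbF.
case: (boolP (touch (T j) c)) => [tj|nj].
  by rewrite !(far_touch (hT Pi) (hT Pj) ap1 (hF f Pi) _ yD Fy tj).
have [h1 _] := hF f Pi; have [h2 _] := hF e Pj.
have n1 : onside (T i) f c l = false.
  by apply: contraNF ni; exact: (onside_touch (tri_sz (hT Pi)) (tri_corners (hT Pi)) cS).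
have n2 : onside (T j) e c l = false.
  by apply: contraNF nj; exact: (onside_touch (tri_sz (hT Pj)) (tri_corners (hT Pj)) cS).
have := h1 c l cS; have := h2 c l cS; rewrite n1 n2.
by do 4!case: (F _ _ _).
Qed.

Lemma exit_same_strand i x y k : P i -> x \in O -> y \in O ->
    exitd (T i) x.2 x -> exitd (T i) y.2 y ->
    x = iter k rho y -> (forall m, (m < k)%N -> ~~ bd (iter m rho y)) -> x = y.
Proof.
move=> Pi xO yO /and3P[_ xD xD'] /and3P[_ yD yD'] ek hk.
have := crossing Pi xO; rewrite xD xD' => /(_ isT) [cx _ ux].
have := crossing Pi yO; rewrite yD yD' => /(_ isT) [cy _ uy].
have [e1 e2 e3] := iter_str hk; rewrite -ek in e1 e2 e3; rewrite e1 in cx.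
have erf : rf (pc x) y.2 = rf (pc y) y.2 by rewrite /rf ux uy.
have ec : pc x = pc y.
  by apply: (cell_inj3 (d := y.2)); rewrite ?ux ?uy // cx erf cy.
move: e3; rewrite ec -[X in X = _]addr0 -[0]/(2 * 0%:Z) => /lpos_step_inj k0.
by rewrite ek -k0.
Qed.

(** Each beam accounts for at most one exit, so sending an exit to the bounce that ends its beam is
    injective. *)
Lemma avoiding_bound : (\sum_(i | P i) \sum_(y in O) (avoid i y.2 && exitd (T i) y.2 y) <= ell O)%N.
Proof.
rewrite pair_big /= (eq_bigr (fun p : I * dart =>
  if avoid p.1 p.2.2 && exitd (T p.1) p.2.2 p.2 then 1%N else 0%N)); last by move=> p _; case:
    (_ && _).
rewrite -big_mkcondr.
pose A := [pred p : I * dart | (P p.1 && (p.2 \in O)) && (avoid p.1 p.2.2 && exitd (T p.1) p.2.2 p.2)].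
rewrite (eq_bigl (mem A)) // sum1_card -(@card_in_imset _ _ (fun p : I * dart => fin p.2) A).
  apply: subset_leq_card; apply/subsetP => z /imsetP[[i y]]; rewrite !inE /=.
  by case/andP => /andP[_ yO] _ ->;
    rewrite fin_bd andbT -[X in X \in _]/(iter (len y) rho y) strand_O.
move=> [i x] [j y]; rewrite !inE /= =>
  /andP[/andP[Pi xO] /andP[ax ex_x]] /andP[/andP[Pj yO] /andP[ay ey]] e.
have [eij|nij] := eqVneq i j.
  subst j; congr (_, _); case/fin_eq: e => k [[ek hk]|[ek hk]].
    exact: exit_same_strand Pi xO yO ex_x ey ek hk.
  exact/esym/(exit_same_strand Pi yO xO ey ex_x ek hk).
exfalso; case/fin_eq: e => k [[ek hk]|[ek hk]].
  exact: no_two_avoiding Pi Pj nij xO yO ex_x ey ax ay ek hk.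
by rewrite eq_sym in nij; exact: no_two_avoiding Pj Pi nij yO xO ey ex_x ay ax ek hk.
Qed.

(** By [side_disjoint], [v0] is beyond at most one side of T i; the direction of that side avoids
    the two others. *)
Lemma avoid_count i : P i -> (0 < avoid i NE + avoid i W + avoid i SE)%N.
Proof.
move=> Pi; have [c cS cv0] := v0_vertex.
have D d d' : d <> d' -> ~~ (F i d v0 && F i d' v0).
  by move=> nd; rewrite -cv0; exact: (side_disjoint (tri_sz (hT Pi)) (@tri_fill _ _ (hT Pi))
     (tri_corners (hT Pi)) conn NE nd (hF d Pi) (hF d' Pi) cS).
have : ~~ (F i NE v0 && F i W v0) by apply: D.
have : ~~ (F i NE v0 && F i SE v0) by apply: D.
have : ~~ (F i W v0 && F i SE v0) by apply: D.
by rewrite /avoid /=; move: (F i NE v0) (F i W v0) (F i SE v0) => [] [] [].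
Qed.

(** In [avoiding_bound] each avoided direction of a triangle contributes [passes], by [passesE]. As
    [v0] is inside T i0, this triangle counts three times, every other one at least once. *)
Lemma passes_bound : (\sum_(i | P i) passes (T i) O + 2 * passes (T i0) O <= ell O)%N.
Proof.
apply: leq_trans avoiding_bound.
have e i : P i -> (\sum_(y in O) (avoid i y.2 && exitd (T i) y.2 y) =
   (avoid i NE + avoid i W + avoid i SE) * passes (T i) O)%N.
  move=> Pi; have pe d := passesE pot (hT Pi) (fun y => not_own Pi (y := y)) d.
  rewrite !mulnDl -{1}(pe NE) -{1}(pe W) -{1}(pe SE) !big_distrr /= -!big_split /=.
  apply: eq_bigr => y _; rewrite /exitd; case: (y.2) => /=; rewrite ?muln0 ?addn0 ?add0n;
    by case: (avoid _ _); rewrite ?mul1n.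
rewrite (eq_bigr _ e) (bigD1 i0) //= [X in (_ <= X)%N](bigD1 i0) //=.
have -> : (avoid i0 NE + avoid i0 W + avoid i0 SE = 3)%N.
  by rewrite /avoid /= !(fun d => (hF d Pi0).2 _ v0D).
rewrite addnAC; apply: leq_add; first by lia.
by apply: leq_sum => i /andP[Pi _]; rewrite leq_pmull // avoid_count.
Qed.
End Avoiding.

Lemma inD_line T c d : inD T (vx c d) -> co c d != ln T d ->
  gtu T.1 (ln T d) (co c d) /\ gtu T.1 (co c d) (- (ln T (tau d) + ln T (tau' d))).
Proof. by move: c d => [[a b] []] d; case: d; tri_cases T => h1 h2; split; lia. Qed.

Lemma line_mono c c' d : co c d = co c' d -> lpos c d <= lpos c' d ->
  co c (tau d) <= co c' (tau d) /\ co c' (tau' d) <= co c (tau' d).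
Proof.
case: c c' => [[a b] v] [[a' b'] v']; rewrite /lpos.
by case: d; case: v; case: v' => /= h1 h2; split; lia.
Qed.

Lemma sum_bool_gt0 (X : finType) (A : {set X}) (p : X -> bool) :
  (0 < \sum_(y in A) p y)%N -> exists2 y, y \in A & p y.
Proof.
rewrite lt0n sum_nat_eq0 negb_forall => /existsP[y]; rewrite negb_imply => /andP[yA].
by rewrite eqb0 negbK => h; exists y.
Qed.

Lemma gtu_trans u x y z : gtu u x y -> gtu u y z -> gtu u x z.
Proof. by rewrite /gtu; case: u => h1 h2; [exact: lt_trans h1 h2|exact: lt_trans h2 h1]. Qed.

(** * Orbits with four bounces *)

Section Quad.
Variables (S : {fset cell}) (T : tri).
Notation dart := (S * dir)%type.
Hypothesis pot : potentials S.
Hypothesis hT : triangle_in S T.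
Variable x0 : dart.
Let O := porbit rho x0.
Hypothesis hO : forall y, y \in O -> ~~ ((co (pc y) y.2 == ln T y.2) && touch T (pc y)).
Hypothesis pT : (0 < passes T O)%N.

Lemma exit_ex d : exists y, [/\ y \in O, y.2 = d, inD T (piv y),
  co (pc y) d != ln T d & ~~ inD T (piv (rho y))].
Proof.
have e := passesE pot hT hO d; have := pT; rewrite -e => /sum_bool_gt0[y yO /and3P[/eqP yd h1 h2]].
exists y; split=> //; have := hO yO; rewrite yd; case: (_ == _) => //= /negP[].
by apply/touchP; exists y.2.
Qed.

Lemma enter_ex d : exists y, [/\ y \in O, y.2 = d, ~~ inD T (piv y),
  co (pc y) d != ln T d & inD T (piv (rho y))].
Proof.
have e := passesE pot hT hO d; have := pT; rewrite -e (exit_enter hT).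
move=> /sum_bool_gt0[y yO /and3P[/eqP yd h1 h2]].
exists y; split=> //; have := hO yO; rewrite yd; case: (_ == _) => //= /negP[].
by apply/touchP; exists (rf (pc y) y.2); rewrite -piv_rho.
Qed.

(** In direction [d], exits cross one of the two sides other than [d] and entries cross the second
    one. *)
Lemma side_dart d d2 : d != d2 -> exists y, [/\ y \in O, y.2 = d & co (pc y) d2 = ln T d2].
Proof.
move=> dd2; have [y [yO yd y1 yl y2]] := exit_ex d; have [z [zO zd z1 zl z2]] := enter_ex d.
have [|cy _ uy] := cross_dart hO yO; first by rewrite y1 (negbTE y2).
have [|cz _ uz] := cross_dart hO zO; first by rewrite z2 (negbTE z1).
rewrite yd y1 (negbTE z1) zd in cy uy cz uz.
have : rf (pc y) d = d2 \/ rf (pc z) d = d2.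
  move: dd2; rewrite /rf uy uz; case: (T.1); case: (d); case: (d2) => //= _; by [left|right].
by case=> e; [exists y|exists z]; rewrite -?{1}e ?cy ?cz ?e //; split=> //; rewrite -e.
Qed.
End Quad.

Section Quad2.
Variables (S : {fset cell}) (T T' : tri).
Notation dart := (S * dir)%type.
Hypotheses (pot : potentials S).
Hypotheses (hT : triangle_in S T) (hT' : triangle_in S T') (eu : T.1 = T'.1).
Variable x0 : dart.
Let O := porbit rho x0.
Hypothesis hO : forall y, y \in O -> ~~ ((co (pc y) y.2 == ln T y.2) && touch T (pc y)).
Hypothesis hO' : forall y, y \in O -> ~~ ((co (pc y) y.2 == ln T' y.2) && touch T' (pc y)).
Hypotheses (pT : (0 < passes T O)%N) (pT' : (0 < passes T' O)%N).
Variable i : dir.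
Hypothesis sep : separated T T' i.

(** The exits from the two separated triangles in direction [i] lie on different lines, so [i] must
    be the direction of the two parallel beams, those ending at [b1] and [b3]. Both run strictly on
    the inner side of line [i] of T. The beam ending at [b0] joins these two lines, so it cannot
    meet line [i] of T, against [side_dart]. *)
Lemma no_two_in_quad b0 b1 b2 b3 :
    bd b0 -> bd b3 -> nextb b3 = b0 -> nextb b0 = b1 ->
    b1.2 = b3.2 -> b0.2 != b1.2 -> b2.2 != b1.2 -> b0.2 != b2.2 ->
    (forall y, y \in O -> bd y -> [\/ y = b0, y = b1, y = b2 | y = b3]) -> False.
Proof.
move=> h0 h3 n3 n0 e13 n01 n21 n02 all4.
have finO y : y \in O -> [\/ fin y = b0, fin y = b1, fin y = b2 | fin y = b3].
  move=> yO; apply: all4; last exact: fin_bd.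
  by move: yO; rewrite /O -!eq_porbit_mem => /eqP <-; rewrite eq_porbit_mem fin_porbit.
have [y [yO yd y1 yl _]] := exit_ex pot hT hO pT i.
have [y' [yO' yd' y1' yl' _]] := exit_ex pot hT' hO' pT' i.
rewrite /piv yd in y1; rewrite /piv yd' in y1'.
have [ly1 ly2] := inD_line y1 yl; have [ly1' _] := inD_line y1' yl'.
have [fy1 fy2 _] := finP y; have [fy1' fy2' _] := finP y'; rewrite yd yd' in fy1 fy2 fy1' fy2'.
have lt_lines : gtu T.1 (co (pc y) i) (co (pc y') i).
  by rewrite -eu in ly1'; exact: gtu_trans ly2 (gtu_trans sep ly1').
have neqc : co (pc y) i <> co (pc y') i by move=> e; move: lt_lines; rewrite e /gtu ltxx; case:
  (T.1).
have same : fin y = fin y' -> False by move=> e; apply: neqc; rewrite -fy2 -fy2' e.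
have [fi|[fi fi']] : i = b1.2 \/ (i = b0.2 \/ i = b2.2) /\ i <> b1.2.
  move: n01 n21 n02; case: (i); case: (b0.2); case: (b1.2); case: (b2.2) => //= _ _ _;
    first [by left|right; split=> //; by [left|right]].
- have [r1 r2 r3] := nextb_line h3; have [q1 q2 q3] := nextb_line h0.
  rewrite n3 in r1 r2 r3; rewrite n0 in q1 q2 q3.
  have lev b : b = b1 \/ b = b3 -> gtu T.1 (ln T i) (co (pc b) i).
    have hb : fin y = b \/ fin y' = b -> gtu T.1 (ln T i) (co (pc b) i).
      case=> <-; first by rewrite fy2.
      by rewrite fy2'; exact: gtu_trans ly1 lt_lines.
    move=> eb; apply: hb; case: (finO y yO) => e; case: (finO y' yO') => e';
      try (by exfalso; apply: same; rewrite e e'); move: fy1 fy1'; rewrite e e' fi => f1 f1';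
      try (by move: n01; rewrite f1 eqxx); try (by move: n01; rewrite f1' eqxx);
      try (by move: n21; rewrite f1 eqxx); try (by move: n21; rewrite f1' eqxx);
      case: eb => ->; first [by left|by right].
  have [z [zO zd zl]] := side_dart pot hT hO pT (d := b0.2) (d2 := i) ltac:(by rewrite fi).
  have [fz1 fz2 fz3] := finP z; rewrite zd in fz1 fz2 fz3.
  have ez : fin z = b0.
    case: (finO z zO) => // e; move: fz1; rewrite e => e'.
    + by move: n01; rewrite e' eqxx.
    + by move: n02; rewrite e' eqxx.
    + by move: n01; rewrite e13 e' eqxx.
  rewrite ez in fz2 fz3.
  have st := strand_start h3 (etrans ez (esym n3)); rewrite zd in st.
  have [m1 m2] := line_mono (etrans (esym r2) fz2) st.
  have [|m3 m4] := @line_mono (pc z) (pc b0) b0.2 (esym fz2); first by rewrite fz3 lerDl mulr_ge0.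
  have l0 : gtu T.1 (ln T i) (co (pc b0) i).
    by rewrite fi -q2 -fi; apply: lev; left.
  have l3 : gtu T.1 (ln T i) (co (pc b3) i) by apply: lev; right.
  have : i = tau b0.2 \/ i = tau' b0.2.
    by rewrite fi; move: n01; case: (b0.2); case: (b1.2) => //= _; by [left|right].
  move: zl l0 l3; rewrite /gtu; case: (T.1) => zl l0 l3 [] e; rewrite -e in m1 m2 m3 m4.
  + by move: (lt_le_trans l3 m1); rewrite zl ltxx.
  + by move: (lt_le_trans l0 m4); rewrite zl ltxx.
  + by move: (le_lt_trans m3 l0); rewrite zl ltxx.
  + by move: (le_lt_trans m2 l3); rewrite zl ltxx.
- apply: same; case: fi => fi.
    have H z : z \in O -> (fin z).2 = i -> fin z = b0.
      move=> zO; case: (finO z zO) => -> //; rewrite fi ?e13 => e; exfalso; move: n01 n02;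
        by rewrite ?e13 ?e eqxx.
    exact: etrans (H y yO fy1) (esym (H y' yO' fy1')).
  have H z : z \in O -> (fin z).2 = i -> fin z = b2.
    move=> zO; case: (finO z zO) => -> //; rewrite fi ?e13 => e; exfalso; move: n21 n02;
      by rewrite ?e13 ?e eqxx.
  exact: etrans (H y yO fy1) (esym (H y' yO' fy1')).
Qed.

Lemma no_two_in_ell4 b : bd b -> b \in O -> ell O = 4%N -> False.
Proof.
move=> hb; rewrite /O -eq_porbit_mem => /eqP eO; rewrite -eO => e4.
have := iter_ell hb; rewrite e4.
have all4 y : y \in O -> bd y -> [\/ y = b, y = nextb b, y = nextb (nextb b) |
    y = nextb (nextb (nextb b))].
  rewrite /O -eO => yO hy; have [r] := bd_orbit hb yO hy; rewrite e4.
  by case: r => [|[|[|[|//]]]] _ ->;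
     [constructor 1|constructor 2|constructor 3|constructor 4].
have [b1 E1] : exists b1, b1 = nextb b by eexists.
have [b2 E2] : exists b2, b2 = nextb b1 by eexists.
have [b3 E3] : exists b3, b3 = nextb b2 by eexists.
rewrite -E1 -E2 -E3 in all4; rewrite /= -E1 -E2 -E3 => E0.
have h1 : bd b1 by rewrite E1 nextb_bd.
have h2 : bd b2 by rewrite E2 nextb_bd.
have h3 : bd b3 by rewrite E3 nextb_bd.
have [n0 _ _] := nextb_line hb; have [n1 _ _] := nextb_line h1; have [n2 _ _] := nextb_line h2.
have [n3 _ _] := nextb_line h3.
rewrite -E1 -E2 -E3 E0 in n0 n1 n2 n3.
have dirs d : [|| d == b.2, d == b1.2, d == b2.2 | d == b3.2].
  have [y [yO yd _ _ _]] := exit_ex pot hT hO pT d; have [fy _ _] := finP y.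
  have fO : fin y \in O by move: yO; rewrite /O -!eq_porbit_mem => /eqP <-;
    rewrite eq_porbit_mem fin_porbit.
  by rewrite -yd -fy; case: (all4 _ fO (fin_bd y)) => ->; rewrite eqxx ?orbT.
have d01 : b.2 != b1.2 by rewrite n0 eq_sym rf_neq.
have d12 : b1.2 != b2.2 by rewrite n1 eq_sym rf_neq.
have d23 : b2.2 != b3.2 by rewrite n2 eq_sym rf_neq.
have d30 : b3.2 != b.2 by rewrite n3 eq_sym rf_neq.
(* Cyclically consecutive directions differ and all three occur, so exactly one pair of opposite
   beams is parallel. *)
have [[e13 e02]|[e02 e13]] : b1.2 = b3.2 /\ b.2 != b2.2 \/ b.2 = b2.2 /\ b1.2 != b3.2.
  move: d01 d12 d23 d30 (dirs NE) (dirs W) (dirs SE).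
  by case: (b.2); case: (b1.2); case: (b2.2); case: (b3.2) => //= _ _ _ _ _ _ _; by [left|right].
- apply: (no_two_in_quad (b0 := b) (b1 := b1) (b2 := b2) (b3 := b3)) => //.
  by rewrite eq_sym.
- apply: (no_two_in_quad (b0 := b1) (b1 := b2) (b2 := b3) (b3 := b)) => //.
  + by rewrite eq_sym.
  + move=> y yO /(all4 y yO)[] ->; [constructor 4|constructor 1|constructor 2|constructor 3]; by [].
Qed.
End Quad2.

(** * Small triangles *)

Lemma dart_eq (S : {fset cell}) (x y : S * dir) : pc x = pc y -> x.2 = y.2 -> x = y.
Proof. by case: x y => [? ?] [? ?]; rewrite /pc /= => /val_inj -> ->. Qed.

Section Touching.
Variables (S : {fset cell}) (T : tri).
Notation dart := (S * dir)%type.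
Implicit Types x y : dart.

Lemma piv_pred y : piv (rho^-1%g y) = vx (pc y) (ex (pc y) y.2).
Proof.
have [z ->] : exists z, y = rho z by exists (rho^-1%g y); rewrite permKV.
rewrite permK /piv; case: (boolP (bd z)) => [h|/rho_str[-> ->]].
  by rewrite (rho_bd h) /= /pc /= /ex /rf -/(pc z); case: (pc z) => [[a b] []]; case: (z.2).
rewrite /nxt /ex nb_up; move: (pc z) (z.2) => c d.
by case: c => [[a b] []]; case: d; rewrite /= ?subrK ?addrK.
Qed.

Lemma rho_back y : nb (pc y) (rf (pc y) y.2) \in S ->
  exists z, [/\ rho z = y, pc z = nb (pc y) (rf (pc y) y.2) & z.2 = y.2].
Proof.
move=> h; pose z : dart := ([` h], y.2); suff : rho z = y by exists z; split.
have e : nxt z = pc y.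
  rewrite /nxt /pc /= -/(pc y) /rf /ex; move: (pc y) (y.2) => c d.
  by case: c => [[a b] []]; case: d; rewrite /= ?subrK ?addrK.
have /rho_str[] : ~~ bd z by rewrite /bd e negbK; exact: pcS.
by rewrite e => h1 h2; exact: dart_eq.
Qed.

Hypotheses (hT : triangle_in S T) (pot : potentials S).
Variable x0 : dart.
Let O := porbit rho x0.
Hypothesis hO : forall y, y \in O -> ~~ ((co (pc y) y.2 == ln T y.2) && touch T (pc y)).

Lemma rho_O y : y \in O -> rho y \in O.
Proof. by rewrite /O -!eq_porbit_mem (porbit_perm rho 1). Qed.

Lemma rhoV_O y : y \in O -> rho^-1%g y \in O.
Proof. by rewrite -{1}[y](permKV rho) /O -!eq_porbit_mem (porbit_perm rho 1). Qed.

(** An orbit that never left T would keep its pivots inside, but at a bounce the pivot is not an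
    interior vertex. *)
Lemma piv_passes y : y \in O -> inD T (piv y) -> (0 < passes T O)%N.
Proof.
move=> yO yD; rewrite lt0n; apply/eqP => p0.
have stay z : z \in O -> inD T (piv z) -> inD T (piv (rho z)).
  move=> zO zD; apply/negPn/negP => n; have := passesE pot hT hO z.2; rewrite p0 => /eqP.
  by rewrite sum_nat_eq0 => /forallP/(_ z); rewrite zO /exitd eqxx zD n.
have all k : iter k rho y \in O /\ inD T (piv (iter k rho y)).
  by elim: k => // k [h1 h2]; split; [exact: rho_O|exact: stay].
have [k hk] := bd_ex y; have [_] := all k.
by apply/negP; apply: contra (proj1 (niv_piv hk)); exact: tri_fill.
Qed.

(** The three vertices of the cell of [y] are the pivots of [y], of its successor and of its
    predecessor. *)
Lemma touch_passes y : y \in O -> touch T (pc y) -> (0 < passes T O)%N.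
Proof.
move=> yO /touchP[i hi]; have : [\/ i = y.2, i = rf (pc y) y.2 | i = ex (pc y) y.2].
  rewrite /rf /ex; case: (pc y).2; case: (y.2); case: i {hi};
    first [by constructor 1|by constructor 2|by constructor 3].
case=> e; rewrite e in hi.
- exact: piv_passes yO hi.
- by apply: (piv_passes (rho_O yO)); rewrite piv_rho.
- by apply: (piv_passes (rhoV_O yO)); rewrite piv_pred.
Qed.
End Touching.

Section FewOrbits.
Variables (S : {fset cell}) (T : tri).
Notation dart := (S * dir)%type.
Hypotheses (hT : triangle_in S T) (small : sz T <= 5).
Variable t : dart.
Let OT := porbit rho t.
Hypotheses (dT : side_darts T OT).

Lemma exit_small c : sz T <= 5 -> inD T (vx c NE) -> co c NE != ln T NE ->
  co c NE = ln T NE + (if T.1 then 2 else -2) \/ co c NE = ln T NE + (if T.1 then 4 else -4).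
Proof. by case: c => [[a b] []]; tri_cases T; lia. Qed.

(** Only two lines of direction [NE] run strictly inside T, and each carries at most one exit,
    because the orientation and the side crossed determine the cell. So at most two orbits besides
    [OT] leave T. *)
Lemma orbits_le3 : (forall x, porbit rho x != OT -> (0 < passes T (porbit rho x))%N) ->
  (#|porbits (@rho S)| <= 3)%N.
Proof.
move=> allp; pose E := [set y : dart | exitd T NE y && (y \notin OT)].
have cr y : y \in E -> [/\ co (pc y) (rf (pc y) y.2) = ln T (rf (pc y) y.2),
    (pc y).2 = ~~ T.1, y.2 = NE, inD T (vx (pc y) NE) & co (pc y) NE != ln T NE].
  rewrite inE => /andP[/and3P[/eqP e h1 h2] h3].
  have ty : touch T (pc y) by apply/touchP; exists y.2.
  have nl : co (pc y) y.2 != ln T y.2 by move: h3; rewrite dT ty andbT.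
  have [|h4 _ h5] := @cross_geo T (pc y) y.2 _ nl.
    by rewrite -piv_rho -/(piv y) h1 (negbTE h2).
  by split=> //; [rewrite h5 -/(piv y) h1|rewrite -e|rewrite -e].
have E2 : (#|E| <= 2)%N.
  rewrite -[2%N]card_bool; apply: (@leq_card_in _ _ (fun y : dart =>
    co (pc y) NE == ln T NE + (if T.1 then 2 else -2))).
  move=> x y xE yE; have [x1 x2 x3 x4 x5] := cr x xE; have [y1 y2 y3 y4 y5] := cr y yE.
  move=> exy; have ec : co (pc x) NE = co (pc y) NE.
    have := exit_small small x4 x5; have := exit_small small y4 y5; move: exy.
    by case: eqP => [-> /esym/eqP -> //|n] /esym/eqP n' [|e1] // [|e2] //; rewrite e1 e2.
  have ep : pc x = pc y.
    apply: (cell_inj3 (d := NE)); rewrite ?x2 ?y2 //.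
    by move: x1 y1; rewrite x3 y3 /rf x2 y2 => -> ->.
  by apply: dart_eq; rewrite ?x3.
have sub : porbits (@rho S) \subset OT |: [set porbit rho y | y in E].
  apply/subsetP => X /imsetP[x _ ->]; rewrite in_setU1; case: eqP => //= /eqP nx.
  have /sum_bool_gt0[y yO ye] := allp x nx.
  move: yO; rewrite -eq_porbit_mem => /eqP exy; rewrite -exy; apply: imset_f.
  by rewrite inE ye /=; apply: contra nx; rewrite /OT -eq_porbit_mem exy.
apply: leq_trans (subset_leq_card sub) _; rewrite cardsU1; apply: (@leq_add _ _ 1 2).
  by case: (_ \notin _).
exact: leq_trans (leq_imset_card _ _) E2.
Qed.
End FewOrbits.

(* For sz T = 5: the middle one of the three vertices just outside side j, and the two
   vertices beyond it. *)
Definition outer (T : tri) (j : dir) : vec :=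
  let: (u, (a, b, _)) := T in
  if u then match j with NE => (a, b + 2) | W => (a + 2, b) | SE => (a + 2, b + 2) end
  else match j with NE => (a + 1, b - 1) | W => (a - 1, b + 1) | SE => (a - 1, b - 1) end.
Definition bump1 (T : tri) (j : dir) : vec :=
  let: (u, (a, b, _)) := T in
  if u then match j with NE => (a - 1, b + 2) | W => (a + 3, b - 1) | SE => (a + 2, b + 3) end
  else match j with NE => (a + 2, b - 1) | W => (a - 2, b + 2) | SE => (a - 1, b - 2) end.
Definition bump2 (T : tri) (j : dir) : vec :=
  let: (u, (a, b, _)) := T in
  if u then match j with NE => (a - 1, b + 3) | W => (a + 2, b - 1) | SE => (a + 3, b + 2) end
  else match j with NE => (a + 2, b - 2) | W => (a - 1, b + 2) | SE => (a - 2, b - 1) end.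

(** Componentwise equality, in a form that [lia] can use. *)
Definition veq (v w : vec) : bool := (v.1 == w.1) && (v.2 == w.2).
Lemma veqP v w : reflect (v = w) (veq v w).
Proof. by case: v w => [a b] [c d]; rewrite /veq /= -xpair_eqE; exact: eqP. Qed.

(** The row of vertices just outside side [j]: two for size 3, three for size 5. Its extreme
    vertices are ends of the boundary panes at corners, so only the middle one can be interior. *)
Definition beyond T j v : bool :=
  [&& cv v j == ln T j + (if T.1 then -1 else 1), gtu T.1 (ln T (tau j)) (cv v (tau j))
    & gtu T.1 (ln T (tau' j)) (cv v (tau' j))].

Lemma leave T c i k : 3 <= sz T -> inD T (vx c i) -> ~~ inD T (vx c k) ->
  [|| beyond T NE (vx c k), beyond T W (vx c k) | beyond T SE (vx c k)].
Proof.
by move: c i k => [[a b] []] i k; case: i; case: k; rewrite /beyond; tri_cases T => hs h1 h2; lia.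
Qed.

(** Sizes are odd, so the bounds amount to size 3; below, bounds 5 and 6 amount to size 5. *)
Lemma beyond3 T j v : 3 <= sz T <= 4 -> beyond T j v ->
  veq v (vx (corner_cell T (tau j)) j) || veq v (vx (corner_cell T (tau' j)) j).
Proof. by case: v => x y; case: j; rewrite /beyond /veq; tri_cases T; lia. Qed.

Lemma beyond5 T j v : 5 <= sz T <= 6 -> beyond T j v ->
  [|| veq v (vx (corner_cell T (tau j)) j),
    veq v (vx (corner_cell T (tau' j)) j) | veq v (outer T j)].
Proof. by case: v => x y; case: j; rewrite /beyond /veq; tri_cases T; lia. Qed.

Lemma sz5 T : 5 <= sz T <= 6 -> T = (T.1, (T.2.1.1, T.2.1.2,
  if T.1 then - T.2.1.1 - T.2.1.2 - 4 else 1 - T.2.1.1 - T.2.1.2)).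
Proof. by case: T => [[] [[a b] s]]; rewrite /sz /ln /= => h; congr (_, (_, _)); lia. Qed.

Lemma leave_bump T v k j l : 5 <= sz T <= 6 -> let c := cellat (outer T j) v k in
  ~~ touch T c -> l != k ->
  [|| veq (vx c l) (vx (corner_cell T (tau j)) j), veq (vx c l) (vx (corner_cell T (tau' j)) j),
      veq (vx c l) (bump1 T j) | veq (vx c l) (bump2 T j)].
Proof.
move/sz5 ->; case: T.1; move: (T.2.1.1) (T.2.1.2) => a b; rewrite /touch /inD /gtu /ln /veq;
  case: v; case: k; case: j; case: l => //=; lia.
Qed.

(** Pane [j] is the entrance or the exit of any dart whose direction is not [j]; this is how
    [bump_passes] brings an orbit near the outer vertex to the triangle in at most two steps. *)
Lemma bump_step T v k j : 5 <= sz T <= 6 -> let c := cellat (outer T j) v k in ~~ touch T c ->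
  touch T (nb c j) || [&& k == j, touch T (nb (nb c (tau j)) j) & touch T (nb (nb c (tau' j)) j)].
Proof.
move/sz5 ->; case: T.1; move: (T.2.1.1) (T.2.1.2) => a b; rewrite /touch /inD /gtu /ln /veq;
  case: v; case: k; case: j => //=; lia.
Qed.

(** Each line of U lies strictly between a side of T and the opposite corner, which leaves two
    values, hence finitely many U. As the ends of the corner pane of U are not interior, this yields
    the hypothesis [bumps] below. *)
Lemma opposite_corner T U j : 5 <= sz T <= 6 -> U.1 = ~~ T.1 ->
    (forall d, gtu T.1 (ln T d) (ln U d) /\
               gtu T.1 (ln U d) (- (ln T (tau d) + ln T (tau' d)))) ->
  let p := vx (corner_cell U j) (tau j) in let q := vx (corner_cell U j) (tau' j) in
  [|| inD T p, inD T q, veq p (outer T j), veq q (outer T j) |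
      (veq p (bump1 T j) && veq q (bump2 T j)) || (veq q (bump1 T j) && veq p (bump2 T j))].
Proof.
move=> hs hU h; have := h NE; have := h W; have := h SE; move: hs hU {h} => /sz5 ->.
case: U => [v [[x y] z]] /= ->; case: T.1; move: (T.2.1.1) (T.2.1.2) => a b;
  rewrite /inD /gtu /ln /veq /= => -[h1 h2] [h3 h4] [h5 h6].
- have ex : x = a + 1 \/ x = a + 2 by lia.
  have ey : y = b + 1 \/ y = b + 2 by lia.
  have ez : z = - a - b - 3 \/ z = - a - b - 2 by lia.
  by clear h1 h2 h3 h4 h5 h6; case: ex => ->; case: ey => ->; case: ez => ->; case: j => /=; lia.
- have ex : x = a - 1 \/ x = a - 2 by lia.
  have ey : y = b - 1 \/ y = b - 2 by lia.
  have ez : z = - a - b \/ z = - a - b - 1 by lia.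
  by clear h1 h2 h3 h4 h5 h6; case: ex => ->; case: ey => ->; case: ez => ->; case: j => /=; lia.
Qed.

Lemma tauK j : tau' (tau j) = j. Proof. by case: j. Qed.
Lemma tau'K j : tau (tau' j) = j. Proof. by case: j. Qed.

Lemma sz_le5 T : sz T <= 6 -> sz T <= 5.
Proof. by tri_cases T; lia. Qed.

Definition chordless (S : {fset cell}) : Prop := forall c i, c \in S -> nb c i \in S ->
  iv S (vx c (tau i)) || iv S (vx c (tau' i)).

Lemma corner_niv (S : {fset cell}) T k : triangle_in S T ->
  ~~ iv S (vx (corner_cell T k) (tau k)) /\ ~~ iv S (vx (corner_cell T k) (tau' k)).
Proof.
by move=> hT; have [e1 e2 e3] := corner_cellE T k; have [_] := tri_corners hT e1 e2 e3; exact: nivP.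
Qed.

Lemma touch_nb T c i : touch T c -> ~~ touch T (nb c i) ->
  [/\ inD T (vx c i), ~~ inD T (vx c (tau i)) & ~~ inD T (vx c (tau' i))].
Proof.
case/touchP => k hk n.
have n1 : ~~ inD T (vx c (tau i)) by apply: contra n => h; apply/touchP; exists (tau' i);
  rewrite vx_nb2.
have n2 : ~~ inD T (vx c (tau' i)) by apply: contra n => h; apply/touchP; exists (tau i);
  rewrite vx_nb1.
by split=> //; case: (dir_tauP k i) hk n1 n2 => -> // ->.
Qed.

Section Small.
Variables (S : {fset cell}) (T : tri).
Notation dart := (S * dir)%type.
Hypotheses (conn : connected_cells S) (pot : potentials S) (cf : chordless S).
Hypotheses (hT : triangle_in S T).

Lemma beyond_niv j v : sz T <= 6 -> beyond T j v -> iv S v -> 5 <= sz T /\ v = outer T j.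
Proof.
move=> h6 hb hv; have s3 := tri_sz hT.
have n1 : v <> vx (corner_cell T (tau j)) j.
  by move=> e; have [_ /negP n] := corner_niv (tau j) hT; apply: n; rewrite tauK -e.
have n2 : v <> vx (corner_cell T (tau' j)) j.
  by move=> e; have [/negP n _] := corner_niv (tau' j) hT; apply: n; rewrite tau'K -e.
case: (lerP 5 (sz T)) => h5; last first.
  have h4 : 3 <= sz T <= 4 by rewrite s3; lia.
  by case/orP: (beyond3 h4 hb) => /veqP.
have h56 : 5 <= sz T <= 6 by rewrite h5.
by case/or3P: (beyond5 h56 hb) => /veqP.
Qed.

(** The pane crossed has both ends outside T, and one of them is interior as there are no chords.
    Only the middle vertex of the row beyond a side qualifies. *)
Lemma leave_outer c i : sz T <= 6 -> c \in S -> touch T c -> nb c i \in S -> ~~ touch T (nb c i) ->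
  5 <= sz T /\ exists j k, vx (nb c i) k = outer T j /\ iv S (outer T j).
Proof.
move=> h6 cS tc nS nt; have [h1 h2 h3] := touch_nb tc nt; have s3 := tri_sz hT.
have H k l : ~~ inD T (vx c k) -> iv S (vx c k) -> vx (nb c i) l = vx c k ->
    5 <= sz T /\ exists j k, vx (nb c i) k = outer T j /\ iv S (outer T j).
  move=> nk ik el; case/or3P: (leave s3 h1 nk) => hb; have [h5 e] := beyond_niv h6 hb ik;
    split=> //; [exists NE|exists W|exists SE]; exists l; by rewrite el -e.
case/orP: (cf cS nS) => hv.
  exact: (H (tau i) (tau' i) h2 hv (vx_nb2 c i)).
exact: (H (tau' i) (tau i) h3 hv (vx_nb1 c i)).
Qed.

Variable t : dart.
Let OT := porbit rho t.
Hypotheses (dT : side_darts T OT).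

Lemma touch_ex : exists2 c, c \in S & touch T c.
Proof.
have [v hv] := inD_ex (tri_sz hT); exists (cellat v true NE).
  by have /ivP h := tri_fill hT hv; apply: (h _ NE); rewrite vx_cellat.
by apply/touchP; exists NE; rewrite vx_cellat.
Qed.

Lemma own_not x0 y : porbit rho x0 != OT -> y \in porbit rho x0 ->
  ~~ ((co (pc y) y.2 == ln T y.2) && touch T (pc y)).
Proof.
move=> n yO; rewrite -dT; apply: contra n; move: yO; rewrite /OT -!eq_porbit_mem.
by move=> /eqP <-.
Qed.

(** For size 3 no interior pane leads away from T, so every cell of the connected set S touches T
    and every orbit meets it. *)
Lemma small3 : sz T <= 4 -> (#|porbits (@rho S)| <= 3)%N.
Proof.
move=> h4; have h6 : sz T <= 6 by apply: le_trans h4 _.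
apply: (orbits_le3 _ dT); first by apply: le_trans h4 _.
have all_t c : c \in S -> touch T c.
  apply: conn; first exact: touch_ex.
  move=> {}c i cS tc nS; apply/negPn/negP => nt; have [h5] := leave_outer h6 cS tc nS nt.
  by move: (le_trans h5 h4).
move=> x0 n; apply: (@touch_passes S T hT pot x0 _ x0); first by move=> y; exact: own_not.
  exact: porbit_id.
by apply: all_t; exact: pcS.
Qed.

Section Five.
Hypothesis h5 : 5 <= sz T <= 6.
Hypothesis bumps : forall j, iv S (outer T j) -> ~~ iv S (bump1 T j) /\ ~~ iv S (bump2 T j).

(** The cells touching T or having an interior outer vertex are closed under passing to neighbours:
    to leave the star of an outer vertex, one crosses a pane whose ends are corner ends or bumps,
    none of them interior, and this pane would be a chord. *)
Lemma bump_cover c : c \in S -> ~~ touch T c ->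
  exists j k, vx c k = outer T j /\ iv S (outer T j).
Proof.
have [_ h6] := andP h5.
pose A c := touch T c || [exists p : dir * dir,
  (veq (vx c p.2) (outer T p.1)) && iv S (outer T p.1)].
have AP z : reflect (touch T z \/ exists j k, vx z k = outer T j /\ iv S (outer T j)) (A z).
  apply: (iffP orP) => -[h|]; try by left.
    by case/existsP => -[j k] /= /andP[/veqP e iv']; right; exists j, k.
  by case=> j [k [e iv']]; right; apply/existsP; exists (j, k); rewrite /= iv' andbT; apply/veqP.
suff H : forall c, c \in S -> A c by move=> cS nt; case: (AP c (H c cS)) => // h; rewrite h in nt.
apply: conn; first by have [z zS tz] := touch_ex; exists z => //; apply/AP; left.
move=> {}c i cS /AP[tc|[j [k [e ivj]]]] nS; apply/AP.
  case: (boolP (touch T (nb c i))) => nt; first by left.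
  by right; have [_] := leave_outer h6 cS tc nS nt.
case: (boolP (touch T c)) => nt.
  case: (boolP (touch T (nb c i))) => nt'; first by left.
  by right; have [_] := leave_outer h6 cS nt nS nt'.
right; case: (dir_tauP k i) => ek; last 2 first.
- by exists j, (tau' i); rewrite vx_nb2 -ek.
- by exists j, (tau i); rewrite vx_nb1 -ek.
have ec : c = cellat (outer T j) c.2 k by rewrite -e cellatE.
have [nb1 nb2] := bumps ivj; rewrite ec in nt.
have niv l : l != k -> ~~ iv S (vx c l).
  move=> lk; have := leave_bump h5 nt lk; rewrite -ec => /or4P[] /veqP -> //.
    by have [_] := corner_niv (tau j) hT; rewrite tauK.
  by have [+ _] := corner_niv (tau' j) hT; rewrite tau'K.
have n1 : tau i != k by rewrite ek; case: (i).
have n2 : tau' i != k by rewrite ek; case: (i).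
by case/orP: (cf cS nS) => hv; [move: (niv _ n1)|move: (niv _ n2)]; rewrite hv.
Qed.

Lemma bump_passes x0 : porbit rho x0 != OT -> (0 < passes T (porbit rho x0))%N.
Proof.
move=> n; have own y := @own_not x0 y n.
have tp y := @touch_passes S T hT pot x0 own y.
have A1 y j : y \in porbit rho x0 -> y.2 != j -> touch T (nb (pc y) j) ->
    (0 < passes T (porbit rho x0))%N.
  move=> yO dj tn; have nS : nb (pc y) j \in S by exact: (touch_in (@tri_fill _ _ hT) tn).
  have [ej|ej] : ex (pc y) y.2 = j \/ rf (pc y) y.2 = j.
    by move: dj; rewrite /ex /rf; case: (pc y).2; case: (y.2); case: (j) => //= _;
      [right|left|left|right|right|left|left|right|right|left|left|right].
  - apply: (tp (rho y)); first exact: rho_O.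
    by have [|-> _] := @rho_str S y; rewrite /bd /nxt ej ?nS.
  - have [|z [e pz _]] := @rho_back S y; first by rewrite ej.
    by apply: (tp z); [move: yO; rewrite -e -!eq_porbit_mem (porbit_perm rho 1)|rewrite pz ej].
have A2 y j k : y \in porbit rho x0 -> y.2 != j -> vx (pc y) k = outer T j -> iv S (outer T j) ->
    (0 < passes T (porbit rho x0))%N.
  move=> yO dj e ivj; case: (boolP (touch T (pc y))) => nt; first exact: tp nt.
  have ec : pc y = cellat (outer T j) (pc y).2 k by rewrite -e cellatE.
  have := nt; rewrite {1}ec => nt'; have := bump_step h5 nt'; rewrite -ec =>
    /orP[|/and3P[/eqP ek t1 t2]].
    exact: A1 yO dj.
  have tt f : f != j -> touch T (nb (nb (pc y) f) j).
    by case: (dir_tauP f j) => -> // /eqP.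
  have inS f : f != j -> nb (pc y) f \in S.
    move=> fj; move/ivP: ivj => H; rewrite -e ek in H.
    case: (dir_tauP j f) => ej; first by rewrite ej eqxx in fj.
      by apply: (H _ (tau' f)); rewrite vx_nb2 ej.
    by apply: (H _ (tau f)); rewrite vx_nb1 ej.
  have [fj|fj] : ex (pc y) y.2 != j \/ rf (pc y) y.2 != j.
    by rewrite /ex /rf; case: (pc y).2; case: (y.2); case: (j); by [left|right].
  - have [|p1 p2] := @rho_str S y; first by rewrite /bd negbK /nxt inS.
    by apply: (A1 (rho y) j); [exact: rho_O|rewrite p2|rewrite p1 /nxt tt].
  - have [|z [ez pz dz]] := @rho_back S y; first exact: inS.
    by apply: (A1 z j); [move: yO;
      rewrite -ez -!eq_porbit_mem (porbit_perm rho 1)|rewrite dz|rewrite pz tt].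
(* A bounce offers two darts with different directions in one cell, so one of them has a direction
   other than [j]. *)
have [m hm] := bd_ex x0; set y := iter m rho x0 in hm; have yO : y \in porbit rho x0 by exact:
  mem_iter_rho.
case: (boolP (touch T (pc y))) => nt; first exact: tp nt.
have [j [k [e ivj]]] := bump_cover (pcS y) nt.
have [dj|dj] := boolP (y.2 == j); last exact: A2 yO dj e ivj.
apply: (A2 (rho y) j k) => //; first exact: rho_O.
  by rewrite (rho_bd hm) -(eqP dj) rf_neq.
by rewrite (rho_bd hm).
Qed.

Lemma small5 : (#|porbits (@rho S)| <= 3)%N.
Proof.
apply: (orbits_le3 _ dT); last exact: bump_passes.
by have [_ /sz_le5] := andP h5.
Qed.
End Five.
End Small.

(** * Counting exits *)

(** The cell where the [k]-th line of direction [NE] inside T, counted from side [NE], leaves T. *)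
Definition exit_cell (T : tri) (k : int) : cell :=
  let: (u, (a, b, s)) := T in
  if u then ((a + k, - s - 2 - (a + k)), false) else ((a - k, b), true).

Lemma exit_cellE T k : 1 <= k -> 2 * k + 1 <= sz T -> let c := exit_cell T k in
  [/\ inD T (vx c NE), ~~ inD T (vx c (rf c NE)), co c NE != ln T NE
    & co c NE = ln T NE + (if T.1 then 2 * k else - (2 * k))].
Proof.
move=> k1; tri_cases T => hs; split; lia.
Qed.

Section Count.
Variables (S : {fset cell}).
Notation dart := (S * dir)%type.
Notation rhoS := (@rho S).
Implicit Types (O U : {set dart}).
Hypotheses (conn : connected_cells S) (pot : potentials S).

(** The [m] lines of direction [NE] strictly inside T leave it in different cells, and their darts
    are not on the sides, so not in [O]. *)
Lemma exit_many T O m : triangle_in S T -> side_darts T O -> 2 * m%:Z + 1 <= sz T ->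
  (m <= #|[set y : dart | exitd T NE y & y \notin O]|)%N.
Proof.
move=> hT dT hm.
have ex1 (k : 'I_m) : exists y : dart, [/\ y.2 = NE, pc y = exit_cell T (k.+1)%:Z &
    y \in [set y : dart | exitd T NE y & y \notin O]].
  have [||h1 h2 h3 _] := @exit_cellE T k.+1%:Z.
  - by [].
  - by apply: le_trans hm; rewrite lerD2r ler_pM2l // lez_nat.
  have cS : exit_cell T k.+1%:Z \in S by move/(tri_fill hT)/ivP: h1; apply.
  exists ([` cS], NE); split=> //; rewrite inE /exitd eqxx piv_rho /piv /pc /= h1 h2 /=.
  by rewrite dT /pc /= (negbTE h3).
have [f hf] := fin_all_exists ex1.
have fi : injective f.
  move=> k l e; have [_ ek _] := hf k; have [_ el _] := hf l; apply: val_inj.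
  have := ek; rewrite e el; case: (k) (l) => [x xm] [y ym] /=.
  by clear; case: T => [[] [[a b] s]] /= [] h; move: h; lia.
rewrite -[m in (m <= _)%N]card_ord -(card_imset _ fi); apply: subset_leq_card.
by apply/subsetP => y /imsetP[k _ ->]; have [] := hf k.
Qed.

Lemma sum_porbits (P : pred {set dart}) (f : dart -> nat) :
  (\sum_(O in porbits rhoS | P O) \sum_(y in O) f y = \sum_(y | P (porbit rhoS y)) f y)%N.
Proof.
rewrite [RHS](partition_big (porbit rhoS) (fun O => (O \in porbits rhoS) && P O)) /=.
  apply: eq_bigr => O /andP[/imsetP[x _ ->] Px]; apply: eq_bigl => y.
  by rewrite -eq_porbit_mem; case: eqP => [->|]; rewrite ?andbF ?andbT ?Px.
by move=> y Py; rewrite Py andbT imset_f.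
Qed.

Lemma mem_porbits O x : O \in porbits rhoS -> (porbit rhoS x == O) = (x \in O).
Proof. by case/imsetP => y _ ->; rewrite eq_porbit_mem. Qed.

Lemma passes_out T O : O \in porbits rhoS ->
  (\sum_(O' in porbits rhoS | O' != O) passes T O' = #|[set y :
    dart | exitd T NE y & y \notin O]|)%N.
Proof.
move=> hO; rewrite (sum_porbits (fun O' => O' != O) (fun y => exitd T NE y : nat)).
rewrite -sum1dep_card [RHS]big_mkcondr [LHS]big_mkcond [RHS]big_mkcond /=.
by apply: eq_bigr => y _; rewrite mem_porbits //; do 2!case: ifP => //; case: (exitd _ _ _).
Qed.

Lemma sum_ell : (\sum_(O in porbits rhoS) ell O = #|[set x : dart | bd x]|)%N.
Proof.
have e O : ell O = (\sum_(y in O) bd y)%N.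
  by rewrite /ell -sum1dep_card big_mkcondr; apply: eq_bigr => y _; case: (bd y).
rewrite (eq_bigr _ (fun O _ => e O)) (eq_bigl (fun O => (O \in porbits rhoS) && true)); last first.
  by move=> O; rewrite andbT.
rewrite sum_porbits -sum1dep_card [RHS]big_mkcond /=.
by apply: eq_bigr => y _; case: (bd y).
Qed.

Lemma orbit_bd O : O \in porbits rhoS -> exists2 b, bd b & O = porbit rho b.
Proof.
case/imsetP => x _ ->; exists (fin x); first exact: fin_bd.
by apply/eqP; rewrite eq_porbit_mem porbit_sym fin_porbit.
Qed.

Lemma ell_porbits O : O \in porbits rhoS -> (2 < ell O)%N.
Proof. by case/orbit_bd => b hb ->; exact: ell_ge3. Qed.

Lemma porbits_disjoint O O' x : O \in porbits rhoS -> O' \in porbits rhoS -> O != O' ->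
  x \in O -> x \notin O'.
Proof. by move=> hO hO' n; rewrite -!mem_porbits // => /eqP ->. Qed.

Lemma single_cell c : c \in S -> (forall i, nb c i \notin S) -> (#|porbits rhoS| <= 3)%N.
Proof.
move=> cS h; have all1 z : z \in S -> z = c.
  move=> zS; apply/eqP; apply: (conn (A := fun z => z == c)) => //; first by exists c.
  by move=> z' i _ /eqP -> n; move: (h i); rewrite n.
apply: leq_trans (leq_imset_card _ _) _.
pose D : {set dir} := [set: dir]; have sub : setT \subset [set (([` cS], d) : dart) | d in D].
  apply/subsetP => -[z d] _; apply/imsetP; exists d; rewrite ?inE //; congr (_, _).
  by apply: val_inj => /=; apply: all1; exact: valP.
rewrite -cardsT; apply: leq_trans (subset_leq_card sub) _; apply: leq_trans (leq_imset_card _ _) _.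
have <- : #|[set NE; W; SE]| = 3%N by rewrite setUC cardsU1 cards2 !inE.
by apply: subset_leq_card; apply/subsetP => -[] _; rewrite !inE eqxx ?orbT.
Qed.

Hypotheses (fil : filled S) (cf : chordless S).
Hypothesis many : (3 < #|porbits rhoS|)%N.

Definition trio O : bool := (O \in porbits rhoS) && (ell O == 3%N).

Lemma tri_orbit O : trio O -> exists T, [/\ triangle_in S T, side_darts T O & 5 <= sz T].
Proof.
case/andP => /orbit_bd[b hb ->] /eqP e3; case: (tri_class hb e3) => [h|[T [h1 h2 h3 h4]]].
  by have := single_cell (pcS b) h; rewrite leqNgt many.
have hT : triangle_in S T by split=> // v; exact: fil.
exists T; split=> //; rewrite leNgt; apply/negP => h5.
have h5' : sz T <= 4 by move: h5; lia.
by have := small3 conn pot cf hT h4 h5'; rewrite leqNgt many.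
Qed.

Section Chosen.
Variable T : {set dart} -> tri.
Hypothesis hT : forall O, trio O -> [/\ triangle_in S (T O), side_darts (T O) O & 5 <= sz (T O)].

Lemma trioP O : trio O -> O \in porbits rhoS. Proof. by case/andP. Qed.

Lemma foreign O x : trio O -> porbit rhoS x != O -> forall y, y \in porbit rhoS x ->
  ~~ ((co (pc y) y.2 == ln (T O) y.2) && touch (T O) (pc y)).
Proof.
move=> tO n y; rewrite -eq_porbit_mem => /eqP e; have [_ <- _] := hT tO.
by apply: contra n => yO; rewrite -e mem_porbits ?trioP.
Qed.

(** A dart of [U] inside the triangle of [O] would lie in a cell touching both triangles, which are
    separated. *)
Lemma passes_same O U : trio O -> trio U -> O != U -> (T O).1 = (T U).1 -> passes (T O) U = 0%N.
Proof.
move=> tO tU n eu; apply/eqP; rewrite -leqn0 leqNgt; apply/negP =>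
  /sum_bool_gt0[y yU /and3P[_ yD _]].
have [h1 h2 _] := hT tO; have [h3 h4 _] := hT tU.
have [k] := separate h1 h3 eu h2 h4 (fun x => @porbits_disjoint O U x (trioP tO) (trioP tU) n).
have t1 : touch (T O) (pc y) by apply/touchP; exists y.2.
have t2 : touch (T U) (pc y) by move: yU; rewrite h4 => /andP[].
by case/orP => s; [exact: separated_touch eu s t1 t2|exact: separated_touch (esym eu) s t2 t1].
Qed.

(** The cell in which [U] leaves the triangle of [O] carries a dart of each orbit, since a side of
    that triangle runs through it. So [O] meets a cell touching the triangle of [U]. *)
Lemma passes_sym O U : trio O -> trio U -> O != U -> (0 < passes (T O) U)%N -> (0 < passes (T U) O)%N.
Proof.
move=> tO tU n /sum_bool_gt0[y yU /and3P[_ yD yn]].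
have [h1 h2 _] := hT tO; have [h3 h4 _] := hT tU.
have eU : porbit rhoS y = U by apply/eqP; rewrite mem_porbits ?trioP.
have fy z : z \in porbit rho y -> ~~ ((co (pc z) z.2 == ln (T O) z.2) && touch (T O) (pc z)).
  by apply: foreign => //; rewrite eU eq_sym.
have [|cy _ _] := cross_dart fy (porbit_id _ y); first by rewrite yD (negbTE yn).
have t1 : touch (T O) (pc y) by apply/touchP; exists y.2.
pose x : dart := (y.1, rf (pc y) y.2); have xO : x \in O by rewrite h2 /x /= cy eqxx.
have eO : porbit rhoS x = O by apply/eqP; rewrite mem_porbits ?trioP.
rewrite -eO; apply: (@touch_passes S (T U) h3 pot x _ x); last 2 first.
- exact: porbit_id.
- by move: yU; rewrite h4 => /andP[].
by apply: foreign => //; rewrite eO.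
Qed.

Definition weight u O : nat := \sum_(U | trio U && ((T U).1 == u) && (U != O)) passes (T U) O.

Lemma weight_bound u O U : O \in porbits rhoS -> trio U -> (T U).1 = u -> U != O ->
  (weight u O + 2 * passes (T U) O <= ell O)%N.
Proof.
case/imsetP => x _ -> tU eu nU; pose P V := trio V && ((T V).1 == u) && (V != porbit rho x).
have tP V : P V -> trio V by case/andP => /andP[].
have pF V : exists F : dir -> vec -> bool, P V -> forall d, side_potential S (T V) d (F d).
  case: (boolP (P V)) => [PV|_]; last by exists (fun _ _ => false).
  have [h1 _ _] := hT (tP _ PV).
  have [F hF] := fin_all_exists (fun i =>
    side_pot (tri_sz h1) (@tri_fill _ _ h1) (tri_corners h1) pot i).
  by exists F.
have [F hF] := fin_all_exists pF.
have PU : P U by rewrite /P tU eu eqxx.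
have [h1 _ _] := hT tU; have [v0 hv0] := inD_ex (tri_sz h1).
apply: (@passes_bound S _ P T id u x conn pot _ _ _ _ _ F _ U v0) => //.
- by move=> V /tP/hT[].
- by move=> V /tP/hT[].
- by move=> V /andP[/andP[_ /eqP]].
- move=> V y PV; rewrite -eq_porbit_mem => /eqP e;
  rewrite -mem_porbits ?(trioP (tP _ PV)) // e eq_sym.
  by case/andP: PV.
- by move=> V V' y PV PV' n; apply: porbits_disjoint; rewrite ?trioP ?tP.
- by move=> V d PV; exact: hF.
Qed.

Lemma weight_gt0 u O : (0 < weight u O)%N ->
  exists U, [/\ trio U, (T U).1 = u, U != O & (0 < passes (T U) O)%N].
Proof.
rewrite lt0n sum_nat_eq0 negb_forall => /existsP[U]; rewrite negb_imply.
by case/andP => /andP[/andP[tU /eqP eu] n]; rewrite -lt0n => h; exists U.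
Qed.

Lemma weight_small u O : O \in porbits rhoS -> (weight u O <= ell O - 2)%N.
Proof.
move=> hO; have [|/weight_gt0[U [tU eu nU p]]] := posnP (weight u O); first by move=> ->.
have := weight_bound hO tU eu nU; move: p; clear; lia.
Qed.

(** From five bounces on, ell O - 2 is at most 2 ell O - 7. With four bounces only weight 2 has to
    be excluded: by [weight_bound] it would be shared by two triangles of the same orientation,
    against [no_two_in_ell4]. *)
Lemma weight_out u O : O \in porbits rhoS -> ~~ trio O -> (weight u O <= 2 * ell O - 7)%N.
Proof.
move=> hO; rewrite /trio hO /= => n3; have e2 := ell_porbits hO; have ws := weight_small u hO.
have [e4|n4] := eqVneq (ell O) 4%N; last first.
  have e5 : (4 < ell O)%N by move: e2 n3 n4; clear; lia.
  by move: ws e5; clear; lia.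
rewrite e4 /= leqNgt; apply/negP => w2.
have [|U [tU eu nU p]] := @weight_gt0 u O; first by apply: ltn_trans w2.
have wb := weight_bound hO tU eu nU; rewrite e4 in wb.
have [p1 w2'] : passes (T U) O = 1%N /\ weight u O = 2%N by move: wb p w2; clear; lia.
have : (0 < \sum_(V | trio V && ((T V).1 == u) && (V != O) && (V != U)) passes (T V) O)%N.
  by move: w2'; rewrite /weight (bigD1 U) /= ?p1; [lia|rewrite tU eu nU eqxx].
rewrite lt0n sum_nat_eq0 negb_forall => /existsP[V]; rewrite negb_imply -lt0n.
case/andP => /andP[/andP[/andP[tV /eqP ev] nV] nVU] pV.
have [h1 h2 _] := hT tU; have [h3 h4 _] := hT tV.
have euv : (T U).1 = (T V).1 by rewrite eu ev.
have dis : U != V by rewrite eq_sym.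
have [b hb eO] := orbit_bd hO; have bO : b \in porbit rho b by rewrite porbit_id.
have fU : forall y, y \in porbit rho b -> ~~ ((co (pc y) y.2 == ln (T U) y.2) && touch (T U) (pc y)).
  by apply: foreign => //; rewrite -eO eq_sym.
have fV : forall y, y \in porbit rho b -> ~~ ((co (pc y) y.2 == ln (T V) y.2) && touch (T V) (pc y)).
  by apply: foreign => //; rewrite -eO eq_sym.
rewrite eO in p pV e4.
have [k /orP[] s] := separate h1 h3 euv h2 h4 (fun x =>
  @porbits_disjoint U V x (trioP tU) (trioP tV) dis).
  exact: (no_two_in_ell4 pot h1 h3 euv fU fV p pV s hb bO e4).
exact: (no_two_in_ell4 pot h3 h1 (esym euv) fV fU pV p s hb bO e4).
Qed.

(** The lines of the triangle of [U] would run strictly inside that of [O]. By [opposite_corner] its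
    corner panes then give the hypothesis [bumps], and [small5] contradicts the presence of more
    than three orbits. *)
Lemma passes_small O U : trio O -> trio U -> U != O -> sz (T O) <= 6 -> passes (T O) U = 0%N.
Proof.
move=> tO tU n s6; have [h1 h2 s5] := hT tO; have [h3 h4 _] := hT tU.
apply/eqP; rewrite -leqn0 leqNgt; apply/negP => p.
have [eu|eu] := eqVneq (T O).1 (T U).1.
  by move: p; rewrite (passes_same tO tU) // eq_sym.
have eu' : (T U).1 = ~~ (T O).1 by move: eu; case: (T O).1; case: (T U).1.
have s56 : 5 <= sz (T O) <= 6 by rewrite s5.
have [y0 y0U] : exists y0, U = porbit rho y0 by case/andP: tU => /imsetP[y0 _ ->]; exists y0.
have fO : forall y, y \in porbit rho y0 -> ~~ ((co (pc y) y.2 == ln (T O) y.2) && touch (T O) (pc y)).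
  by apply: foreign => //; rewrite -y0U.
have between d : gtu (T O).1 (ln (T O) d) (ln (T U) d) /\
    gtu (T O).1 (ln (T U) d) (- (ln (T O) (tau d) + ln (T O) (tau' d))).
  rewrite y0U in p; have [y [yU yd yD yl _]] := exit_ex pot h1 fO p d.
  rewrite -y0U h4 yd in yU; have /andP[/eqP <- _] := yU.
  by apply: inD_line => //; rewrite -[X in vx _ X]yd.
have bumps j : iv S (outer (T O) j) -> ~~ iv S (bump1 (T O) j) /\ ~~ iv S (bump2 (T O) j).
  move=> io; have [np nq] := corner_niv j h3.
  case/or4P: (opposite_corner j s56 eu' between) => [/(tri_fill h1) h|/(tri_fill h1) h|/veqP e|].
  - by rewrite h in np.
  - by rewrite h in nq.
  - by rewrite e io in np.
  case/or3P => [/veqP e|/andP[/veqP e1 /veqP e2]|/andP[/veqP e1 /veqP e2]].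
  - by rewrite e io in nq.
  - by rewrite -e1 -e2.
  - by rewrite -e1 -e2.
have [o eo] : exists o, O = porbit rho o by case/andP: tO => /imsetP[o _ ->]; exists o.
by have := small5 conn pot cf h1 (t := o); rewrite -eo => /(_ h2 s56 bumps); rewrite leqNgt many.
Qed.

(** A nonzero term comes from a triangle of the opposite orientation, is at most 1 since [U] has
    three bounces, and is matched by symmetry with a term of the weight of [O]. That weight is at
    most 3 - 2. *)
Lemma passes_trio O : trio O -> (\sum_(U | trio U && (U != O)) passes (T O) U <= 1)%N.
Proof.
move=> tO; have /andP[hO /eqP e3] := tO.
apply: leq_trans (_ : weight (~~ (T O).1) O <= 1)%N; last by have := weight_small (~~ (T O).1) hO;
  rewrite e3.
rewrite /weight big_mkcond [X in (_ <= X)%N]big_mkcond; apply: leq_sum => U _.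
case: (boolP (trio U)) => //= tU; case: (boolP (U != O)) => nU; last by rewrite andbF.
rewrite andbT; have nU' : O != U by rewrite eq_sym.
case: (posnP (passes (T O) U)) => [->//|p].
have ne : (T O).1 != (T U).1 by apply: contraTneq p => e; rewrite (passes_same tO tU nU' e).
have -> : (T U).1 == ~~ (T O).1 by move: ne; case: (T O).1; case: (T U).1.
apply: leq_trans (passes_sym tO tU nU' p).
have eu : (T O).1 = (T O).1 by [].
have := weight_bound (trioP tU) tO eu nU'.
by case/andP: tU => _ /eqP ->; clear; lia.
Qed.

(** A triangle of size at least 7 has three exits, at most one of them due to orbits with three
    bounces; one of size 5 has two exits, none of them due to such orbits. *)
Lemma passes_nontri O : trio O ->
  (2 <= \sum_(U | (U \in porbits rhoS) && ~~ trio U) passes (T O) U)%N.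
Proof.
move=> tO; have hO := trioP tO; have [h1 h2 s5] := hT tO; have po := passes_out (T O) hO.
have pt := passes_trio tO.
have split : (\sum_(U in porbits rhoS | U != O) passes (T O) U =
    \sum_(U | trio U && (U != O)) passes (T O) U +
    \sum_(U | (U \in porbits rhoS) && ~~ trio U) passes (T O) U)%N.
  rewrite (bigID trio) /=; congr (_ + _)%N; apply: eq_bigl => U.
    by rewrite /trio; case: (U \in porbits rhoS) => //=; rewrite andbC.
  by case: (eqVneq U O) => [->|_]; rewrite ?andbT ?tO //= !andbF.
have [s7|s6] := boolP (7 <= sz (T O)).
  by have := @exit_many (T O) O 3 h1 h2 s7; rewrite -po split; move: pt; clear; lia.
have s6' : sz (T O) <= 6 by move: s6; clear; lia.
have p0 : (\sum_(U | trio U && (U != O)) passes (T O) U = 0)%N.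
  by apply: big1 => U /andP[tU nU]; exact: passes_small.
by have := @exit_many (T O) O 2 h1 h2 s5; rewrite -po split p0.
Qed.

Lemma count_chosen : (7 * #|porbits rhoS| <= 2 * #|[set x : dart | bd x]|)%N.
Proof.
rewrite -sum_ell -sum1_card !big_distrr /= (bigID trio) /= [X in (_ <= X)%N](bigID trio) /=.
have e O : (O \in porbits rhoS) && trio O = trio O by rewrite /trio; case: (O \in porbits rhoS).
rewrite !(eq_bigl _ _ e).
have -> : (\sum_(O | trio O) 2 * ell O = \sum_(O | trio O) 6)%N.
  by apply: eq_bigr => O /andP[_ /eqP ->].
have key : (\sum_(O | trio O) 2 <= \sum_(U | (U \in porbits rhoS) && ~~ trio U) (2 * (2 * ell U - 7)))%N.
  apply: leq_trans (_ : _ <= \sum_(O | trio O) \sum_(U | (U \in porbits rhoS) && ~~ trio U) passes (T O) U)%N _.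
    by apply: leq_sum => O; exact: passes_nontri.
  rewrite exchange_big /=; apply: leq_sum => U /andP[hU nU].
  apply: leq_trans (_ : weight true U + weight false U <= _)%N; last first.
    have := weight_out true hU nU; have := weight_out false hU nU; clear; lia.
  rewrite (bigID (fun O => (T O).1 == true)) /=; apply: leq_add; apply: eq_leq; apply: eq_bigl => O.
    by case: (eqVneq U O) nU => [-> /negbTE ->|_ _] //; rewrite andbT.
  by case: (eqVneq U O) nU => [-> /negbTE ->|_ _] //; rewrite andbT; case: (T O).1.
(* The truncated subtraction is exact because the orbits concerned have at least four bounces. *)
have e7 : (\sum_(U | (U \in porbits rhoS) && ~~ trio U) (2 * (2 * ell U - 7)) +
    2 * \sum_(U | (U \in porbits rhoS) && ~~ trio U) 7 * 1 =
    2 * \sum_(U | (U \in porbits rhoS) && ~~ trio U) 2 * ell U)%N.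
  rewrite !big_distrr -big_split /=; apply: eq_bigr => U /andP[hU nU].
  have e4 : (3 < ell U)%N.
    by move: nU; rewrite /trio hU ltn_neqAle eq_sym /= => ->; exact: ell_porbits.
  by move: e4; clear; lia.
have e1 : (\sum_(O | trio O) 7 * 1 = 7 * \sum_(O | trio O) 1)%N by rewrite big_distrr.
have e6 : (\sum_(O | trio O) 6 = 6 * \sum_(O | trio O) 1)%N by rewrite big_distrr.
have e2 : (\sum_(O | trio O) 2 = 2 * \sum_(O | trio O) 1)%N by rewrite big_distrr.
rewrite e1 e6; rewrite e2 in key; move: key e7; clear.
set a := (\sum_(O | trio O) 1)%N; set b := (\sum_(U | _) (2 * (2 * ell U - 7)))%N.
set p := (\sum_(U | _) 7 * 1)%N; set q := (\sum_(U | _) 2 * ell U)%N.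
by clearbody a b p q; lia.
Qed.

End Chosen.
End Count.

Lemma chordless_bound (S : {fset cell}) :
  connected_cells S -> potentials S -> filled S -> chordless S ->
  (7 * #|porbits (@rho S)| <= 2 * #|[set x : S * dir | bd x]| + 3)%N.
Proof.
move=> conn pot fil cf; case: (ltnP 3 #|porbits (@rho S)|) => [many|few].
  have ex1 (O : {set S * dir}) : exists T, trio O -> [/\ triangle_in S T,
    side_darts T O & 5 <= sz T].
    case: (boolP (trio O)) => [tO|_]; last by exists (true, (0, 0, 0)).
    by have [T hT] := tri_orbit conn pot fil cf many tO; exists T.
  have [T hT] := fin_all_exists ex1.
  exact: leq_trans (count_chosen conn pot cf many hT) (leq_addr _ _).
have : (3 * #|porbits (@rho S)| <= #|[set x : S * dir | bd x]|)%N.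
  rewrite -sum_ell mulnC -sum_nat_const; apply: leq_sum => O hO; exact: ell_porbits.
by move: few; lia.
Qed.

(** * Closed curves *)

Definition ispane (x y : vec) (c : cell) (i : dir) : bool :=
  (veq x (vx c (tau i)) && veq y (vx c (tau' i))) || (veq x (vx c (tau' i)) && veq y (vx c (tau i))).

Lemma veqxx v : veq v v. Proof. exact/veqP. Qed.
Definition adjacent (x y : vec) : Prop := exists c i, ispane x y c i.

Lemma ispane_nb x y c i : ispane x y (nb c i) i = ispane x y c i.
Proof. by rewrite /ispane vx_nb1 vx_nb2 orbC. Qed.

Lemma ispaneC x y c i : ispane x y c i = ispane y x c i.
Proof. by rewrite /ispane orbC andbC [X in _ || X]andbC. Qed.

Lemma ispane_vx c i : ispane (vx c (tau i)) (vx c (tau' i)) c i.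
Proof. by rewrite /ispane !veqxx. Qed.

Lemma adjacentP x y : adjacent x y ->
  [\/ (y.1 = x.1 + 1 /\ y.2 = x.2) \/ (x.1 = y.1 + 1 /\ y.2 = x.2),
      (y.2 = x.2 + 1 /\ y.1 = x.1) \/ (x.2 = y.2 + 1 /\ y.1 = x.1)
    | (y.2 = x.2 + 1 /\ x.1 = y.1 + 1) \/ (x.2 = y.2 + 1 /\ y.1 = x.1 + 1)].
Proof.
case=> -[[a b] u] [i] /orP[] /andP[/veqP-> /veqP->]; case: u; case: i => /=;
  first [by constructor 1; lia|by constructor 2; lia|by constructor 3; lia].
Qed.

(* Whether the step from x to y crosses the ray running west from the cell c. *)
Definition ray (x y : vec) (c : cell) : bool :=
  [&& x.2 == c.1.2, y.2 == c.1.2 + 1 & (if c.2 then x.1 else y.1) <= c.1.1] (+)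
  [&& y.2 == c.1.2, x.2 == c.1.2 + 1 & (if c.2 then y.1 else x.1) <= c.1.1].

(** Crossing a horizontal pane moves the ray to the adjacent row. This correction, for vertices to
    the left on the line between the rows, then enters the crossing count, and it telescopes along a
    closed curve. *)
Definition left_of (c : cell) (i : dir) (x : vec) : bool :=
  [&& i == W, x.2 == c.1.2 + (if c.2 then 0 else 1) & x.1 <= c.1.1].

Ltac split_atoms := repeat match goal with
  | |- context [?a == ?b] => let h := fresh in case: (@eqP _ a b) => h //=; try (exfalso; lia)
  | |- context [(?a <= ?b)%R] => let h := fresh in case: (lerP a b) => h //=; try (exfalso; lia)
  end.

Lemma ray_jump x y c i : adjacent x y ->
  ray x y c (+) ray x y (nb c i) = ispane x y c i (+) (left_of c i x (+) left_of c i y).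
Proof.
case: x y => [x1 x2] [y1 y2] /adjacentP /=; case: c => [[a b] u].
case=> [] [] [e1 e2]; subst; rewrite /ray /ispane /left_of /veq /=; case: u; case: i => /=;
  split_atoms.
Qed.

Notation xsum n F := (\big[addb/false]_(j < n) F%B (nat_of_ord j)).

Lemma telescope n (h : nat -> bool) : xsum n (fun j => h j (+) h j.+1) = h 0%N (+) h n.
Proof.
elim: n => [|n IH]; first by rewrite big_ord0 addbb.
by rewrite big_ord_recr IH /= -addbA addKb.
Qed.

Definition winding n (g : nat -> vec) (c : cell) : bool := xsum n (fun j => ray (g j) (g j.+1) c).

Lemma winding_jump n g : (forall j, (j < n)%N -> adjacent (g j) (g j.+1)) -> g n = g 0%N ->
  forall c i, winding n g c (+) winding n g (nb c i) = xsum n (fun j => ispane (g j) (g j.+1) c i).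
Proof.
move=> adj cl c i; rewrite /winding -big_split /=.
rewrite (eq_bigr (fun j : 'I_n => ispane (g j) (g j.+1) c i (+)
   (left_of c i (g j) (+) left_of c i (g j.+1)))); last by move=> j _; apply/ray_jump/adj.
by rewrite big_split /= (telescope n (fun j => left_of c i (g j))) cl addbb addbF.
Qed.

Lemma int_shift (P : int -> Prop) : P 0 -> (forall z, P z <-> P (z + 1)) -> forall z, P z.
Proof.
move=> P0 h; elim/int_rec => // n.
  by move/h; rewrite -[n%:Z + 1]/(n%:Z + 1%:Z) -PoszD addn1.
by move=> IH; apply/h; rewrite -addn1 PoszD opprD subrK.
Qed.

Lemma plane_const (B : cell -> bool) : (forall c i, B (nb c i) = B c) -> forall c c', B c = B c'.
Proof.
move=> h; suff H : forall c, B c = B ((0, 0), true) by move=> c c'; rewrite !H.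
have hd a b : B ((a, b), false) = B ((a, b), true) by rewrite -(h ((a, b), true) SE).
have hx a b : B ((a - 1, b), true) = B ((a, b), true) by rewrite -hd -(h ((a, b), true) NE).
have hy a b : B ((a, b - 1), true) = B ((a, b), true) by rewrite -hd -(h ((a, b), true) W).
move=> [[a b] u]; have -> : B ((a, b), u) = B ((a, b), true) by case: u => //; exact: hd.
have -> : B ((a, b), true) = B ((0, b), true).
  apply: (int_shift (P := fun a => B ((a, b), true) = B ((0, b), true))) => // z.
  by rewrite -(hx (z + 1)) addrK.
apply: (int_shift (P := fun b => B ((0, b), true) = B ((0, 0), true))) => // z.
by rewrite -(hy _ (z + 1)) addrK.
Qed.

Lemma fset_bound (S : {fset cell}) : exists N : nat, forall c,
  c \in S -> `|c.1.1| + `|c.1.2| < N%:Z.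
Proof.
suff H (s : seq cell) : exists N : nat, forall c, c \in s -> `|c.1.1| + `|c.1.2| < N%:Z by exact: H.
elim: s => [|c s [N IH]]; first by exists 0%N.
exists (N + `|c.1.1| + `|c.1.2| + 1)%N => z; rewrite inE => /orP[/eqP->|/IH].
  by move: c.1.1 c.1.2 {IH} => a b; lia.
by move: c.1.1 c.1.2 z.1.1 z.1.2 {IH} => a b a' b'; lia.
Qed.

Lemma fset_avoid (S : {fset cell}) : exists c, c \notin S.
Proof.
have [N hN] := fset_bound S; exists ((N%:Z, 0), true); apply/negP => /hN /=; lia.
Qed.

(* The six panes at v are (pane_cell v t, pane_idx t); their other ends are pane_end v t. *)
Definition pane_cell (v : vec) (t : dir * bool) : cell := cellat v true t.1.
Definition pane_idx (t : dir * bool) : dir := if t.2 then tau t.1 else tau' t.1.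
Definition pane_end (v : vec) (t : dir * bool) : vec :=
  vx (pane_cell v t) (if t.2 then tau' t.1 else tau t.1).

Lemma pane_end_inj v : injective (pane_end v).
Proof.
by move: v => [x y] [k b] [k' b']; case: k; case: b; case: k'; case: b' => //=;
  rewrite /pane_end /=;
  move=> e; exfalso; have := congr1 fst e; have := congr1 snd e; clear; rewrite /=; lia.
Qed.

Lemma pane_at v u c i : ispane v u c i -> exists t, [/\ pane_end v t = u, pane_idx t = i &
  (pane_cell v t = c \/ nb (pane_cell v t) i = c)].
Proof.
wlog cu : c / c.2 = true => [H h|].
  case e : c.2; first exact: H.
  have [||t [h1 h2 h3]] := H (nb c i); rewrite ?nb_up ?e ?ispane_nb //.
  by exists t; split=> //; case: h3 => g; [right; rewrite g nbK|left; rewrite -(nbK i c) -g nbK].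
case/orP => /andP[/veqP-> /veqP->].
  exists (tau i, false); rewrite /pane_end /pane_cell /pane_idx /= -cu cellatE.
  by split; [case: (i)|case: (i)|left].
exists (tau' i, true); rewrite /pane_end /pane_cell /pane_idx /= -cu cellatE.
by split; [case: (i)|case: (i)|left].
Qed.

Lemma pane_at' v t : ispane v (pane_end v t) (pane_cell v t) (pane_idx t).
Proof.
by case: v => x y; case: t => -[] []; rewrite /ispane /veq /=; lia.
Qed.

Definition jump (A : cell -> bool) (c : cell) (i : dir) : bool := A c (+) A (nb c i).

Lemma jump_nb A c i : jump A (nb c i) i = jump A c i.
Proof. by rewrite /jump nbK addbC. Qed.

Lemma nb_cellat v u k : nb (cellat v u k) (tau k) = cellat v (~~ u) (tau' k) /\
  nb (cellat v u k) (tau' k) = cellat v (~~ u) (tau k).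
Proof. by case: v => x y; case: u; case: k => /=; split; congr (_, _, _); lia. Qed.

Lemma big_dir (F : dir -> bool) : \big[addb/false]_k F k = F NE (+) F W (+) F SE.
Proof.
rewrite (bigD1 NE) // (bigD1 W) // (bigD1 SE) //= big1 ?addbF ?addbA //.
by case.
Qed.

(** Each of the six cells around [v] occurs in exactly two of the six jumps. *)
Lemma vertex_parity A v : \big[addb/false]_(t :
  dir * bool) jump A (pane_cell v t) (pane_idx t) = false.
Proof.
rewrite -(pair_bigA _ (fun k b => jump A (pane_cell v (k, b)) (pane_idx (k, b)))) /=.
have e k : \big[addb/false]_(b : bool) jump A (pane_cell v (k, b)) (pane_idx (k, b)) =
    A (cellat v false (tau' k)) (+) A (cellat v false (tau k)).
  rewrite big_bool /jump /pane_cell /pane_idx /=.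
  by have [-> ->] := nb_cellat v true k; rewrite addbACA addbb.
rewrite big_dir !e /tau /tau'.
by case: (A (cellat v false NE)); case: (A (cellat v false W)); case: (A (cellat v false SE)).
Qed.

(* The steps f j, f j.+1 for j < n, counted mod 2, are the boundary panes of S. *)
Record curve (S : {fset cell}) (n : nat) (f : nat -> vec) : Prop := Curve {
  cu_per : forall j, f (j + n)%N = f j;
  cu_inj : forall i j, f i = f j -> i = j %[mod n];
  cu_adj : forall j, adjacent (f j) (f j.+1);
  cu_jump : forall c i, jump (mem S) c i = xsum n (fun j => ispane (f j) (f j.+1) c i);
  cu_ne : exists c, c \in S }.

Lemma xsum_true n (F : nat -> bool) : xsum n F -> exists2 j, (j < n)%N & F j.
Proof.
elim: n => [|n IH]; first by rewrite big_ord0.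
rewrite big_ord_recr /=; case e : (F n); first by exists n.
by rewrite addbF => /IH[j jn Fj]; exists j => //; apply: ltnW.
Qed.

Lemma xsum_one n (F : nat -> bool) j : (j < n)%N -> (forall k, (k < n)%N -> F k -> k = j) ->
  xsum n F = F j.
Proof.
move=> jn h; rewrite (bigD1 (Ordinal jn)) //= big1 ?addbF // => k nk; apply/negbTE/negP.
by move/h => /(_ (ltn_ord k)) e; case/eqP: nk; apply: val_inj.
Qed.

Lemma ispane_adj x y c i : ispane x y c i -> adjacent x y. Proof. by exists c, i. Qed.

Lemma ispane_ends x y x' y' c i : ispane x y c i -> ispane x' y' c i ->
  x' = x /\ y' = y \/ x' = y /\ y' = x.
Proof.
by case/orP => /andP[/veqP-> /veqP->] /orP[] /andP[/veqP-> /veqP->]; by [left|right].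
Qed.

Lemma adjacent_neq x y : adjacent x y -> x <> y.
Proof. by move=> /adjacentP + e; rewrite e; case=> [] [] []; lia. Qed.

(** * A Jordan theorem for closed curves of panes *)

Section Theory.
Variables (S : {fset cell}) (n : nat) (f : nat -> vec).
Hypothesis hf : curve S n f.

Lemma cu_mod i j : i = j %[mod n] -> f i = f j.
Proof.
have h k m : f (m + k * n)%N = f m.
  by elim: k m => [|k IH] m; rewrite ?addn0 // mulSn addnA IH (cu_per hf).
by move=> e; rewrite (divn_eq i n) (divn_eq j n) addnC h e addnC h.
Qed.

Lemma jump_pane c i : jump (mem S) c i -> exists2 j, (j < n)%N & ispane (f j) (f j.+1) c i.
Proof. by rewrite (cu_jump hf) => h; exact: (xsum_true (F := fun j =>
  ispane (f j) (f j.+1) c i) h). Qed.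

Lemma no_jump_false : (forall c i, jump (mem S) c i = false) -> False.
Proof.
move=> h; have [c cS] := cu_ne hf; have [c' /negP] := fset_avoid S; apply.
have := @plane_const (mem S) _ c' c; rewrite /= cS; apply=> z i.
by have := h z i; rewrite /jump /=; case: (z \in S); case: (nb z i \in S).
Qed.

Lemma cu_ge3 : (2 < n)%N.
Proof.
case: n hf => [|[|[|//]]] h; exfalso; apply: no_jump_false => c i; rewrite (cu_jump h).
- by rewrite big_ord0.
- by have /adjacent_neq[] := cu_adj h 0; have := cu_per h 0.
- by rewrite !big_ord_recr big_ord0 /= (cu_per h 0) [X in _ (+) X]ispaneC addbb.
Qed.

Lemma cu_succ i j : f i = f j -> f i.+1 = f j.+1.
Proof. by move=> /(cu_inj hf) e; apply: cu_mod;
  rewrite -(addn1 i) -(addn1 j) -modnDml e modnDml. Qed.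

Lemma cu_pred i j : f i.+1 = f j.+1 -> f i = f j.
Proof.
move=> /(cu_inj hf) e; apply: cu_mod; have n0 : (0 < n)%N by apply: leq_trans cu_ge3.
apply/eqP; rewrite -(eqn_modDr 1) !addn1; exact/eqP.
Qed.

Lemma cu_two j : f j.+2 <> f j.
Proof.
move=> /(cu_inj hf)/eqP; rewrite -addn2 -[X in _ == X %[mod _]]addn0 eqn_modDl mod0n.
by rewrite modn_small ?cu_ge3.
Qed.

Lemma pane_jump j c i : ispane (f j) (f j.+1) c i -> jump (mem S) c i.
Proof.
move=> h; have n0 : (0 < n)%N by apply: leq_trans cu_ge3.
rewrite (cu_jump hf) (xsum_one (F := fun j => ispane (f j) (f j.+1) c i) (j :=
  (j %% n)%N)) ?ltn_mod //.
  have e : f (j %% n)%N = f j by apply: cu_mod; rewrite modn_mod.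
  by rewrite e (cu_succ e).
move=> k kn /(ispane_ends h)[[e _]|[e1 e2]]; last by case: (@cu_two j); rewrite -e2;
  exact/esym/cu_succ.
by rewrite -(cu_inj hf e) modn_small.
Qed.

(* An even number of the panes at f j.+1 separate A from its complement. *)
Lemma jump_walk (A : cell -> bool) j c i c' i' :
  (forall z k, jump A z k -> jump (mem S) z k) ->
  ispane (f j) (f j.+1) c i -> ispane (f j.+1) (f j.+2) c' i' -> jump A c i = jump A c' i'.
Proof.
move=> hA h h'; set v := f j.+1 in h h'.
have [t [te ti tc]] : exists t, [/\ pane_end v t = f j,
  pane_idx t = i & (pane_cell v t = c \/ nb (pane_cell v t) i = c)].
  by apply: pane_at; rewrite ispaneC.
have [t' [te' ti' tc']] := pane_at h'.
have e : jump A c i = jump A (pane_cell v t) (pane_idx t) by rewrite ti; case: tc => <-;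
  rewrite ?jump_nb.
have e' : jump A c' i' = jump A (pane_cell v t') (pane_idx t') by rewrite ti'; case: tc' => <-;
  rewrite ?jump_nb.
have tt : t != t' by apply/eqP => E; case: (@cu_two j); rewrite -te' -E te.
have := vertex_parity A v; rewrite (bigD1 t) //= (bigD1 t') 1?eq_sym //= big1 ?addbF.
  by rewrite -e -e'; case: (jump A c i); case: (jump A c' i').
move=> s /andP[s1 s2]; apply/negbTE/negP => /hA/jump_pane[k _ /(ispane_ends (pane_at' v s))].
case=> [[k1 k2]|[k1 k2]].
  by move: s2; rewrite (@pane_end_inj v s t') ?eqxx // te' -k2; apply: cu_succ.
by move: s1; rewrite (@pane_end_inj v s t) ?eqxx // te -k1; apply: cu_pred.
Qed.

Lemma jump_all (A : cell -> bool) : (forall z k, jump A z k -> jump (mem S) z k) ->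
  exists e, forall c i, jump (mem S) c i -> jump A c i = e.
Proof.
move=> hA; have [c0 [i0 h0]] := cu_adj hf 0; exists (jump A c0 i0) => c i /jump_pane[j _].
elim: j c i => [|j IH] c i h.
  case: (pane_at h) (pane_at h0) => t [te ti tc] [t' [te' ti' tc']].
  have E : t = t' by apply: (@pane_end_inj (f 0%N)); rewrite te te'.
  have -> : jump A c i = jump A (pane_cell (f 0%N) t) (pane_idx t) by rewrite ti; case: tc => <-;
    rewrite ?jump_nb.
  by rewrite E ti'; case: tc' => <-; rewrite ?jump_nb.
have [c' [i' h']] := cu_adj hf j.
by rewrite -(IH c' i' h'); apply/esym; apply: jump_walk h' h.
Qed.

(** By [jump_all], [A] jumps at all boundary panes of S or at none. Correcting it by S in the first
    case leaves no jump at all, and a function without jumps is constant on the plane. *)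
Lemma jordan (A : cell -> bool) : (forall z k, jump A z k -> jump (mem S) z k) ->
  exists b e, forall c, A c = b (+) (e && (c \in S)).
Proof.
move=> hA; have [e he] := jump_all hA; have [c0 c0S] := cu_ne hf.
exists (A c0 (+) e), e => c; pose B c := A c (+) (e && (c \in S)).
have /(_ c c0) : forall c c', B c = B c'.
  apply: plane_const => z i; rewrite /B.
  have := he z i; have := hA z i; rewrite /jump /=.
  case: (A z); case: (A (nb z i)); case: (z \in S); case: (nb z i \in S); case: (e) => //= h1 h2;
    first [by move: (h1 isT)|by move: (h2 isT)].
by rewrite /B c0S andbT => <-; rewrite -addbA addbb addbF.
Qed.

(** [jordan] applies to the cells of S satisfying [A]: none of them lies outside S, so they are all
    of S or there are none. *)
Lemma curve_connected : connected_cells S.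
Proof.
move=> A [c0 c0S Ac0] hA c cS; pose B c := A c && (c \in S).
have [z k|b [e he]] := @jordan B.
  rewrite /jump /B /=; have := hA z k; have := hA (nb z k) k; rewrite nbK.
  case: (A z); case: (A (nb z k)); case: (z \in S); case: (nb z k \in S) => //= h1 h2;
    first [by move: (h1 isT isT isT)|by move: (h2 isT isT isT)].
have [c' nS] := fset_avoid S.
have := he c'; rewrite /B (negbTE nS) !andbF addbF => b0.
by have := he c; have := he c0; rewrite /B -b0 c0S cS Ac0 !andbT /= => <-.
Qed.
End Theory.

(** * Potentials inside a curve *)

Definition prim (h : int -> bool) (z : int) : bool :=
  match z with
  | Posz m => xsum m (fun k => h k%:Z)
  | Negz m => xsum m.+1 (fun k => h (- k.+1%:Z))
  end.

Lemma prim_step h z : prim h (z + 1) = prim h z (+) h z.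
Proof.
case: z => m; first by rewrite -[Posz m + 1]/(Posz m + Posz 1) -PoszD addn1 /= big_ord_recr.
case: m => [|m].
  by have -> : Negz 0 + 1 = Posz 0 by []; rewrite /prim big_ord0 big_ord_recr big_ord0 /= addbb.
have -> : Negz m.+1 + 1 = Negz m by rewrite !NegzE -(addn1 m.+1) PoszD opprD subrK.
by rewrite /prim [in RHS]big_ord_recr NegzE /= -addbA addbb addbF.
Qed.

(** [d] is integrated along row 0 and then along the lines of direction [NE]; the relation [cl],
    from the two cells of a parallelogram, makes the horizontal differences correct in every other
    row. *)
Lemma plane_potential (d : cell -> dir -> bool) : (forall c i, d (nb c i) i = d c i) ->
  (forall c, d c NE (+) d c W (+) d c SE = false) ->
  exists F : vec -> bool, forall c i, F (vx c (tau i)) (+) F (vx c (tau' i)) = d c i.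
Proof.
move=> sym coc; pose h a b := d ((a, b), true) W; pose v a b := d ((a, b), true) NE.
have cl a b : h a (b + 1) = h a b (+) v a b (+) v (a + 1) b.
  have := coc ((a, b), true); have := coc ((a, b), false).
  rewrite -(sym ((a, b), false) NE) -(sym ((a, b), false) W) -(sym ((a, b),
    false) SE) /= -/(h a (b + 1)) -/(v (a + 1) b).
  by rewrite -/(h a b) -/(v a b); case: (d _ _); case: (h a b); case: (h a (b + 1)); case: (v a b);
    case: (v (a + 1) b).
pose F (p : vec) := prim (fun x => h x 0) p.1 (+) prim (v p.1) p.2.
have Fv a b : F (a, b) (+) F (a, b + 1) = v a b.
  by rewrite /F /= prim_step addbACA addbb addFb addbA addbb.
have Fh a b : F (a, b) (+) F (a + 1, b) = h a b.
  apply: (int_shift (P := fun b => F (a, b) (+) F (a + 1, b) = h a b)).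
    by rewrite /F /= !big_ord0 !addbF prim_step addbA addbb.
  move=> z; rewrite cl; have := Fv a z; have := Fv (a + 1) z.
  case: (F (a, z)); case: (F (a, z + 1)); case: (F (a + 1, z)); case: (F (a + 1, z + 1)) =>
    /= <- <-;
    by case: (h a z).
have up a b i : F (vx ((a, b), true) (tau i)) (+) F (vx ((a, b), true) (tau' i)) = d ((a, b),
  true) i.
  case: i => /=; first by rewrite addbC Fv.
    by rewrite Fh.
  have := coc ((a, b), true); rewrite -/(h a b) -/(v a b) -Fh -Fv.
  by case: (F _); case: (F _); case: (F _); case: (d _ _).
exists F => -[[a b] []] i //; rewrite -sym.
have [a' [b' e]] : exists a' b', nb ((a, b), false) i = ((a', b'), true) by case: i; do 2!eexists.
by rewrite -(vx_nb2 ((a, b), false) i) -(vx_nb1 ((a, b), false) i) e addbC up.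
Qed.

Lemma ispane_uniq x y c i c' i' :
  ispane x y c i -> ispane x y c' i' -> i' = i /\ (c' = c \/ c' = nb c i).
Proof.
move=> /pane_at[t [te ti tc]] /pane_at[t' [te' ti' tc']].
have E : t' = t by apply: (@pane_end_inj x); rewrite te te'.
rewrite E in ti' tc'; have ei : i' = i by rewrite -ti -ti'.
split=> //; rewrite ei in tc'; case: tc => <-; case: tc' => <-; rewrite ?nbK; by [left|right].
Qed.

Section Potentials.
Variables (S : {fset cell}) (n : nat) (f : nat -> vec).
Hypothesis hf : curve S n f.
Variable d : cell -> dir -> bool.
Hypothesis d_sym : forall c i, c \in S -> nb c i \in S -> d (nb c i) i = d c i.
Hypothesis d_coc : forall c, c \in S -> d c NE (+) d c W (+) d c SE = false.

(** [d] read from whichever cell at the pane belongs to S, so that it depends on the pane only,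
    boundary panes included. *)
Let dd c i := if c \in S then d c i else if nb c i \in S then d (nb c i) i else false.

Lemma dd_sym c i : dd (nb c i) i = dd c i.
Proof.
rewrite /dd nbK; case: (boolP (c \in S)) => h; case: (boolP (nb c i \in S)) => h' //.
exact: d_sym.
Qed.

Let Dv x y := [exists t, veq (pane_end x t) y && dd (pane_cell x t) (pane_idx t)].

Lemma DvE x y c i : ispane x y c i -> Dv x y = dd c i.
Proof.
move=> /pane_at[t [te ti tc]].
have -> : dd c i = dd (pane_cell x t) (pane_idx t) by rewrite ti; case: tc => <-; rewrite ?dd_sym.
apply/existsP/idP => [[t' /andP[/veqP e]]|h]; last by exists t; rewrite h te veqxx.
by have -> : t' = t by apply: (@pane_end_inj x); rewrite e te.
Qed.

Notation pane := (S * dir)%type.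
Let swap (x : pane) : pane := if insub (nb (val x.1) x.2) is Some c then (c, x.2) else x.

Lemma swapE x : nb (val x.1) x.2 \in S -> val (swap x).1 = nb (val x.1) x.2 /\ (swap x).2 = x.2.
Proof. by move=> h; rewrite /swap; case: insubP => [c _ e|]; rewrite ?h. Qed.

Lemma swap_out x : nb (val x.1) x.2 \notin S -> swap x = x.
Proof. by move=> h; rewrite /swap; case: insubP => [c|//]; rewrite (negbTE h). Qed.

Lemma swap_inj : injective swap.
Proof.
apply: (can_inj (g := swap)) => x; case: (boolP (nb (val x.1) x.2 \in S)) => h;
  last by rewrite !swap_out.
have [e1 e2] := swapE h; have [|e3 e4] := @swapE (swap x); first by rewrite e1 e2 nbK; exact: valP.
move: e3 e4; rewrite e1 e2 nbK; case: (swap (swap x)) => a b /= e3 e4.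
by case: (x) e3 e4 => p q /= /val_inj -> ->.
Qed.

Lemma interior_sum : \big[addb/false]_(x : pane | nb (val x.1) x.2 \in S) dd (val x.1) x.2 = false.
Proof.
rewrite (bigID (fun x : pane => (val x.1).2)) /=.
rewrite [X in X (+) _](reindex_inj swap_inj) /=.
rewrite [X in X (+) _](eq_big (fun x : pane => (nb (val x.1) x.2 \in S) && ~~ (val x.1).2)
   (fun x : pane => dd (val x.1) x.2)) ?addbb //.
  move=> x; case: (boolP (nb (val x.1) x.2 \in S)) => h; last by rewrite swap_out ?(negbTE h).
  by have [-> ->] := swapE h; rewrite nbK nb_up; case: (x.1) => p hp /=; rewrite hp.
move=> x; case: (boolP (nb (val x.1) x.2 \in S)) => h; last by rewrite swap_out ?(negbTE h).
by have [-> ->] := swapE h; rewrite dd_sym.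
Qed.

Lemma total_sum : \big[addb/false]_(x : pane) dd (val x.1) x.2 = false.
Proof.
rewrite -(pair_bigA _ (fun c i => dd (val c) i)) /= big1 // => c _.
by rewrite big_dir /dd (valP c) d_coc ?(valP c).
Qed.

(** In the sum of the cocycle relations over all cells of S, interior panes occur twice and boundary
    panes once. Hence the partial sums [ph] along the curve close up and define [phi] on the
    boundary vertices. *)
Lemma boundary_sum : xsum n (fun j => Dv (f j) (f j.+1)) = false.
Proof.
have e j : Dv (f j) (f j.+1) =
    \big[addb/false]_(x : pane) (ispane (f j) (f j.+1) (val x.1) x.2 && dd (val x.1) x.2).
  have [c [i h]] := cu_adj hf j.
  have [z [zS hz nz]] : exists z, [/\ z \in S, ispane (f j) (f j.+1) z i & nb z i \notin S].
    have := pane_jump hf h; rewrite /jump /=; case: (boolP (c \in S)) => cS; case: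
      (boolP (nb c i \in S)) => nS // _.
      by exists c.
    by exists (nb c i); rewrite ispane_nb nbK.
  rewrite (DvE hz) (bigD1 (([` zS], i) : pane)) //= hz big1 ?addbF // => -[[w wS] k] /= nw.
  apply/negbTE/negP => /andP[hw _].
  have [ek ew] := ispane_uniq hz hw; subst k; case: ew => ew; last by rewrite -ew wS in nz.
  by case/eqP: nw; congr (_, _); apply: val_inj.
rewrite (eq_bigr (fun j : 'I_n => \big[addb/false]_(x : pane)
  (ispane (f j) (f j.+1) (val x.1) x.2 && dd (val x.1) x.2))); last by move=> j _; exact: e.
rewrite exchange_big /= (eq_bigr (fun x : pane => jump (mem S) (val x.1) x.2 && dd (val x.1) x.2));
  last first.
  by move=> x _; rewrite (cu_jump hf) big_distrl.
have := total_sum; rewrite (bigID (fun x : pane =>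
  nb (val x.1) x.2 \in S)) /= interior_sum addFb => {2}<-.
rewrite [RHS]big_mkcond; apply: eq_bigr => x _; rewrite /jump /= (valP x.1).
by case: (_ \in S).
Qed.

Let ph j := xsum j (fun k => Dv (f k) (f k.+1)).
Let phi v := [exists j : 'I_n, veq (f j) v && ph j].

Lemma phiE j : (j <= n)%N -> phi (f j) = ph j.
Proof.
have n0 : (0 < n)%N by apply: leq_trans (cu_ge3 hf).
have small k : (k < n)%N -> phi (f k) = ph k.
  move=> kn; apply/existsP/idP => [[l /andP[/veqP e]]|h]; last by exists (Ordinal kn);
    rewrite veqxx.
  by have := cu_inj hf e; rewrite !modn_small // => ->.
rewrite leq_eqVlt => /predU1P[->|]; last exact: small.
by have := cu_per hf 0; rewrite add0n => ->; rewrite small // /ph boundary_sum big_ord0.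
Qed.

Lemma phi_jump c i : jump (mem S) c i -> phi (vx c (tau i)) (+) phi (vx c (tau' i)) = dd c i.
Proof.
move=> /(jump_pane hf)[j jn h]; have e : phi (f j) (+) phi (f j.+1) = dd c i.
  rewrite -(DvE h) !phiE //; last exact: ltnW.
  by rewrite /ph big_ord_recr /= addbA addbb addFb.
by rewrite -e; case/orP: h => /andP[/veqP-> /veqP->] //; rewrite addbC.
Qed.

Lemma curve_potential : exists F : vec -> bool, forall c i, c \in S ->
  F (vx c (tau i)) (+) F (vx c (tau' i)) = d c i.
Proof.
(* Away from S, [d] is extended by the coboundary of [phi], which agrees with it on the boundary
   panes; the result is closed on the whole plane. *)
pose d' c i := if (c \in S) || (nb c i \in S) then dd c i else phi (vx c (tau i)) (+) phi (vx c (tau' i)).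
have [c i|c|F hF] := @plane_potential d'; last 1 first.
- by exists F => c i cS; rewrite hF /d' /dd cS.
- by rewrite /d' nbK orbC dd_sym vx_nb1 vx_nb2 addbC.
case: (boolP (c \in S)) => cS; first by rewrite /d' /dd cS d_coc.
have e i : d' c i = phi (vx c (tau i)) (+) phi (vx c (tau' i)).
  rewrite /d' (negbTE cS) /=; case: (boolP (nb c i \in S)) => // nS.
  by rewrite phi_jump // /jump /= (negbTE cS) nS.
by rewrite !e /=; case: (phi _); case: (phi _); case: (phi _).
Qed.
End Potentials.

Lemma curve_potentials S n f : curve S n f -> potentials S.
Proof. by move=> hf d h1 h2; exact: curve_potential hf _ h1 h2. Qed.

(** * Triangles inside a curve contain no boundary vertex *)

Lemma leave_line T c k l : inD T (vx c k) -> ~~ inD T (vx c l) ->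
  exists d, co c d = ln T d.
Proof.
move=> h1 h2; suff : [|| co c NE == ln T NE, co c W == ln T W | co c SE == ln T SE].
  by case/or3P => /eqP e; [exists NE|exists W|exists SE].
by move: c k l h1 h2 => [[a b] []] k l; case: k; case: l; tri_cases T; lia.
Qed.

(* Vertices running to infinity outside T. *)
Definition escape (T : tri) (k : nat) : vec :=
  let v := vx (corner_cell T SE) NE in (v.1 + (if T.1 then - k%:Z else k%:Z), v.2).

Lemma escape_out T k : ~~ inD T (escape T k).
Proof. by rewrite /escape; tri_cases T; lia. Qed.

Lemma escape0 T : escape T 0 = vx (corner_cell T SE) NE.
Proof. by rewrite /escape; case: (vx _ _) => p q /=; case: T.1; rewrite ?oppr0 addr0. Qed.

Lemma escapeS T k : exists i j, escape T k.+1 = vx (cellat (escape T k) true i) j.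
Proof.
exists (if T.1 then NE else SE), (if T.1 then SE else NE); rewrite /escape; case: (vx _ _) =>
  p q /=.
by case: T.1; congr (_, _); lia.
Qed.

Section Fill.
Variables (S : {fset cell}) (n : nat) (f : nat -> vec).
Hypothesis hf : curve S n f.

(** If no pane at the vertex is a boundary pane, the six cells around it are all in S or all
    outside. *)
Lemma boundary_vertex c i : c \in S -> ~~ iv S (vx c i) -> exists j, f j = vx c i.
Proof.
set v := vx c i => cS; case: (boolP [exists t, jump (mem S) (pane_cell v t) (pane_idx t)]).
  case/existsP => t /(jump_pane hf)[j _ /(ispane_ends (pane_at' v t))] h _.
  by case: h => [[h _]|[_ h]]; [exists j|exists j.+1].
rewrite negb_exists => /forallP h /negP[].
have hn u k : (cellat v u k \in S) = (cellat v true NE \in S).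
  have hu k' : (cellat v true k' \in S) = (cellat v false (tau k') \in S) /\
               (cellat v true k' \in S) = (cellat v false (tau' k') \in S).
    have := h (k', true); have := h (k', false); rewrite /jump /pane_cell /pane_idx /=.
    by have [-> ->] := nb_cellat v true k'; do 3!case: (_ \in S).
  have := hu NE; have := hu W; have := hu SE; rewrite /=; case: u; case: k;
    by do ![move=> [-> ?] | move=> [? ->]].
apply/ivP => z k ez; rewrite -(cellatE z k) ez hn -(hn c.2 i) /v cellatE //.
Qed.

Lemma curve_const (R : vec -> bool) :
  (forall c i x y, jump (mem S) c i -> ispane x y c i -> R x = R y) -> forall j,
    R (f j) = R (f 0%N).
Proof.
move=> h; elim=> // j <-; have [c [i hc]] := cu_adj hf j.
by apply/esym; apply: (h c i) => //; exact: (pane_jump hf hc).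
Qed.

(** A pane with exactly one end in T has both its cells on the sides, hence in S, so the boundary
    curve is entirely inside or entirely outside T. In the first case every vertex of S outside T
    would be interior, and walking along [escape] would contradict finiteness. *)
Lemma curve_filled : filled S.
Proof.
move=> T s3 sd.
have sideS c k l : inD T (vx c k) -> ~~ inD T (vx c l) -> c \in S.
  by move=> h1 h2; have [d e] := leave_line h1 h2; apply: (sd _ d e); apply/touchP; exists k.
have const j : inD T (f j) = inD T (f 0%N).
  apply: (curve_const (R := inD T)) => c i x y hj hp.
  have key x' y' z : ispane x' y' z i -> inD T x' -> ~~ inD T y' -> z \in S.
    by case/orP => /andP[/veqP-> /veqP->]; exact: sideS.
  have key2 x' y' : ispane x' y' c i -> inD T x' -> ~~ inD T y' -> False.
    move=> h h1 h2; move: hj; rewrite /jump /= (key _ _ _ h h1 h2) (key x' y' (nb c i)) ?ispane_nb //.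
  apply/idP/idP => h; apply/negPn/negP => h'; first exact: key2 hp h h'.
  by apply: (key2 y x) => //; rewrite ispaneC.
pose c0 := corner_cell T SE; have [_ e1 _] := corner_cellE T SE.
have t0 : touch T c0 by exact: corner_touch.
have c0S : c0 \in S by exact: (sd _ _ e1).
case: (boolP (inD T (f 0%N))) => hD.
  exfalso; have outiv c i : c \in S -> ~~ inD T (vx c i) -> iv S (vx c i).
    move=> cS h; apply/negPn/negP => /(boundary_vertex cS)[j e].
    by move: h; rewrite -e const hD.
  have yiv k : iv S (escape T k).
    elim: k => [|k /ivP IH].
      by rewrite escape0; apply: outiv => //; rewrite -escape0 escape_out.
    have := escape_out T k.+1; have [i [l ->]] := escapeS T k.
    by apply: outiv; apply: (IH _ i); rewrite vx_cellat.
  have [N hN] := fset_bound S; pose m := (N + `|(vx c0 NE).1|)%N.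
  have /ivP/(_ (cellat (escape T m) true SE) SE) := yiv m.
  rewrite vx_cellat => /(_ erefl) /hN; rewrite /m /escape /= -/c0; move:
    (vx c0 NE).1 (vx c0 NE).2 => p q; clear.
  by case: T.1; lia.
have Div c i : c \in S -> inD T (vx c i) -> iv S (vx c i).
  move=> cS h; apply/negPn/negP => /(boundary_vertex cS)[j e].
  by move: h; rewrite -e const (negbTE hD).
have [k hk] := touchP _ _ t0.
move=> v hv; apply: (inD_connect (R := fun v => iv S v) _ hk hv); last exact: Div.
by move=> c l h1 h2; split=> /ivP h; apply: Div => //; apply: h.
Qed.
End Fill.

(** * Cutting along a chord *)

Section Cut.
Variables (S : {fset cell}) (n : nat) (f : nat -> vec).
Hypothesis hf : curve S n f.

Let arc s m c i := xsum m (fun j => ispane (f (s + j)) (f (s + j).+1) c i).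

Lemma arc_cat s m m' c i : arc s (m + m') c i = arc s m c i (+) arc (s + m) m' c i.
Proof.
elim: m' => [|m' IH]; first by rewrite addn0 /arc [X in _ (+) X]big_ord0 addbF.
by rewrite addnS /arc !big_ord_recr /= -/(arc s _ c i) IH addnA addbA.
Qed.

Lemma arc_shift s c i : arc s n c i = jump (mem S) c i.
Proof.
rewrite (cu_jump hf); elim: s => // s <-; have := arc_cat s 1 n c i.
have e1 : arc (s + n) 1 c i = arc s 1 c i.
  by rewrite /arc !big_ord_recl !big_ord0 !addn0 (cu_per hf) -addSn (cu_per hf).
by rewrite addnC arc_cat e1 addn1 addbC => /addbI ->.
Qed.

Lemma arc_jump s m c i : arc s m c i -> jump (mem S) c i.
Proof. by move=> h; have [j _] := xsum_true (F := fun j =>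
  ispane (f (s + j)) (f (s + j).+1) c i) h; exact: (pane_jump hf). Qed.

Lemma close_arc s m S' c0 i0 : (m < n)%N -> ispane (f (s + m)%N) (f s) c0 i0 -> (exists c,
  c \in S') ->
  (forall c i, jump (mem S') c i = arc s m c i (+) ispane (f s) (f (s + m)%N) c i) ->
  curve S' m.+1 (fun j => f (s + j %% m.+1)%N).
Proof.
move=> mn h ne hj; pose g j := f (s + j %% m.+1)%N.
have gS j : (j < m.+1)%N -> g j = f (s + j)%N by move=> jm; rewrite /g modn_small.
have gm : g m.+1 = f s by rewrite /g modnn addn0.
split=> //.
- by move=> j; rewrite modnDr.
- move=> i j /(cu_inj hf)/eqP; rewrite eqn_modDl => /eqP e.
  have := e; rewrite !(@modn_small _ n) //; apply: leq_trans (ltn_pmod _ _) mn; by [].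
- move=> j; rewrite -[j.+1]addn1 -modnDml addn1.
  have := ltn_pmod j (ltn0Sn m); rewrite ltnS leq_eqVlt => /predU1P[->|jm].
    by rewrite modnn addn0; exists c0, i0.
  by rewrite (@modn_small (j %% m.+1).+1 m.+1 jm) addnS; exact: cu_adj hf _.
move=> c i; rewrite hj -[RHS]/(xsum m.+1 (fun j => ispane (g j) (g j.+1) c i)).
rewrite big_ord_recr /= gm gS // ispaneC; congr (_ (+) _).
by apply: eq_bigr => j _; rewrite !gS ?addnS ?ltnS // ltnW.
Qed.

Variables (c0 : cell) (i0 : dir) (a b : nat).
Hypotheses (c0S : c0 \in S) (n0S : nb c0 i0 \in S).
Hypotheses (ab : (a < b)%N) (bn : (b < n)%N) (hab : ispane (f a) (f b) c0 i0).

(** One arc of the curve, closed up by the chord, has a winding parity; S1 consists of the cells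
    where it differs from its value outside S, and S2 is the rest of S. *)
Lemma curve_split : exists (S1 S2 : {fset cell}) n1 f1 n2 f2 c1,
  [/\ curve S1 n1 f1, curve S2 n2 f2, forall c, (c \in S1) (+) (c \in S2) = (c \in S),
      forall c, c \in S1 -> c \notin S2 &
      [/\ c1 \in S1, nb c1 i0 \in S2 & forall c i, c \in S1 -> nb c i \in S2 -> c = c1 /\ i = i0]].
Proof.
pose m := (b - a)%N; pose m' := (n - b + a)%N.
have em : (a + m)%N = b by rewrite /m subnKC // ltnW.
have em' : (b + m')%N = (a + n)%N by rewrite /m' addnA subnKC 1?addnC // ltnW.
have fm' : f (b + m')%N = f a by rewrite em' (cu_per hf).
pose g j := f (a + j %% m.+1)%N; pose w := winding m.+1 g.
pose E c i := ispane (f a) (f b) c i.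
have EP c i : E c i -> i = i0 /\ (c = c0 \/ c = nb c0 i0) by exact: ispane_uniq.
have ES c i : E c i -> c \in S /\ nb c i \in S by move=> /EP[-> [->|->]]; rewrite ?nbK.
have mn : (m < n)%N by apply: leq_ltn_trans bn; exact: leq_subr.
have gS j : (j < m.+1)%N -> g j = f (a + j)%N by move=> jm; rewrite /g modn_small.
have gm : g m.+1 = f a by rewrite /g modnn addn0.
have wj c i : jump w c i = arc a m c i (+) E c i.
  rewrite /jump /w winding_jump ?gm ?gS ?addn0 //.
    rewrite big_ord_recr /= gm gS // em ispaneC; congr (_ (+) _).
    by apply: eq_bigr => j _; rewrite !gS ?addnS ?ltnS // ltnW.
  move=> j; rewrite ltnS leq_eqVlt => /predU1P[->|jm].
    by rewrite gm gS // em; exists c0, i0; rewrite ispaneC.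
  by rewrite (gS j.+1) // (gS j) ?addnS; [exact: cu_adj hf _|rewrite ltnS ltnW].
have wS z k : jump w z k -> jump (mem S) z k || E z k.
  by rewrite wj; case: (E z k); rewrite ?orbT // addbF orbF; exact: arc_jump.
(* The cells outside S of odd winding jump only at boundary panes of S, so by [jordan] the parity is
   a constant [b'] outside S. *)
have [z k|b' [e he]] := jordan hf (A := fun c => w c && (c \notin S)).
  have := wS z k; have := @ES z k; rewrite /jump /=.
  case: (w z); case: (w (nb z k)); case: (z \in S); case: (nb z k \in S); case: (E z k) =>
    //= h1 h2;
    first [by case: (h1 isT)|by move: (h2 isT)].
have {he} wout c : c \notin S -> w c = b'.
  move=> cS; have := he c; have := he c0; rewrite c0S (negbTE cS) !andbF !andbT /= addbF => _.
  by move=> ->.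
pose v c := w c (+) b'; have vS c : v c -> c \in S.
  by apply: contraTT => /wout; rewrite /v => ->; rewrite addbb.
have vj c i : jump v c i = arc a m c i (+) E c i by rewrite -wj /jump /v addbACA addbb addbF.
have in1 c : (c \in [fset c in S | v c]) = v c.
  by rewrite !inE /=; case: (boolP (v c)) => h; rewrite ?andbF // (vS _ h).
have in2 c : (c \in [fset c in S | ~~ v c]) = (c \in S) (+) v c.
  by rewrite !inE /=; case: (boolP (v c)) => h; [rewrite (vS _ h)|rewrite andbT addbF].
have interior c i : c \in S -> nb c i \in S -> jump v c i = E c i.
  move=> h1 h2; rewrite vj; case: (boolP (arc a m c i)) => // /arc_jump.
  by rewrite /jump /= h1 h2.
have [c1 [v1 v2 c1S n1S]] : exists c1, [/\ v c1, v (nb c1 i0) = false, c1 \in S & nb c1 i0 \in S].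
  have := interior _ _ c0S n0S; rewrite /E hab /jump; case: (boolP (v c0)) => h /=.
    by move/negbTE => h'; exists c0.
  by move=> h'; exists (nb c0 i0); rewrite nbK (negbTE h).
have mem1 : mem [fset c in S | v c] =1 v by move=> c; exact: in1.
exists [fset c in S | v c], [fset c in S | ~~ v c], m.+1, g, m'.+1, (fun j =>
  f (b + j %% m'.+1)%N), c1.
split.
- apply: (@close_arc a m _ c0 i0) => //; first by rewrite em ispaneC.
    by exists c1; rewrite in1.
  by move=> c i; rewrite em -vj /jump /= !in1.
- apply: (@close_arc b m' _ c0 i0) => //.
  + by rewrite /m'; clear -ab bn; lia.
  + by rewrite fm'.
  + by exists (nb c1 i0); rewrite in2 n1S v2.
  move=> c i; rewrite fm' -(ispaneC (f a)) -/(E c i); have := arc_cat a m m' c i.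
  rewrite em /m' /m (_ : (b - a + (n - b + a) = n)%N); last by clear -ab bn; lia.
  rewrite arc_shift -/m -/m' => ea; have := vj c i; move: ea; rewrite /jump /= !in2.
  case: (arc a m c i); case: (arc b m' c i); case: (E c i); case: (v c); case: (v (nb c i)); case:
    (c \in S); case: (nb c i \in S); by [].
- by move=> c; rewrite in1 in2; case: (v c); case: (c \in S).
- by move=> c; rewrite in1 in2 => h; rewrite h (vS _ h).
split; rewrite ?in1 ?in2 ?v2 ?addbF // => c i; rewrite in1 in2 => h1 h2.
have h3 : nb c i \in S by move: h2; case: (boolP (v (nb c i))) => [/vS ->|_] //; rewrite addbF.
have nv : v (nb c i) = false by move: h2; rewrite h3; case: (v _).
have := interior c i (vS _ h1) h3; rewrite /jump h1 nv => /esym/EP[ei ec].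
have [e1 e2] : i0 = i /\ (c1 = c \/ c1 = nb c i).
  have := interior c1 i0 c1S n1S; rewrite /jump v1 v2 => /esym E1.
  have := interior c i (vS _ h1) h3; rewrite /jump h1 nv => /esym E2; exact: ispane_uniq E2 E1.
by split=> //; case: e2 => // e2; rewrite e2 nv in v1.
Qed.
End Cut.

(** * Orbits and bounces of the two halves *)

Lemma imset_porbit (T1 T : finType) (p1 : {perm T1}) (p : {perm T}) (f : T1 -> T) :
  (forall x, p (f x) = f (p1 x)) -> forall x, f @: porbit p1 x = porbit p (f x).
Proof.
move=> h x; have hk k : (p ^+ k)%g (f x) = f ((p1 ^+ k)%g x).
  by elim: k => [|k IH]; rewrite ?expg0 ?perm1 // !expgSr !permM IH h.
apply/setP => y; apply/imsetP/porbitP => [[z /porbitP[k ->] ->]|[k ->]]; first by exists k;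
  rewrite hk.
by exists ((p1 ^+ k)%g x); rewrite ?hk // mem_porbit.
Qed.

Lemma card_porbits_sum (T1 T2 T : finType) (p1 : {perm T1}) (p2 : {perm T2}) (p : {perm T})
    (f1 : T1 -> T) (f2 : T2 -> T) : injective f1 -> injective f2 ->
  (forall x, p (f1 x) = f1 (p1 x)) -> (forall x, p (f2 x) = f2 (p2 x)) ->
  (forall x y, f1 x <> f2 y) -> (forall z, (exists x, z = f1 x) \/ (exists y, z = f2 y)) ->
  #|porbits p| = (#|porbits p1| + #|porbits p2|)%N.
Proof.
move=> i1 i2 h1 h2 dis cov.
rewrite -(card_imset _ (imset_inj i1)) -(card_imset _ (imset_inj i2)) -cardsUI.
have -> : [set f1 @: (x : {set T1}) | x in porbits p1] :&: [set f2 @: (x :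
  {set T2}) | x in porbits p2] = set0.
  apply/setP => X; rewrite !inE; apply/negbTE/negP => /andP[/imsetP[Y /imsetP[x _ ->] ->]].
  case/imsetP => Z _ /setP/(_ (f1 x)); rewrite imset_f ?porbit_id // => /esym/imsetP[z _] e.
  exact: dis e.
rewrite cards0 addn0; apply: eq_card => X; rewrite in_setU; apply/imsetP/orP => [[z _ ->]|].
  case: (cov z) => [[x ->]|[x ->]]; [left|right].
    by rewrite -(imset_porbit h1); exact/imset_f/imset_f.
  by rewrite -(imset_porbit h2); exact/imset_f/imset_f.
case=> /imsetP[Y /imsetP[x _ ->] ->]; [exists (f1 x)|exists (f2 x)] => //; exact: imset_porbit.
Qed.

(** Inverse of [ex c]: the direction in which a beam leaves [c] through pane [i]. *)
Definition dex (c : cell) (i : dir) : dir := if c.2 then tau i else tau' i.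

Lemma ex_dex c i : ex c (dex c i) = i. Proof. by rewrite /ex /dex; case: c.2; case: i. Qed.
Lemma dex_ex c d : dex c (ex c d) = d. Proof. by rewrite /ex /dex; case: c.2; case: d. Qed.
Lemma dex_nb c i : dex (nb c i) i = rf c (dex c i).
Proof. by rewrite /dex /rf nb_up; case: c.2; case: i. Qed.

Section Half.
Variables (S A B : {fset cell}) (i0 : dir).
Notation dart := (S * dir)%type.
Hypotheses (AS : forall c, c \in A -> c \in S) (SAB : forall c, c \in S -> c \in A \/ c \in B).
Hypothesis AB : forall c, c \in A -> c \notin B.
Variables (x1 x2 : dart).
Hypotheses (B2 : pc x2 \in B) (e2 : pc x2 = nb (pc x1) i0).
Hypotheses (d1 : x1.2 = dex (pc x1) i0) (d2 : x2.2 = dex (pc x2) i0).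
Hypothesis one : forall c i, c \in A -> nb c i \in B -> c = pc x1 /\ i = i0.

Definition emb (y : A * dir) : dart := ([` AS (valP y.1)], y.2).

Lemma emb_inj : injective emb.
Proof.
move=> [c d] [c' d'] e; have e1 := congr1 (fun x => val x.1) e; have e2' := congr1 snd e.
by move: e1 e2'; rewrite /emb /= => /val_inj -> ->.
Qed.

Lemma emb_x1 y : pc y = pc x1 -> y.2 = x1.2 -> emb y = x1.
Proof. by move=> h1 h2; exact: dart_eq. Qed.

Lemma cross_x1 y : nxt y \in B -> emb y = x1.
Proof.
move=> h; have [h1 h2] := one (valP y.1) h.
by apply: emb_x1 => //; rewrite d1 -(dex_ex (pc y) y.2) h2 -/(pc y) [pc y]h1.
Qed.

(** [x1] and [x2] cross the cut pane from its two sides, and the image of each under [rho] is what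
    reflecting the other would give. Exchanging them first turns both crossings into reflections, as
    in the separate halves. *)
Lemma rho_emb y : (tperm x1 x2 * rho)%g (emb y) = emb (rho y).
Proof.
rewrite permM; have [ey|ny] := eqVneq (emb y) x1.
  have py : pc y = pc x1 by rewrite -ey.
  have dy : y.2 = x1.2 by rewrite -ey.
  have n2 : nb (pc x2) i0 = pc x1 by rewrite e2 nbK.
  rewrite ey tpermL rho_bd; last first.
    by rewrite /bd /nxt py dy d1 ex_dex -e2; apply/negP => /AB; rewrite B2.
  have [|p1 p2] := @rho_str S x2; first by rewrite /bd /nxt d2 ex_dex n2 negbK; exact: pcS.
  apply: dart_eq; first by rewrite p1 /nxt d2 ex_dex n2 /pc /= -/(pc y) py.
  by rewrite p2 d2 e2 dex_nb -d1 py /= dy.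
rewrite tpermD; last 2 first.
- by rewrite eq_sym.
- by apply: contraTneq B2 => ->; exact: (AB (valP y.1)).
have enx : nxt (emb y) = nxt y by [].
case: (boolP (bd y)) => h; last first.
  have [p1 p2] := rho_str h; have [|q1 q2] := @rho_str S (emb y).
    by rewrite /bd enx negbK; apply: AS; rewrite /bd negbK in h.
  by apply: dart_eq; rewrite ?q1 ?q2 ?enx /= ?p2 // -p1.
have hS : bd (emb y).
  rewrite /bd enx; apply/negP => /SAB[hA|hB]; first by move: h; rewrite /bd hA.
  by case/eqP: ny; exact: cross_x1.
by rewrite (rho_bd hS) (rho_bd h); apply: dart_eq.
Qed.

Lemma bd_emb y : bd y -> bd (emb y) || (emb y == x1).
Proof.
move=> h; case: (boolP (bd (emb y))) => //= /negPn/SAB[hA|hB]; first by move: h; rewrite /bd hA.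
by rewrite cross_x1.
Qed.
End Half.

Section Split.
Variables (S S1 S2 : {fset cell}) (c1 : cell) (i0 : dir).
Hypotheses (part : forall c, (c \in S1) (+) (c \in S2) = (c \in S)).
Hypotheses (dis : forall c, c \in S1 -> c \notin S2).
Hypotheses (c1S : c1 \in S1) (n1S : nb c1 i0 \in S2).
Hypothesis one : forall c i, c \in S1 -> nb c i \in S2 -> c = c1 /\ i = i0.

(** The exchanged darts lie in different halves, hence in different cycles of the twisted
    permutation, so undoing the exchange merges two cycles. They are also the only bounces that the
    cut can create. *)
Lemma split_count :
  (#|porbits (@rho S1)| + #|porbits (@rho S2)| = #|porbits (@rho S)| + 1)%N /\
  (#|[set x : S1 * dir | bd x]| + #|[set x : S2 * dir | bd x]| <= #|[set x :
    S * dir | bd x]| + 2)%N.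
Proof.
have dis' c : c \in S2 -> c \notin S1 by move=> h2; apply/negP => /dis; rewrite h2.
have sub1 c : c \in S1 -> c \in S by move=> h; rewrite -part h (negbTE (dis h)).
have sub2 c : c \in S2 -> c \in S by move=> h; rewrite -part h (negbTE (dis' _ h)).
have cov c : c \in S -> c \in S1 \/ c \in S2.
  by rewrite -part; case: (c \in S1) => /=; [left|right].
have cov' c : c \in S -> c \in S2 \/ c \in S1 by case/cov; [right|left].
pose x1 : S * dir := ([` sub1 _ c1S], dex c1 i0).
pose x2 : S * dir := ([` sub2 _ n1S], dex (nb c1 i0) i0).
have p1 : pc x1 = c1 by []. have p2 : pc x2 = nb c1 i0 by [].
have one' c i : c \in S2 -> nb c i \in S1 -> c = pc x2 /\ i = i0.
  move=> h1 h2; have [|e1 e2] := one h2 (i := i); first by rewrite nbK.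
  by rewrite p2 -e1 -e2 nbK.
have r1 := @rho_emb S S1 S2 i0 sub1 cov dis x1 x2 n1S erefl erefl erefl one.
have r2 : forall y, (tperm x1 x2 * rho)%g (emb sub2 y) = emb sub2 (rho y).
  move=> y; rewrite tpermC; apply: (@rho_emb S S2 S1 i0 sub2 cov' dis' x2 x1) => //.
  by rewrite p2 nbK.
have nd x y : emb sub1 x <> emb sub2 y.
  by move=> e; have := dis (valP x.1); have := congr1 (fun z => pc z) e; rewrite /pc /= => ->;
    rewrite (valP y.1).
have cv z : (exists x, z = emb sub1 x) \/ (exists y, z = emb sub2 y).
  case: (cov _ (valP z.1)) => h; [left; exists ([` h], z.2)|right; exists ([` h], z.2)];
    by apply: dart_eq.
split.
  have := card_porbits_sum (@emb_inj _ _ sub1) (@emb_inj _ _ sub2) r1 r2 nd cv.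
  set s := (tperm x1 x2 * rho)%g => es.
  have := porbits_mul_tperm s x1 x2; rewrite /= {1}/s mulgA tperm2 mul1g.
  have -> : x1 != x2 by apply/eqP => e; have := dis c1S; rewrite -p1 e p2 n1S.
  have -> : x1 \notin porbit s x2.
    pose y2 : S2 * dir := ([` n1S], x2.2).
    have -> : x2 = emb sub2 y2 by exact: dart_eq.
    rewrite -(imset_porbit r2); apply/imsetP => -[y _] e.
    by have := dis c1S; rewrite -p1 e (valP y.1).
  by rewrite es => e; apply/eqP; rewrite -(eqn_add2r 1) -[X in X == _]e -addnA.
rewrite -(card_imset _ (@emb_inj _ _ sub1)) -(card_imset _ (@emb_inj _ _ sub2)) -cardsUI.
rewrite [X in (_ + X)%N](_ : _ = 0%N) ?addn0; last first.
  apply/eqP; rewrite cards_eq0; apply/eqP/setP => z; rewrite !inE; apply/negbTE/negP.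
  by case/andP => /imsetP[x _ ->] /imsetP[y _]; exact: nd.
apply: (@leq_trans #|[set x | bd x] :|: [set x1; x2]|).
  apply: subset_leq_card; apply/subsetP => z /setUP[] /imsetP[y]; rewrite inE => hy ->.
    have := @bd_emb S S1 S2 i0 sub1 cov x1 erefl one y hy.
    by rewrite !inE => /orP[->|->]; rewrite ?orbT.
  have := @bd_emb S S2 S1 i0 sub2 cov' x2 erefl one' y hy.
  by rewrite !inE => /orP[->|->]; rewrite ?orbT.
by apply: leq_trans (leq_card_setU _ _) _; rewrite leq_add2l cards2; case: (x1 != x2).
Qed.
End Split.

Lemma chordP (S : {fset cell}) : chordless S \/ exists c i, [/\ c \in S, nb c i \in S,
  ~~ iv S (vx c (tau i)) & ~~ iv S (vx c (tau' i))].
Proof.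
case: (boolP [exists x : S * dir, [&& nb (val x.1) x.2 \in S, ~~ iv S (vx (val x.1) (tau x.2))
    & ~~ iv S (vx (val x.1) (tau' x.2))]]) => [/existsP[x /and3P[h1 h2 h3]]|].
  by right; exists (val x.1), x.2; split=> //; exact: valP.
rewrite negb_exists => /forallP h; left=> c i cS nS; have := h ([` cS], i).
by rewrite /= nS /= -negb_or negbK.
Qed.

Lemma curve_bound (S : {fset cell}) n f : curve S n f ->
  (7 * #|porbits (@rho S)| <= 2 * #|[set x : S * dir | bd x]| + 3)%N.
Proof.
have [m] := ubnP #|` S|; elim: m S n f => // m IH S n f hm hf.
case: (chordP S) => [cf|[c [i [cS nS h1 h2]]]].
  exact: chordless_bound (curve_connected hf) (curve_potentials hf) (curve_filled hf) cf.
have [j0 e1] := boundary_vertex hf cS h1; have [k0 e2] := boundary_vertex hf cS h2.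
have n0 : (0 < n)%N by apply: leq_trans (cu_ge3 hf).
pose j := (j0 %% n)%N; pose k := (k0 %% n)%N.
have jn : (j < n)%N by rewrite ltn_mod. have kn : (k < n)%N by rewrite ltn_mod.
have fj : f j = vx c (tau i) by rewrite -e1; apply: (cu_mod hf); rewrite modn_mod.
have fk : f k = vx c (tau' i) by rewrite -e2; apply: (cu_mod hf); rewrite modn_mod.
have hp : ispane (f j) (f k) c i by rewrite fj fk ispane_vx.
have [S1 [S2 [n1 [f1 [n2 [f2 [c1 [hf1 hf2 part dis [c1S n1S one]]]]]]]]] :
    exists (S1 S2 : {fset cell}) n1 f1 n2 f2 c1,
  [/\ curve S1 n1 f1, curve S2 n2 f2, forall c, (c \in S1) (+) (c \in S2) = (c \in S),
      forall c, c \in S1 -> c \notin S2 &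
      [/\ c1 \in S1, nb c1 i \in S2 & forall z l, z \in S1 -> nb z l \in S2 -> z = c1 /\ l = i]].
  case: (ltngtP j k) => jk.
  - by have := curve_split hf cS nS jk kn hp.
  - by rewrite ispaneC in hp; have := curve_split hf cS nS jk jn hp.
  - by case: (adjacent_neq (ispane_adj hp)); rewrite jk.
have lt (A B : {fset cell}) z : (forall c, c \in A -> c \in S) -> z \in S -> z \notin A ->
    (#|` A| < m)%N.
  move=> AS zS zA; rewrite -ltnS; apply: leq_trans hm; rewrite ltnS; apply: fproper_ltn_card.
  rewrite fproperE; apply/andP; split; first by apply/fsubsetP.
  by apply/negP => /fsubsetP/(_ z zS); rewrite (negbTE zA).
have l1 : (#|` S1| < m)%N.
  apply: (lt S1 S2 (nb c1 i)); last by apply/negP => /dis; rewrite n1S.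
    by move=> z zS; rewrite -part zS (negbTE (dis _ zS)).
  by rewrite -part n1S addbT; apply/negP => /dis; rewrite n1S.
have l2 : (#|` S2| < m)%N.
  apply: (lt S2 S1 c1); last exact: dis.
    by move=> z zS; rewrite -part zS addbT; apply/negP => /dis; rewrite zS.
  by rewrite -part c1S (negbTE (dis _ c1S)).
have b1 := IH _ _ _ l1 hf1; have b2 := IH _ _ _ l2 hf2.
have [ec eb] := split_count part dis c1S n1S one.
move: b1 b2 ec eb; clear.
move: (#|porbits (@rho S1)|) (#|porbits (@rho S2)|) (#|porbits (@rho S)|) => p1 p2 p.
by move: (#|[set x : S1 * dir | bd x]|) (#|[set x : S2 * dir | bd x]|) (#|[set x :
  S * dir | bd x]|) => b1 b2 b; lia.
Qed.

(** * Grid polygons *)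

Lemma cornersP x c : reflect (exists k, x = vx c k) (x \in corners c).
Proof.
case: c => [[a b] u]; apply: (iffP idP) => [|[k ->]].
  case: x => [x y]; rewrite in_corners; case: u => /or3P[] /andP[/eqP-> /eqP->];
     [exists NE|exists W|exists SE|exists W|exists NE|exists SE]; by [].
by case: u; case: k; rewrite in_corners ?eqxx ?orbT.
Qed.

Lemma ispane_corners x y c i : ispane x y c i -> [/\ x != y, x \in corners c & y \in corners c].
Proof.
move=> h; split; first by apply/eqP/adjacent_neq; exists c, i.
  by apply/cornersP; case/orP: h => /andP[/veqP-> _]; eexists.
by apply/cornersP; case/orP: h => /andP[_ /veqP->]; eexists.
Qed.

Lemma corners_ispane x y c : x != y -> x \in corners c -> y \in corners c -> exists i,
  ispane x y c i.
Proof.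
move=> n /cornersP[k ek] /cornersP[l el]; rewrite ek el in n *.
have [i [[-> ->]|[-> ->]]] : exists i, k = tau i /\ l = tau' i \/ k = tau' i /\ l = tau i.
- by case: k n {ek} => n; case: l n {el} => n; rewrite ?eqxx // in n *;
    first [by exists NE; left|by exists NE; right|by exists W; left|by exists W;
      right|by exists SE; left|by exists SE; right].
- by exists i; exact: ispane_vx.
by exists i; rewrite ispaneC ispane_vx.
Qed.

Definition mid (c : cell) (k : dir) : vec := vx c (tau k) + vx c (tau' k).

Lemma ispane_mid x y c i : ispane x y c i -> x + y = mid c i.
Proof. by case/orP => /andP[/veqP-> /veqP->] //; rewrite addrC. Qed.

Lemma mid_midpoints c k : mid c k \in midpoints c.
Proof. by have [h1 h2 h3] := ispane_corners (ispane_vx c k); exact: pane_mid. Qed.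

Lemma mid_nb c k : mid (nb c k) k = mid c k.
Proof. by rewrite /mid vx_nb1 vx_nb2 addrC. Qed.

Definition dvec (d : dir) : vec := match d with NE => northeast | W => west | SE => southeast end.

Lemma mid_ex_rf c d : mid c (ex c d) = mid c (rf c d) + dvec d.
Proof.
by case: c => [[a b] []]; case: d; rewrite /mid /ex /rf /= !addvE; congr (_, _); lia.
Qed.

Lemma rf_nb_ex c d : rf (nb c (ex c d)) d = ex c d.
Proof. by rewrite /rf /ex nb_up; case: c.2; case: d. Qed.

Lemma rf_rf c d : rf c (rf c d) = ex c d.
Proof. by rewrite /rf /ex; case: c.2; case: d. Qed.

Lemma dvecP d : dvec d \in beam_directions. Proof. by case: d. Qed.

Section Link.
Variable P : grid_polygon.
Notation S := (cells P).
Notation dart := (S * dir)%type.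
Implicit Types (i j : 'I_(perim P)) (x y : dart).

(** A pane is a side of exactly two cells, [c] and [nb c k]. *)
Lemma boundary_jump c k : boundary_pane S (vx c (tau k)) (vx c (tau' k)) = jump (mem S) c k.
Proof.
have [n h1 h2] := ispane_corners (ispane_vx c k); rewrite /boundary_pane n /=.
set A := [fset _ in _ | _].
have inA z : (z \in A) = (z \in S) && ((z == c) || (z == nb c k)).
  rewrite !inE /=; congr (_ && _); apply/andP/orP => [[g1 g2]|].
    have [l /(ispane_uniq (ispane_vx c k))[_ [->|->]]] := corners_ispane n g1 g2; rewrite eqxx;
      by [left|right].
  case=> /eqP->; first by split.
  by have := ispane_vx c k; rewrite -ispane_nb => /ispane_corners[].
have nc : c != nb c k by apply/eqP => e; have := nb_up c k; rewrite -e; case: c.2.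
rewrite /jump /=; case: (boolP (c \in S)) => hc; case: (boolP (nb c k \in S)) => hn /=.
- apply/negbTE/cardfs1P => -[z eA]; have := inA c; have := inA (nb c k);
  rewrite eA !inE hc hn !eqxx orbT /=.
  by move=> /eqP e1 /eqP e2; case/eqP: nc; rewrite e1 e2.
- apply/cardfs1P; exists c; apply/fsetP => z; rewrite inA inE.
  by case: eqVneq => [->|_]; rewrite ?hc //=; case: eqVneq => [->|]; rewrite ?andbF // (negbTE hn).
- apply/cardfs1P; exists (nb c k); apply/fsetP => z; rewrite inA inE.
  case: (eqVneq z c) => [->|_] /=; first by rewrite (negbTE hc) (negbTE nc).
  by case: eqVneq => [->|_]; rewrite ?andbF // hn.
apply/negbTE/cardfs1P => -[z eA]; have := inA z; rewrite eA !inE eqxx =>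
  /esym/andP[hz /orP[] /eqP e].
  by rewrite e (negbTE hc) in hz.
by rewrite e (negbTE hn) in hz.
Qed.

Hypothesis n0 : (0 < perim P)%N.
Definition bindex (j : nat) : 'I_(perim P) := Ordinal (ltn_pmod j n0).
Definition bcurve (j : nat) : vec := bvertex (bindex j).

Lemma bcurveS (j : nat) : bcurve j.+1 = bvertex (ordS (bindex j)).
Proof.
rewrite /bcurve; congr bvertex; apply: val_inj; rewrite /= -(addn1 (j %% _)) modnDml addn1 //.
Qed.

Lemma bindex_small i : bindex i = i.
Proof. by apply: val_inj; rewrite /= modn_small. Qed.

Lemma pane_ex i : exists c k, ispane (bvertex i) (bvertex (ordS i)) c k.
Proof.
have [c [_ h1 h2 _]] := bpane_cell i; have /andP[n _] := bpane i.
by have [k hk] := corners_ispane n h1 h2; exists c, k.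
Qed.

Lemma jumpP c k : reflect (exists i, ispane (bvertex i) (bvertex (ordS i)) c k) (jump (mem S) c k).
Proof.
rewrite -boundary_jump; apply: (iffP idP) => [/boundaryP[i h]|[i h]].
  by exists i; case: h => [] [<- <-]; rewrite ?ispane_vx // ispaneC ispane_vx.
apply/boundaryP; exists i; case/orP: h => /andP[/veqP-> /veqP->]; by [left|right].
Qed.

Lemma pane_inj i j c k : ispane (bvertex i) (bvertex (ordS i)) c k ->
  ispane (bvertex j) (bvertex (ordS j)) c k -> i = j.
Proof.
move=> /ispane_mid h1 /ispane_mid h2; apply: (@pane_midpoint_inj P).
by rewrite /pane_midpoint h1 h2.
Qed.

(** Different indices give different panes by [pane_inj], so the mod 2 sum in [cu_jump] has at most
    one nonzero term. *)
Lemma polygon_curve : curve S (perim P) bcurve.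
Proof.
split.
- by move=> j; rewrite /bcurve; congr bvertex; apply: val_inj; rewrite /= modnDr.
- by move=> i j /(@bvertex_inj P) /(congr1 val).
- move=> j; rewrite bcurveS; exact: pane_ex.
- move=> c k; apply/jumpP/idP => [[i hi]|].
    rewrite (xsum_one (F := fun m => ispane (bcurve m) (bcurve m.+1) c k) (j := i)) //.
      by rewrite bcurveS /bcurve bindex_small.
    move=> j jn; rewrite bcurveS => hj; have := pane_inj hj hi; move=> /(congr1 val) /=.
    by rewrite modn_small.
  by move/(xsum_true (F := fun m => ispane (bcurve m) (bcurve m.+1) c k)) => [j _];
    rewrite bcurveS => h; exists (bindex j).
case: (fset_0Vmem S) => [e|[c cS]]; first by have := cells_neq0 P; rewrite e eqxx.
by exists c.
Qed.

Lemma pane_dart i : exists x : dart, bd x /\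
  ispane (bvertex i) (bvertex (ordS i)) (pc x) (ex (pc x) x.2).
Proof.
have [c [k h]] := pane_ex i; have : jump (mem S) c k by apply/jumpP; exists i.
have mk z : z \in S -> nb z k \notin S -> ispane (bvertex i) (bvertex (ordS i)) z k ->
    exists x : dart, bd x /\ ispane (bvertex i) (bvertex (ordS i)) (pc x) (ex (pc x) x.2).
  by move=> zS nS hz; exists ([` zS], dex z k); rewrite /bd /nxt /pc /= ex_dex.
rewrite /jump /=; case: (boolP (c \in S)) => cS; case: (boolP (nb c k \in S)) => nS //= _.
  exact: mk h.
by apply: (mk (nb c k)); rewrite ?nbK ?ispane_nb.
Qed.

Lemma dart_uniq x y i : bd x -> bd y -> ispane (bvertex i) (bvertex (ordS i)) (pc x) (ex (pc x) x.2) ->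
  ispane (bvertex i) (bvertex (ordS i)) (pc y) (ex (pc y) y.2) -> x = y.
Proof.
move=> hx hy h1 h2; have [e [ec|ec]] := ispane_uniq h1 h2; last first.
  by move: hx; rewrite /bd /nxt -ec => /negP[]; exact: pcS.
by apply: dart_eq => //; rewrite -(dex_ex (pc x) x.2) -(dex_ex (pc y) y.2) e ec.
Qed.

Lemma dart_pane (x : dart) : bd x -> exists i,
  ispane (bvertex i) (bvertex (ordS i)) (pc x) (ex (pc x) x.2).
Proof. by move=> h; apply/jumpP; rewrite /jump /= pcS. Qed.

Lemma beam_nextb i j x : bd x -> ispane (bvertex i) (bvertex (ordS i)) (pc x) (ex (pc x) x.2) ->
  ispane (bvertex j) (bvertex (ordS j)) (pc (nextb x)) (ex (pc (nextb x)) (nextb x).2) -> beam i j.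
Proof.
move=> hx hi hj; set z := rho x; have ez : z = (x.1, rf (pc x) x.2) by exact: rho_bd.
(* [len z] counts the moves from cell to cell; the beam crosses one cell more. *)
set d := z.2; exists (dvec d), (len z).+1.
have pz : pc z = pc x by rewrite ez.
have line l : (l <= len z)%N -> (iter l rho z).2 = d.
  by move=> ll; have [|-> _ _] := @iter_str S z l => // m /leq_trans/(_ ll); exact: len_min.
have ent l : (l <= len z)%N -> mid (pc (iter l rho z)) (rf (pc (iter l rho z)) d) = pane_midpoint i + dvec d *+ l.
  elim: l => [|l IH] ll.
    by rewrite mulr0n addr0 /= /d ez /= /pc /= -/(pc x) rf_rf /pane_midpoint (ispane_mid hi).
  have [p1 p2] := rho_str (len_min ll);
    rewrite iterS p1 /nxt line 1?ltnW // rf_nb_ex mid_nb mid_ex_rf IH 1?ltnW //.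
  by rewrite mulrSr addrA.
have exi l : (l <= len z)%N -> mid (pc (iter l rho z)) (ex (pc (iter l rho z)) d) = pane_midpoint i + dvec d *+ l.+1.
  by move=> ll; rewrite mid_ex_rf ent // mulrSr addrA.
have [nxy c1 c2] := ispane_corners hi.
apply/and5P; split=> //.
- exact: dvecP.
- apply: (mid_angle (dvecP d) nxy c1 c2); have := exi 0%N (leq0n _); rewrite mulr1n /= pz => <-.
  exact: mid_midpoints.
- rewrite /pane_midpoint (ispane_mid hj) -exi // /nextb -/z.
  have [e _ _] := finP z; rewrite e -/d; exact/eqP.
apply/forallP => l; apply/litP; exists (pc (iter l rho z)).
have ll : (l <= len z)%N := ltn_ord l.
by split; [exact: pcS|rewrite -(ent _ ll) mid_midpoints|rewrite -(exi _ ll) mid_midpoints].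
Qed.

(** [X i] is the dart that bounces at pane [i]. This injection covers all bounces and conjugates
    [billiards P] to [nextb], so each cycle of [billiards P] is the preimage of an orbit of
    [rho]. *)
Lemma perim_cyc : (#|[set x : dart | bd x]| <= perim P)%N /\ (cyc P <= #|porbits (@rho S)|)%N.
Proof.
have [X hX] := fin_all_exists pane_dart.
have Xb i : bd (X i) := proj1 (hX i).
have Xs x : bd x -> exists i, x = X i.
  by move=> hx; have [i hi] := dart_pane hx; exists i; apply: dart_uniq hi (proj2 (hX i)).
have Xi : injective X by move=> i j e; apply: pane_inj (proj2 (hX i)) _; rewrite e; exact:
  (proj2 (hX j)).
have Xn i : nextb (X i) = X (billiards P i).
  have [j ej] := Xs _ (nextb_bd (X i)); rewrite ej; congr X; apply/esym/billiardsP.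
  by apply: (beam_nextb (Xb i) (proj2 (hX i))); rewrite ej; exact: (proj2 (hX j)).
have Xr r i : iter r (@nextb _) (X i) = X ((billiards P ^+ r)%g i).
  by elim: r => [|r IH]; rewrite ?expg0 ?perm1 // iterS IH Xn expgSr permM.
split.
  rewrite -[X in (_ <= X)%N]card_ord -(card_imset _ Xi); apply: subset_leq_card.
  by apply/subsetP => x; rewrite inE => /Xs[i ->]; exact: imset_f.
apply: leq_trans (leq_imset_card (fun O : {set dart} => [set i | X i \in O]) _).
apply: subset_leq_card; apply/subsetP => O /imsetP[i _ ->]; apply/imsetP.
exists (porbit rho (X i)); first exact: imset_f.
apply/setP => j; rewrite inE; apply/porbitP/idP => [[r ->]|h].
  by rewrite -Xr iter_nextb_porbit.
by have [r _] := bd_orbit (Xb i) h (Xb j); rewrite Xr => /Xi ->; exists r.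
Qed.
End Link.

Theorem theorem1p2 (P : grid_polygon) :
  ((perim P)%:R >= 7 / 2 * (cyc P)%:R - 3 / 2 :> rat)%R.
Proof.
suff h : (7 * cyc P <= 2 * perim P + 3)%N.
  have : (7 * cyc P)%:R <= (2 * perim P + 3)%:R :> rat by rewrite ler_nat.
  by rewrite natrD !natrM; lra.
have [e|n0] := posnP (perim P).
  suff -> : cyc P = 0%N by [].
  apply/eqP; rewrite cards_eq0; apply/eqP/setP => O; rewrite inE; apply/negbTE/imsetP => -[i].
  by case: i => i h; exfalso; rewrite e in h.
have [h1 h2] := perim_cyc P; have := curve_bound (polygon_curve n0).
move: h1 h2; clear.
move: (#|[set x : cells P * dir | bd x]|) (#|porbits (@rho (cells P))|) => b c; lia.
Qed.
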